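(* Let $\epsilon>0$ and $\kappa\in\mathbb{R}$, and consider an FLRW spacetime with spatial curvature $\kappa$ whose scale factor $a$ is smooth and positive for $t>0$ and, near the singularity $t_0=0$, has the form $a(t)=t^{1/\epsilon}$ (for $0<t<\delta$, some $\delta>0$). Assume that one of the following holds: (i) $0<\epsilon<1$ and $\kappa>0$; (ii) $\epsilon>1$ or $\kappa=0$; (iii) $\epsilon=1$ and $\kappa>-1$. Then for every $C>0$ there is $t_1>0$ such that $$\lim_{t\to 0^+}\int_{t}^{t_1}a(t')\int_{t'}^{t_1}\frac{1}{a}\left[\frac{\ddot a}{a}-\frac{\dot a^{2}}{a^{2}}-\frac{\kappa}{a^{2}}\right]dt''\,dt'=-\infty \qquad\text{and}\qquad \lim_{t\to 0^+}\int_{t}^{t_1}f_+\,dt'\in\mathbb{R}_{\ge0},$$ where $f=3\ddot a+\frac{2C}{a}\left[\frac{\ddot a}{a}-\frac{\dot a^{2}}{a^{2}}-\frac{\kappa}{a^{2}}\right]$ and $f_+=\max(f,0)$. Consequently, every point $\gamma(\tau(t_2))$, $t_2>0$, on every non-comoving, non-spacelike geodesic $\gamma$ of the spacetime is conjugate, in the generalized sense defined in the context, to a point $\gamma(\tau(t'))$ with $0\le t'<t_2$.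
   Context: FLRW spacetime: the metric is, in spherical coordinates, $$ds^2=-dt^2+a(t)^2\left[\frac{dr^2}{1-\kappa r^2}+r^2\left(d\theta^2+\sin^2\theta\,d\varphi^2\right)\right],$$ i.e. $-dt^2+a(t)^2h$ with $h$ a Riemannian metric of constant curvature $\kappa$ on a three-dimensional space. Dots on $a$ denote $d/dt$. The time $t_0=0$, where $a$ vanishes, is the singularity, where the metric degenerates. The scale factor is normalized to equal $1$ at some time. Geodesics: a geodesic $\gamma(\tau)$, with $\tau$ an affine parameter (proper time in the timelike case), satisfies $$\frac{dt}{d\tau}=\frac{\sqrt{C-\epsilon_{\mathrm n}a^2}}{a},$$ with $\epsilon_{\mathrm n}=g(\dot\gamma,\dot\gamma)$ equal to $0$ for null geodesics and $-1$ for timelike geodesics. Here $C\ge 0$ is the constant equal to $a^2 g_{ij}\dot\gamma^i\dot\gamma^j$ (spatial indices $i,j$). The geodesic is non-comoving if $C>0$; it can then be parametrized by $t$ and is taken to be defined for all $t$ from the singularity $t_0=0$ (excluded) up to and including the times considered. Curvature convention: $R(X,Y)Z=\nabla_X\nabla_YZ-\nabla_Y\nabla_XZ-\nabla_{[X,Y]}Z$. A Jacobi field along $\gamma$ is a vector field $J$ with $D_\tau^2J+R(J,\dot\gamma)\dot\gamma=0$, where $D_\tau$ is covariant differentiation along $\gamma$. Jacobi tensor based at $\gamma(\tau_2)$, where $\tau_2=\tau(t_2)$: - Timelike case: let $\{E_0=\dot\gamma,E_1,E_2,E_3\}$ be a parallel orthonormal frame along $\gamma$, and let $J_i$ ($i=1,2,3$)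 be the Jacobi field with $J_i(\tau_2)=0$ and $D_\tau J_i(\tau_2)=E_i(\tau_2)$. Let $A(\tau)$ be the $3\times3$ matrix with entries $A^k{}_l=(J_l)^k$, the components in the frame $E_1,E_2,E_3$. - Null case: let $N(\gamma)$ be the bundle of vectors along $\gamma$ orthogonal to $\dot\gamma$ and let $\bar N(\gamma)=N(\gamma)/\langle\dot\gamma\rangle$ (rank 2), with the induced covariant derivative and the induced endomorphism $\bar R_\gamma(\bar v)=\overline{R(v,\dot\gamma)\dot\gamma}$. Let $\bar A(\tau)$ be the endomorphism field of $\bar N(\gamma)$ with $D_\tau^2\bar A+\bar R_\gamma\bar A=0$, $\bar A(\tau_2)=0$, $D_\tau\bar A(\tau_2)=I$; it is a $2\times2$ matrix in a parallel frame. Generalized conjugate points: for $t'>0$, $t'\ne t_2$, the point $\gamma(\tau(t'))$ is conjugate to $\gamma(\tau(t_2))$ if $\det A=0$ (respectively $\det\bar A=0$ in the null case) at $t'$. For $t'=0$ (the singularity), $\gamma(\tau(t_2))$ is said to be conjugate to the point of $\gamma$ at $t_0=0$ if $\det A(\tau(t))\to0$ (respectively $\det\bar A(\tau(t))\to0$) as $t\to0^+$. *)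

(* Defs.v *)
From HB Require Import structures.
From mathcomp Require Import all_boot all_order all_algebra.
From mathcomp Require Import all_classical all_reals all_analysis.

Set Implicit Arguments.
Unset Strict Implicit.
Unset Printing Implicit Defensive.

Import Order.TTheory GRing.Theory Num.Theory.
Import numFieldNormedType.Exports.

Local Open Scope classical_set_scope.
Local Open Scope ring_scope.

(* Conventions.  The components of a tangent vector in a chart form a row
   vector; as in the library, the Jacobian matrix J of a map f acts on row
   vectors on the right, i.e., 'd f x v = v *m J.  Indices start at 0. *)

Section LocalGeometry.
Variables (R : realType) (n : nat).
Implicit Types (g : 'rV[R]_n -> 'M[R]_n) (x u v w : 'rV[R]_n).

Definition partial (i : 'I_n) (f : 'rV[R]_n -> R) : 'rV[R]_n -> R :=
  fun x => 'D_(delta_mx 0 i) f x.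

(* C^oo on U, for U open *)
Definition smooth_on (U : set 'rV[R]_n) (f : 'rV[R]_n -> R) :=
  forall (s : seq 'I_n) x, U x -> differentiable (foldr partial f s) x.

Definition inner (G : 'M[R]_n) u v : R := (u *m G *m v^T) 0 0.

(* Gamma^k_{ij} *)
Definition christoffel g (k i j : 'I_n) x : R :=
  2^-1 * \sum_(l < n) invmx (g x) k l *
    (partial i (fun y => g y j l) x + partial j (fun y => g y i l) x
     - partial l (fun y => g y i j) x).

(* The l-th component of R(e_i, e_j) e_k, for the curvature
   R(X,Y)Z = nabla_X nabla_Y Z - nabla_Y nabla_X Z - nabla_[X,Y] Z. *)
Definition riemann_coef g (l k i j : 'I_n) x : R :=
  partial i (christoffel g l j k) x - partial j (christoffel g l i k) x
  + \sum_(m < n) (christoffel g l i m x * christoffel g m j k x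
                  - christoffel g l j m x * christoffel g m i k x).

(* R(u,v)w at x *)
Definition riemann g x u v w : 'rV[R]_n :=
  \row_(l < n) \sum_(i < n) \sum_(j < n) \sum_(k < n)
    riemann_coef g l k i j x * u 0 i * v 0 j * w 0 k.

Definition plane_area2 (G : 'M[R]_n) u v : R :=
  inner G u u * inner G v v - inner G u v ^+ 2.

Definition sectional g x u v : R :=
  inner (g x) (riemann g x u v v) u / plane_area2 (g x) u v.

End LocalGeometry.

(* The data of an atlas and of the components of a metric in each chart: chart
   i is the map crd i : dom i -> 'rV_n, with inverse pnt i, and gmx i x is the
   matrix of the metric at the point of coordinates x.  The values of crd, pnt
   and gmx outside the chart are irrelevant. *)
Record metric_atlas (R : realType) (n : nat) := MetricAtlas {
  pt : topologicalType;
  idx : Type;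
  dom : idx -> set pt;
  crd : idx -> pt -> 'rV[R]_n;
  pnt : idx -> 'rV[R]_n -> pt;
  gmx : idx -> 'rV[R]_n -> 'M[R]_n
}.

Section Manifold.
Variables (R : realType) (n : nat) (M : metric_atlas R n).

Definition transition (i j : idx M) : 'rV[R]_n -> 'rV[R]_n :=
  fun x => crd j (pnt i x).

Definition smooth_manifold :=
  [/\ hausdorff_space (pt M) /\ @second_countable (pt M),
      forall p : pt M, exists i : idx M, dom i p,
      forall i : idx M, open (dom i) /\ open (crd i @` dom i),
      forall (i : idx M) p, dom i p ->
        [/\ pnt i (crd i p) = p, {for p, continuous (crd i)}
          & {for crd i p, continuous (pnt i)}]
    & forall (i j : idx M) (k : 'I_n),
        smooth_on (crd i @` (dom i `&` dom j)) (fun x => transition i j x 0 k)].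

Definition riemannian_metric :=
  [/\ forall (i : idx M) (k l : 'I_n),
        smooth_on (crd i @` dom i) (fun x => gmx i x k l),
      forall (i : idx M) p, dom i p -> (gmx i (crd i p))^T = gmx i (crd i p),
      forall (i : idx M) p u, dom i p -> u != 0 ->
        0 < inner (gmx i (crd i p)) u u
    & forall (i j : idx M) p, dom i p -> dom j p ->
        let Jac := jacobian (transition i j) (crd i p) in
        gmx i (crd i p) = Jac *m gmx j (crd j p) *m Jac^T].

Definition riemannian_manifold := smooth_manifold /\ riemannian_metric.

Definition constant_curvature (kappa : R) :=
  forall (i : idx M) p u v, dom i p -> plane_area2 (gmx i (crd i p)) u v != 0 ->
    sectional (gmx i) (crd i p) u v = kappa.

End Manifold.

Section Curves.
Variables (R : realType) (n : nat) (M : metric_atlas R n).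
(* curves are defined on an open interval D; their values outside are
   irrelevant *)
Variables (D : set R) (gam : R -> pt M).

Definition smooth_fun (f : R -> R) :=
  forall (m : nat) s, D s -> derivable (derive1n m f) s 1.

Definition smooth_curve :=
  [/\ forall s, D s -> {for s, continuous gam},
      forall s, D s -> exists i : idx M, dom i (gam s)
    & forall (i : idx M) (k : 'I_n) (m : nat) s, D s -> dom i (gam s) ->
        derivable (derive1n m (fun r => crd i (gam r) 0 k)) s 1].

(* A family V : idx M -> R -> 'rV_n gives the components V i s, in the chart i,
   of a vector tangent at gam s, when gam s is in the domain of that chart. *)
Definition field := idx M -> R -> 'rV[R]_n.

Definition vector_field (V : field) :=
  (forall (i : idx M) (k : 'I_n) (m : nat) s, D s -> dom i (gam s) ->
     derivable (derive1n m (fun r => V i r 0 k)) s 1) /\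
  (forall (i j : idx M) s, D s -> dom i (gam s) -> dom j (gam s) ->
     V j s = V i s *m jacobian (transition i j) (crd i (gam s))).

Definition velocity : field :=
  fun i s => \row_k derive1 (fun r => crd i (gam r) 0 k) s.

(* covariant derivative along gam *)
Definition covD (V : field) : field :=
  fun i s => \row_k (derive1 (fun r => V i r 0 k) s
    + \sum_(l < n) \sum_(m < n) christoffel (gmx i) k l m (crd i (gam s))
        * velocity i s 0 l * V i s 0 m).

Definition inner_along (V W : field) (i : idx M) s : R :=
  inner (gmx i (crd i (gam s))) (V i s) (W i s).

(* R(V, gam')gam' *)
Definition tidal (V : field) : field :=
  fun i s =>
    riemann (gmx i) (crd i (gam s)) (V i s) (velocity i s) (velocity i s).

Definition along (P : idx M -> R -> Prop) :=
  forall i s, D s -> dom i (gam s) -> P i s.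

Definition geodesic :=
  smooth_curve /\ along (fun i s => covD velocity i s = 0).

Definition causal_character (c : R) :=
  along (fun i s => inner_along velocity velocity i s = c).
Definition timelike := causal_character (-1).
Definition null := causal_character 0.

Definition jacobi_field (J : field) :=
  vector_field J /\
  along (fun i s => covD (covD J) i s + tidal J i s = 0).

(* equality modulo the line spanned by gam' *)
Definition eqmod_velocity (V W : field) i s :=
  exists c : R, V i s = W i s + c *: velocity i s.

Definition comb (m : nat) (c : R -> 'I_m -> R) (E : 'I_m -> field) : field :=
  fun i s => \sum_(k < m) c s k *: E k i s.

(* Together with gam', which is unit timelike and parallel, E is a parallel
   orthonormal frame along the timelike geodesic gam. *)
Definition parallel_orthonormal_frame (E : 'I_n.-1 -> field) :=
  [/\ forall k, vector_field (E k),
      forall k, along (fun i s => covD (E k) i s = 0),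
      forall k, along (fun i s => inner_along (E k) velocity i s = 0)
    & forall k l, along (fun i s => inner_along (E k) (E l) i s = (k == l)%:R)].

(* A s is the matrix (A^k_l), k being the row index. *)
Definition jacobi_matrix (s2 : R) (A : R -> 'M[R]_n.-1) :=
  exists E J : 'I_n.-1 -> field,
  [/\ parallel_orthonormal_frame E,
      forall l, jacobi_field (J l),
      forall l i, dom i (gam s2) -> J l i s2 = 0 /\ covD (J l) i s2 = E l i s2
    & forall l, along (eqmod_velocity (J l) (comb (fun s k => A s k l) E))].

(* Sections of the quotient of gam'^_|_ by the line spanned by gam' are
   represented by vector fields orthogonal to gam', up to eqmod_velocity.  The
   classes of the E k are parallel and form a basis of this quotient, whose
   rank is n - 2. *)
Definition parallel_quotient_frame (E : 'I_n.-2 -> field) :=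
  [/\ forall k, vector_field (E k),
      forall k, along (fun i s => inner_along (E k) velocity i s = 0),
      forall c : 'I_n.-2 -> R,
        along (fun i s =>
          eqmod_velocity (comb (fun=> c) E) (fun _ _ => 0) i s ->
          forall k, c k = 0)
    & forall k, along (eqmod_velocity (covD (E k)) (fun _ _ => 0))].

(* The endomorphism field with matrix A in the quotient frame E maps the class
   of E l to the class of the field V below; since that frame is parallel, the
   covariant derivatives of the endomorphism field are obtained by
   differentiating these classes. *)
Definition quotient_jacobi_matrix (s2 : R) (A : R -> 'M[R]_n.-2) :=
  exists E : 'I_n.-2 -> field,
  [/\ parallel_quotient_frame E,
      forall k l, smooth_fun (fun s => A s k l),
      A s2 = 0
    & forall l, let V := comb (fun s k => A s k l) E in
        along (eqmod_velocity (fun i s => covD (covD V) i s + tidal V i s)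
                              (fun _ _ => 0)) /\
        (forall i, dom i (gam s2) -> eqmod_velocity (covD V) (E l) i s2)].

End Curves.

Section FLRW.
Variables (R : realType) (a : R -> R) (S : metric_atlas R 3).

(* The spacetime ]0, +oo[ x S with the metric - dt^2 + a(t)^2 h, h being the
   metric of S.  The charts are (t, p) |-> (t, crd i p); they do not cover the
   points (t, p) with t <= 0. *)
Definition flrw : metric_atlas R 4 :=
  @MetricAtlas R (1 + 3) (R * pt S)%type (idx S)
    (fun i => [set p | 0 < p.1 /\ dom i p.2])
    (fun i p => row_mx p.1%:M (crd i p.2))
    (fun i x => (lsubmx x 0 0, pnt i (rsubmx x)))
    (fun i x => block_mx (-1)%:M 0 0 (a (lsubmx x 0 0) ^+ 2 *: gmx i (rsubmx x))).

(* smooth and positive for t > 0, and equal to 1 at some time *)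
Definition scale_factor :=
  [/\ smooth_fun [set t | 0 < t] a, forall t, 0 < t -> 0 < a t
    & exists2 t, 0 < t & a t = 1].

Variables (D : set R) (gam : R -> pt flrw).

Definition time (s : R) : R := (gam s).1.

(* a^2 g_ij gam'^i gam'^j, the sum being over spatial indices; it is constant
   along a geodesic *)
Definition spatial_constant (i : idx flrw) (s : R) : R :=
  let x := crd i (gam s) in
  let v := @rsubmx _ 1 1 3 (velocity gam i s) in
  a (time s) ^+ 2 * inner (@drsubmx _ 1 3 1 3 (gmx i x)) v v.

(* D is the domain of the affine parameter; the geodesic is future-directed,
   and every time of D is preceded in D by all the times since the singularity,
   excluded. *)
Definition flrw_geodesic :=
  [/\ open D, is_interval D, geodesic D gam,
      forall s, D s -> 0 < derive1 time s
    & forall s t, D s -> 0 < t <= time s -> exists2 r, D r & time r = t].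

Definition non_comoving :=
  along D gam (fun i s => 0 < spatial_constant i s).

Definition non_spacelike := timelike D gam \/ null D gam.

(* the affine parameter as a function of t *)
Definition tau (t : R) : R := xget 0 [set s | D s /\ time s = t].

Definition vanishes_at (m : nat) (A : R -> 'M[R]_m) (t : R) :=
  (0 < t /\ \det (A (tau t)) = 0) \/
  (t = 0 /\ \det (A (tau r)) @[r --> 0^'+] --> (0 : R)).

(* gam s2 is conjugate, in the generalized sense, to the point of gam at time
   t.  Parallel frames and Jacobi fields exist by the theory of linear ODEs,
   and det A does not depend on the choice of the frame. *)
Definition conjugate (s2 t : R) :=
  (timelike D gam ->
     forall A, jacobi_matrix D gam s2 A -> vanishes_at A t) /\
  (null D gam ->
     forall A, quotient_jacobi_matrix D gam s2 A -> vanishes_at A t).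

End FLRW.

Section Integrands.
Variables (R : realType) (kappa : R) (a : R -> R).

Definition flrw_bracket (t : R) : R :=
  derive1n 2 a t / a t - derive1 a t ^+ 2 / a t ^+ 2 - kappa / a t ^+ 2.

Definition flrw_f (C t : R) : R :=
  3 * derive1n 2 a t + 2 * C / a t * flrw_bracket t.

Definition flrw_f_plus (C t : R) : R := Num.max (flrw_f C t) 0.

End Integrands.

(* Main.v *)
Require Import Defs.
From mathcomp Require Import all_boot all_order all_algebra.
From mathcomp Require Import all_classical all_reals all_analysis.
From mathcomp Require Import ring lra.

(* Along a non-comoving geodesic of an FLRW spacetime the Jacobi equation
   decouples.  With b = a o t and C = b^2 (t'^2 + c0), where c0 = -1 or 0 is the
   causal character, every component X of the Jacobi tensor transverse to the
   plane spanned by the velocity and d/dt is of the form X = b xi, where xi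
   satisfies in the conformal parameter ds / b^2 the equation
   xi'' = - kappa C xi.  Hence xi is bounded if kappa > 0 and grows more slowly
   than 1 / b in the other cases, so that X tends to 0 at the singularity.  In
   the timelike case the remaining component solves X'' = (a'' / a) X, which has
   the explicit solution b t', and by constancy of the Wronskian it stays bounded.
   The direction of this component in a parallel frame E_k is the constant
   vector of entries b (E_k)^0.  Thus det A always tends to 0 and every point is
   conjugate to the singularity t' = 0, whatever the initial conditions of A. *)

Set Implicit Arguments.
Unset Strict Implicit.
Unset Printing Implicit Defensive.

Import Order.TTheory GRing.Theory Num.Theory.
Import numFieldNormedType.Exports.

Local Open Scope classical_set_scope.
Local Open Scope ring_scope.

(** * Pointwise calculus *)

Section PointwiseCalculus.
Context {R : realType} {V : normedModType R}.
Implicit Types (f g : V -> R) (x v : V).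

(** The conditions on [kappa] and [eps] measure how fast [xi] may grow. Since [b t' >= sqrt C], the
    conformal parameter satisfies [ds / b^2 <= dt / (sqrt C b)], so for [kappa < 0] the exponential
    rate [sqrt (- kappa C)] costs at most [sqrt (- kappa) dt / t^p], where [p = 1 / eps]. This is
    integrable if [p < 1]; if [p = 1] it yields the growth [t^(- sqrt (- kappa))], which is slower
    than [1 / b = 1 / t] exactly when [kappa > -1]. For [kappa = 0] the growth is linear in the
    conformal parameter, and for [kappa > 0] an energy is conserved, so that every [p] is allowed.
    The obstacle in the timelike case is the longitudinal component, which is only bounded. With [P]
    the projection onto the transverse plane, [2 det A = tr (P A adj A)] exhibits the determinant as
    a combination of transverse entries with bounded coefficients. Curvature is computed with
    Christoffel symbols of the first kind tested against vectors, so that the product structure of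
    the metric is used without splitting indices. *)

Lemma differentiable_addf f g x : differentiable f x -> differentiable g x ->
  differentiable (fun y => f y + g y) x.
Proof. exact: differentiableD. Qed.

Lemma differentiable_subf f g x : differentiable f x -> differentiable g x ->
  differentiable (fun y => f y - g y) x.
Proof. exact: differentiableB. Qed.

Lemma differentiable_mulf f g x : differentiable f x -> differentiable g x ->
  differentiable (fun y => f y * g y) x.
Proof. exact: differentiableM. Qed.

Lemma differentiable_constf (c : R) x : differentiable (fun _ : V => c) x.
Proof. exact: differentiable_cst. Qed.

Lemma differentiable_sumf (I : Type) (r : seq I) (P : pred I) (f : I -> V -> R) x :
  (forall i, P i -> differentiable (f i) x) ->
  differentiable (fun y => \sum_(i <- r | P i) f i y) x.
Proof.
move=> df; elim: r => [|i r IH].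
  have -> : (fun y => \sum_(i <- [::] | P i) f i y) = cst 0.
    by apply/funext => y; rewrite big_nil.
  exact: differentiable_cst.
have -> : (fun y => \sum_(j <- i :: r | P j) f j y) =
    if P i then (fun y => f i y + \sum_(j <- r | P j) f j y)
    else (fun y => \sum_(j <- r | P j) f j y).
  by apply/funext => y; rewrite big_cons; case: ifP.
case: ifP => // Pi; apply: differentiable_addf => //; exact: df.
Qed.

Lemma differentiable_prodf (I : Type) (r : seq I) (P : pred I) (f : I -> V -> R) x :
  (forall i, P i -> differentiable (f i) x) ->
  differentiable (fun y => \prod_(i <- r | P i) f i y) x.
Proof.
move=> df; elim: r => [|i r IH].
  have -> : (fun y => \prod_(i <- [::] | P i) f i y) = cst 1.
    by apply/funext => y; rewrite big_nil.
  exact: differentiable_cst.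
have -> : (fun y => \prod_(j <- i :: r | P j) f j y) =
    if P i then (fun y => f i y * \prod_(j <- r | P j) f j y)
    else (fun y => \prod_(j <- r | P j) f j y).
  by apply/funext => y; rewrite big_cons; case: ifP.
case: ifP => // Pi; apply: differentiable_mulf => //; exact: df.
Qed.

Lemma is_derive_addf f g x v (df dg : R) :
  is_derive x v f df -> is_derive x v g dg ->
  is_derive x v (fun y => f y + g y) (df + dg).
Proof. by move=> ? ?; exact: is_deriveD. Qed.

Lemma is_derive_subf f g x v (df dg : R) :
  is_derive x v f df -> is_derive x v g dg ->
  is_derive x v (fun y => f y - g y) (df - dg).
Proof. by move=> ? ?; exact: is_deriveB. Qed.

Lemma is_derive_mulf f g x v (df dg : R) :
  is_derive x v f df -> is_derive x v g dg ->
  is_derive x v (fun y => f y * g y) (df * g x + f x * dg).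
Proof.
move=> hf hg; apply: (is_derive_eq (is_deriveM hf hg)).
by rewrite addrC; congr (_ + _); exact: mulrC.
Qed.

Lemma is_derive_constf (c : R) x v : is_derive x v (fun _ : V => c) 0.
Proof. exact: is_derive_cst. Qed.

Lemma is_derive_sumf (I : Type) (r : seq I) (P : pred I) (f : I -> V -> R)
    (df : I -> R) x v :
  (forall i, P i -> is_derive x v (f i) (df i)) ->
  is_derive x v (fun y => \sum_(i <- r | P i) f i y) (\sum_(i <- r | P i) df i).
Proof.
move=> hd; elim: r => [|i r IH].
  have -> : (fun y => \sum_(i <- [::] | P i) f i y) = cst 0.
    by apply/funext => y; rewrite big_nil.
  rewrite big_nil; exact: is_derive_cst.
have -> : (fun y => \sum_(j <- i :: r | P j) f j y) =
    if P i then (fun y => f i y + \sum_(j <- r | P j) f j y)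
    else (fun y => \sum_(j <- r | P j) f j y).
  by apply/funext => y; rewrite big_cons; case: ifP.
rewrite big_cons; case: ifP => // Pi; apply: is_derive_addf => //; exact: hd.
Qed.

(** The difference [k] vanishes near [x], hence is negligible against the identity and has
    differential 0 there; [g] is recovered as [f + k]. *)
Lemma near_eq_differentiable f g x :
  (\near x, f x = g x) -> differentiable f x -> differentiable g x.
Proof.
move=> fg df; pose k : V -> R := fun y => g y - f y.
have kE : k \o shift x = cst (k x) + (0 : V -> R) +o_ (0 : V) id.
  apply/eqaddoP => e e0; near=> y.
  rewrite -[X in `|X|]/(k (y + x) - (k x + 0)).
  have -> : k x = 0 by rewrite /k (nbhs_singleton fg) subrr.
  suff -> : k (y + x) = 0 by rewrite addr0 subrr normr0; apply: mulr_ge0; [exact: ltW|exact: normr_ge0].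
  apply/eqP; rewrite subr_eq0 eq_sym; apply/eqP.
  near: y; move: fg; rewrite (near_shift 0) /=.
  by apply: filterS => y; rewrite subr0.
have c0 : continuous (0 : V -> R) by move=> ?; exact: cst_continuous.
have dk : differentiable k x.
  by apply/diff_locallyP; rewrite (diff_unique c0 kE); split.
rewrite (_ : g = fun y => f y + k y); first exact: differentiable_addf.
by apply/funext => y; rewrite /k addrC subrK.
Unshelve. all: by end_near. Qed.

End PointwiseCalculus.

(** * Christoffel symbols and curvature of a metric in a chart *)

Section Inner.
Context {R : realType} {n : nat}.
Implicit Types (G : 'M[R]_n) (u v w : 'rV[R]_n).

Lemma innerE G u v :
  inner G u v = \sum_(i < n) \sum_(j < n) u 0 i * G i j * v 0 j.
Proof.
rewrite /inner mxE exchange_big /=; apply: eq_bigr => j _.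
by rewrite !mxE mulr_suml.
Qed.

Lemma innerDl G u v w : inner G (u + v) w = inner G u w + inner G v w.
Proof. by rewrite /inner !mulmxDl mxE. Qed.

Lemma innerDr G u v w : inner G w (u + v) = inner G w u + inner G w v.
Proof. by rewrite /inner linearD mulmxDr mxE. Qed.

Lemma innerZl G c u w : inner G (c *: u) w = c * inner G u w.
Proof. by rewrite /inner -!scalemxAl mxE. Qed.

Lemma innerZr G c u w : inner G w (c *: u) = c * inner G w u.
Proof. by rewrite /inner linearZ -scalemxAr mxE. Qed.

Lemma innerBl G u v w : inner G (u - v) w = inner G u w - inner G v w.
Proof. by rewrite innerDl -scaleN1r innerZl mulN1r. Qed.

Lemma innerBr G u v w : inner G w (u - v) = inner G w u - inner G w v.
Proof. by rewrite innerDr -scaleN1r innerZr mulN1r. Qed.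

Lemma inner0l G w : inner G 0 w = 0.
Proof. by rewrite /inner !mul0mx mxE. Qed.

Lemma inner0r G w : inner G w 0 = 0.
Proof. by rewrite /inner linear0 mulmx0 mxE. Qed.

Lemma inner_suml G (I : Type) (r : seq I) (P : pred I) (F : I -> 'rV[R]_n) w :
  inner G (\sum_(i <- r | P i) F i) w = \sum_(i <- r | P i) inner G (F i) w.
Proof. by rewrite /inner !mulmx_suml summxE. Qed.

Lemma inner_sumr G (I : Type) (r : seq I) (P : pred I) (F : I -> 'rV[R]_n) w :
  inner G w (\sum_(i <- r | P i) F i) = \sum_(i <- r | P i) inner G w (F i).
Proof. by rewrite /inner linear_sum mulmx_sumr summxE. Qed.

Lemma innerC G u v : G^T = G -> inner G u v = inner G v u.
Proof.
move=> GT; rewrite /inner -[in LHS](trmxK (u *m G *m v^T)) mxE.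
by rewrite trmx_mul trmxK trmx_mul GT mulmxA.
Qed.

Lemma inner_delta G i j : inner G (delta_mx 0 i) (delta_mx 0 j) = G i j.
Proof. by rewrite /inner -rowE trmx_delta -colE !mxE. Qed.

Lemma inner_rows m p (F : 'M[R]_(m, p)) (B : 'M[R]_p) q r :
  (F *m B *m F^T) q r = inner B (row q F) (row r F).
Proof.
rewrite /inner -row_mul !mxE; apply: eq_bigr => j _; by rewrite !mxE.
Qed.

Lemma row_deltaE u : u = \sum_(i < n) u 0 i *: delta_mx 0 i.
Proof. exact: row_sum_delta. Qed.

End Inner.

Lemma derive_rVE (R : realType) n (f : 'rV[R]_n -> R) x X :
  differentiable f x ->
  'D_X f x = \sum_(i < n) X 0 i * 'D_(delta_mx 0 i) f x.
Proof.
move=> df; rewrite deriveE // {1}(row_deltaE X) linear_sum.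
by apply: eq_bigr => i _; rewrite linearZ deriveE.
Qed.

Section Metric.
Context {R : realType} {n : nat}.
Variables (U : set 'rV[R]_n) (g : 'rV[R]_n -> 'M[R]_n).
Implicit Types (x y X Y Z W : 'rV[R]_n).

(** Differentiability is asked of [inner (g y) Y W] for constant vectors [Y] and [W], a form that
    passes to product metrics without indices. Differentiable first derivatives are enough for the
    curvature and for the symmetry of second derivatives. *)
Definition c2_metric :=
  [/\ open U, forall x, U x -> (g x)^T = g x, forall x, U x -> g x \in unitmx,
      forall Y W x, U x -> differentiable (fun y => inner (g y) Y W) x
    & forall X Y W x, U x ->
        differentiable (fun y => 'D_X (fun z => inner (g z) Y W) y) x].

(* The Christoffel symbols of the first kind and of the second kind, as
   functions of vectors: low x X Y W is the inner product of chr x X Y and W. *)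
Definition low x X Y W : R :=
  2^-1 * ('D_X (fun y => inner (g y) Y W) x + 'D_Y (fun y => inner (g y) X W) x
          - 'D_W (fun y => inner (g y) X Y) x).

Definition chr x X Y : 'rV[R]_n :=
  \row_k \sum_(i < n) \sum_(j < n) christoffel g k i j x * X 0 i * Y 0 j.

Hypothesis gU : c2_metric.

Let opU : open U. Proof. by case: gU. Qed.
Let sg x : U x -> (g x)^T = g x. Proof. by case: gU => _ + _ _ _; apply. Qed.
Let ug x : U x -> g x \in unitmx. Proof. by case: gU => _ _ + _ _; apply. Qed.
Let dg Y W x : U x -> differentiable (fun y => inner (g y) Y W) x.
Proof. by case: gU => _ _ _ + _; apply. Qed.
Let ddg X Y W x : U x ->
  differentiable (fun y => 'D_X (fun z => inner (g z) Y W) y) x.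
Proof. by case: gU => _ _ _ _; apply. Qed.

Lemma c2_metric_near x : U x -> \near x, U x.
Proof. by move=> Ux; exact: open_nbhs_nbhs. Qed.

Lemma is_derive_inner x X Y W : U x ->
  is_derive x X (fun y => inner (g y) Y W) ('D_X (fun y => inner (g y) Y W) x).
Proof. by move=> Ux; apply/derivableP/diff_derivable/dg. Qed.

Lemma derive_innerE x X Y W : U x ->
  'D_X (fun y => inner (g y) Y W) x =
  \sum_(i < n) \sum_(j < n)
    Y 0 i * 'D_X (fun y => inner (g y) (delta_mx 0 i) (delta_mx 0 j)) x * W 0 j.
Proof.
move=> Ux; have -> : (fun y => inner (g y) Y W) = fun y =>
    \sum_(i < n) \sum_(j < n)
      Y 0 i * inner (g y) (delta_mx 0 i) (delta_mx 0 j) * W 0 j.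
  apply/funext => y; rewrite innerE; apply: eq_bigr => i _.
  by apply: eq_bigr => j _; rewrite inner_delta.
apply: derive_val; apply: is_derive_sumf => i _; apply: is_derive_sumf => j _.
have := is_derive_mulf (is_derive_mulf (is_derive_constf (Y 0 i) x X)
  (is_derive_inner X (delta_mx 0 i) (delta_mx 0 j) Ux))
  (is_derive_constf (W 0 j) x X).
by move=> /is_derive_eq; apply; rewrite mul0r add0r mulr0 addr0.
Qed.

Lemma derive_inner_dir x X Y W : U x ->
  'D_X (fun y => inner (g y) Y W) x =
  \sum_(i < n) X 0 i * 'D_(delta_mx 0 i) (fun y => inner (g y) Y W) x.
Proof. by move=> Ux; rewrite derive_rVE //; exact: dg. Qed.

Lemma derive_inner_sym x X Y W : U x ->
  'D_X (fun y => inner (g y) Y W) x = 'D_X (fun y => inner (g y) W Y) x.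
Proof.
move=> Ux; apply: near_eq_derive; near=> y; apply: innerC; apply: sg.
by near: y; exact: c2_metric_near.
Unshelve. all: by end_near. Qed.

Lemma lowE x X Y W : U x -> low x X Y W =
  \sum_(i < n) \sum_(j < n) \sum_(k < n) X 0 i * Y 0 j * W 0 k *
    low x (delta_mx 0 i) (delta_mx 0 j) (delta_mx 0 k).
Proof.
move=> Ux; pose d i j k : R := 'D_(delta_mx 0 i)
  (fun y => inner (g y) (delta_mx 0 j) (delta_mx 0 k)) x.
have E A B C : 'D_A (fun y => inner (g y) B C) x =
    \sum_i \sum_j \sum_k A 0 i * B 0 j * C 0 k * d i j k.
  rewrite derive_inner_dir //; apply: eq_bigr => i _; rewrite derive_innerE //.
  rewrite big_distrr /=; apply: eq_bigr => j _; rewrite big_distrr /=.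
  by apply: eq_bigr => k _; rewrite /d; ring.
rewrite /low !E.
have -> : \sum_i \sum_j \sum_k Y 0 i * X 0 j * W 0 k * d i j k =
    \sum_i \sum_j \sum_k X 0 i * Y 0 j * W 0 k * d j i k.
  rewrite exchange_big /=; apply: eq_bigr => i _; apply: eq_bigr => j _.
  by apply: eq_bigr => k _; ring.
have -> : \sum_i \sum_j \sum_k W 0 i * X 0 j * Y 0 k * d i j k =
    \sum_i \sum_j \sum_k X 0 i * Y 0 j * W 0 k * d k i j.
  rewrite exchange_big /=; apply: eq_bigr => i _; rewrite exchange_big /=.
  apply: eq_bigr => j _; by apply: eq_bigr => k _; ring.
rewrite -big_split -sumrB big_distrr /=; apply: eq_bigr => i _.
rewrite -big_split -sumrB big_distrr /=; apply: eq_bigr => j _.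
rewrite -big_split -sumrB big_distrr /=; apply: eq_bigr => k _.
by rewrite -/(d i j k) -/(d j i k) -/(d k i j); ring.
Qed.

Lemma low_sym x X Y W : U x -> low x X Y W = low x Y X W.
Proof.
by move=> Ux; rewrite /low [X in _ - X](derive_inner_sym _ _ _ Ux) [X in X - _]addrC.
Qed.

Lemma christoffelE x i j k : christoffel g k i j x =
  \sum_(l < n) invmx (g x) k l *
    low x (delta_mx 0 i) (delta_mx 0 j) (delta_mx 0 l).
Proof.
rewrite /christoffel big_distrr /=; apply: eq_bigr => l _.
rewrite mulrCA /low /partial; congr (_ * (_ * (_ + _ - _))); congr ('D_ _ _ _);
  by apply/funext => y; rewrite inner_delta.
Qed.

Lemma chrE x X Y : U x ->
  chr x X Y = (\row_l low x X Y (delta_mx 0 l)) *m invmx (g x).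
Proof.
move=> Ux; have sI k l : invmx (g x) k l = invmx (g x) l k.
  by rewrite -[in RHS](sg Ux) -trmx_inv mxE.
apply/rowP => k; rewrite !mxE.
under eq_bigr => i _ do under eq_bigr => j _ do rewrite christoffelE //.
have E l : (\row_l low x X Y (delta_mx 0 l)) 0 l =
    \sum_(i < n) \sum_(j < n) X 0 i * Y 0 j *
      low x (delta_mx 0 i) (delta_mx 0 j) (delta_mx 0 l).
  rewrite mxE lowE //; apply: eq_bigr => i _; apply: eq_bigr => j _.
  rewrite (bigD1 l) //= big1 ?addr0 => [|m ml]; first by rewrite mxE !eqxx mulr1.
  by rewrite mxE (negPf ml) andbF mulr0 mul0r.
under [RHS]eq_bigr => l _ do rewrite E mulr_suml.
rewrite [RHS]exchange_big /=; apply: eq_bigr => i _.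
under [RHS]eq_bigr => l _ do rewrite mulr_suml.
rewrite [RHS]exchange_big /=; apply: eq_bigr => j _.
rewrite !mulr_suml; apply: eq_bigr => l _; by rewrite (sI k l); ring.
Qed.

Lemma inner_chr x X Y W : U x -> inner (g x) (chr x X Y) W = low x X Y W.
Proof.
move=> Ux; rewrite chrE // /inner mulmxKV ?ug // mxE lowE //.
under eq_bigr => l _ do rewrite !mxE lowE //.
under eq_bigr => l _ do rewrite mulr_suml.
rewrite exchange_big /=; apply: eq_bigr => i _.
under eq_bigr => l _ do rewrite mulr_suml.
rewrite exchange_big /=; apply: eq_bigr => j _.
apply: eq_bigr => l _; rewrite (bigD1 l) //= big1 ?addr0 => [|m ml].
  by rewrite mxE !eqxx mulr1; ring.
by rewrite mxE (negPf ml) andbF mulr0 mul0r.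
Qed.

(** Serves to identify a vector by testing it against every [W] instead of inverting the metric. *)
Lemma inner_nondeg x X Y : U x ->
  (forall W, inner (g x) X W = inner (g x) Y W) -> X = Y.
Proof.
move=> Ux h; apply: (can_inj (mulmxK (ug Ux))); apply/rowP => k.
by have := h (delta_mx 0 k); rewrite /inner trmx_delta -!colE !mxE.
Qed.

(* The connection is metric. *)
Lemma derive_inner_low x X Y W : U x ->
  'D_X (fun y => inner (g y) Y W) x = low x X Y W + low x X W Y.
Proof.
move=> Ux; rewrite /low (derive_inner_sym X W Y Ux).
rewrite (derive_inner_sym Y X W Ux) (derive_inner_sym W X Y Ux).
rewrite (derive_inner_sym W Y X Ux).
rewrite -(derive_inner_sym W Y X Ux); lra.
Qed.

End Metric.

(** * Determinants and inverses of matrix-valued functions *)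

Section MatrixCalculus.
Context {R : realType} {V : normedModType R}.

Lemma differentiable_det m (M : V -> 'M[R]_m) x :
  (forall i j, differentiable (fun y => M y i j) x) ->
  differentiable (fun y => \det (M y)) x.
Proof.
move=> dM; rewrite /determinant.
apply: differentiable_sumf => s _; apply: differentiable_mulf.
  exact: differentiable_constf.
by apply: differentiable_prodf => i _.
Qed.

(** The cofactor formula describes [invmx] on invertible matrices only, hence the hypothesis on a
    whole neighbourhood. *)
Lemma differentiable_invmx m (M : V -> 'M[R]_m) x :
  (\near x, M x \in unitmx) -> (forall i j, differentiable (fun y => M y i j) x) ->
  forall i j, differentiable (fun y => invmx (M y) i j) x.
Proof.
move=> uM dM i j.
apply: (@near_eq_differentiable _ _
  (fun y => (\det (M y))^-1 * cofactor (M y) j i)).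
  by apply: filterS uM => y uy; rewrite /invmx uy !mxE.
apply: differentiable_mulf.
  apply: differentiableV; first exact: differentiable_det.
  by have := nbhs_singleton uM; rewrite unitmxE unitfE.
apply: differentiable_mulf; first exact: differentiable_constf.
apply: differentiable_det => k l.
rewrite (_ : (fun y => _) = fun y => M y (lift j k) (lift i l)) //.
by apply/funext => y; rewrite !mxE.
Qed.

Lemma is_derive_inner_fun n (G : V -> 'M[R]_n) (u w : V -> 'rV[R]_n) x v
    (DG : 'M[R]_n) (Du Dw : 'rV[R]_n) :
  (forall i j, is_derive x v (fun y => G y i j) (DG i j)) ->
  (forall i, is_derive x v (fun y => u y 0 i) (Du 0 i)) ->
  (forall i, is_derive x v (fun y => w y 0 i) (Dw 0 i)) ->
  is_derive x v (fun y => inner (G y) (u y) (w y))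
    (inner DG (u x) (w x) + inner (G x) Du (w x) + inner (G x) (u x) Dw).
Proof.
move=> hG hu hw.
have -> : (fun y => inner (G y) (u y) (w y)) = fun y =>
   \sum_(i < n) \sum_(j < n) u y 0 i * G y i j * w y 0 j.
  by apply/funext => y; rewrite innerE.
rewrite !innerE -!big_split /=; apply: is_derive_sumf => i _.
rewrite -!big_split /=; apply: is_derive_sumf => j _.
have := is_derive_mulf (is_derive_mulf (hu i) (hG i j)) (hw j).
by move=> /is_derive_eq; apply; ring.
Qed.

End MatrixCalculus.

(** * The Riemann tensor with all indices lowered *)

Section Curvature.
Context {R : realType} {n : nat}.
Variables (U : set 'rV[R]_n) (g : 'rV[R]_n -> 'M[R]_n).
Hypothesis gU : c2_metric U g.
Implicit Types (x y X Y Z W : 'rV[R]_n).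

Let nU x : U x -> \near x, U x. Proof. exact: (c2_metric_near gU). Qed.
Let sg x : U x -> (g x)^T = g x. Proof. by case: gU => _ + _ _ _; apply. Qed.
Let ug x : U x -> g x \in unitmx. Proof. by case: gU => _ _ + _ _; apply. Qed.
Let dg Y W x : U x -> differentiable (fun y => inner (g y) Y W) x.
Proof. by case: gU => _ _ _ + _; apply. Qed.
Let ddg X Y W x : U x ->
  differentiable (fun y => 'D_X (fun z => inner (g z) Y W) y) x.
Proof. by case: gU => _ _ _ _; apply. Qed.

Lemma differentiable_metric x i j : U x -> differentiable (fun y => g y i j) x.
Proof.
move=> Ux; rewrite (_ : (fun y => _) =
  fun y => inner (g y) (delta_mx 0 i) (delta_mx 0 j)); first exact: dg.
by apply/funext => y; rewrite inner_delta.
Qed.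

Lemma differentiable_low x X Y W : U x -> differentiable (fun y => low g y X Y W) x.
Proof.
move=> Ux; apply: differentiable_mulf; first exact: differentiable_constf.
apply: differentiable_subf; last exact: ddg.
by apply: differentiable_addf; exact: ddg.
Qed.

Lemma differentiable_christoffel x k i j : U x ->
  differentiable (christoffel g k i j) x.
Proof.
move=> Ux; apply: (@near_eq_differentiable _ _ (fun x => \sum_(l < n)
   invmx (g x) k l * low g x (delta_mx 0 i) (delta_mx 0 j) (delta_mx 0 l))).
  by near=> y; rewrite christoffelE.
apply: differentiable_sumf => l _; apply: differentiable_mulf; last first.
  exact: differentiable_low.
apply: differentiable_invmx => [|? ?]; last exact: differentiable_metric.
by apply: filterS (nU Ux) => y /ug.
Unshelve. all: by end_near. Qed.

Lemma is_derive_christoffel x X k i j : U x ->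
  is_derive x X (christoffel g k i j)
    (\sum_(m < n) X 0 m * partial m (christoffel g k i j) x).
Proof.
move=> Ux; have dc := differentiable_christoffel k i j Ux.
rewrite -derive_rVE //; exact/derivableP/diff_derivable.
Qed.

Lemma is_derive_chr x X Y Z l : U x ->
  is_derive x X (fun y => chr g y Y Z 0 l)
    (\sum_(i < n) \sum_(j < n) \sum_(k < n)
       partial i (christoffel g l j k) x * X 0 i * Y 0 j * Z 0 k).
Proof.
move=> Ux; have -> : (fun y => chr g y Y Z 0 l) = fun y =>
    \sum_(j < n) \sum_(k < n) christoffel g l j k y * Y 0 j * Z 0 k.
  by apply/funext => y; rewrite mxE.
rewrite exchange_big /=; apply: is_derive_sumf => j _.
rewrite exchange_big /=; apply: is_derive_sumf => k _.
have := is_derive_mulf (is_derive_mulf (is_derive_christoffel X l j k Ux)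
  (is_derive_constf (Y 0 j) x X)) (is_derive_constf (Z 0 k) x X).
move=> /is_derive_eq; apply; rewrite !mulr0 !addr0 !mulr_suml.
by apply: eq_bigr => i _; ring.
Qed.

Lemma riemannE x X Y Z : U x -> riemann g x X Y Z =
  \row_l ('D_X (fun y => chr g y Y Z 0 l) x - 'D_Y (fun y => chr g y X Z 0 l) x)
  + chr g x X (chr g x Y Z) - chr g x Y (chr g x X Z).
Proof.
move=> Ux; apply/rowP => l; rewrite !mxE.
rewrite (@derive_val _ _ _ _ _ _ _ (is_derive_chr X Y Z l Ux)).
rewrite (@derive_val _ _ _ _ _ _ _ (is_derive_chr Y X Z l Ux)).
rewrite [X in _ - X + _ - _]exchange_big /=.
have E A B : \sum_(i < n) \sum_(m < n) christoffel g l i m x * A 0 i *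
      chr g x B Z 0 m =
    \sum_(i < n) \sum_(j < n) \sum_(k < n) A 0 i * B 0 j * Z 0 k *
      \sum_(m < n) christoffel g l i m x * christoffel g m j k x.
  apply: eq_bigr => i _.
  under eq_bigr => m _ do rewrite mxE big_distrr /=.
  rewrite exchange_big /=; apply: eq_bigr => j _.
  under eq_bigr => m _ do rewrite big_distrr /=.
  rewrite exchange_big /=; apply: eq_bigr => k _.
  by rewrite big_distrr /=; apply: eq_bigr => m _; ring.
rewrite !E [X in _ + _ - X]exchange_big /=.
rewrite -sumrB -big_split -sumrB; apply: eq_bigr => i _ /=.
rewrite -sumrB -big_split -sumrB; apply: eq_bigr => j _ /=.
rewrite -sumrB -big_split -sumrB; apply: eq_bigr => k _ /=.
rewrite /riemann_coef sumrB; set p := partial _ _ _; set q := partial _ _ _.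
set S := \sum_(m < n) _; set T := \sum_(m < n) _.
by move: p q S T (X 0 i) (Y 0 j) (Z 0 k) => p q S T a b c; ring.
Qed.

Definition metric_deriv x X : 'M[R]_n := \matrix_(i, j) 'D_X (fun y => g y i j) x.

Lemma inner_metric_deriv x X Y W : U x ->
  inner (metric_deriv x X) Y W = low g x X Y W + low g x X W Y.
Proof.
move=> Ux; rewrite -(derive_inner_low gU) // (derive_innerE gU) // innerE.
apply: eq_bigr => i _; apply: eq_bigr => j _; rewrite mxE.
rewrite (_ : (fun y => inner _ _ _) = fun y => g y i j) //.
by apply/funext => y; rewrite inner_delta.
Qed.

Lemma is_derive_metric x X i j : U x ->
  is_derive x X (fun y => g y i j) (metric_deriv x X i j).
Proof.
by move=> Ux; rewrite mxE; apply/derivableP/diff_derivable/differentiable_metric.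
Qed.

Lemma inner_derive_chr x X Y Z W : U x ->
  inner (g x) (\row_l 'D_X (fun y => chr g y Y Z 0 l) x) W =
  'D_X (fun y => low g y Y Z W) x - low g x X (chr g x Y Z) W
   - inner (g x) (chr g x X W) (chr g x Y Z).
Proof.
move=> Ux; set DU := \row_l _.
have hu i : is_derive x X (fun y => chr g y Y Z 0 i) (DU 0 i).
  by have [h _] := is_derive_chr X Y Z i Ux; apply: DeriveDef; rewrite ?mxE.
have hw i : is_derive x X (fun y => (fun=> W) y 0 i) ((0 : 'rV[R]_n) 0 i).
  by rewrite mxE; exact: is_derive_constf.
have [_ E] := is_derive_inner_fun (fun i j => is_derive_metric X i j Ux) hu hw.
have -> : 'D_X (fun y => low g y Y Z W) x =
    'D_X (fun y => inner (g y) (chr g y Y Z) W) x.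
  apply: near_eq_derive; apply: filterS (nU Ux) => y Uy.
  by rewrite (inner_chr gU).
rewrite E inner0r addr0 inner_metric_deriv // -(inner_chr gU X W) //; ring.
Qed.

(** Lowering the index turns derivatives of [chr] into derivatives of [low]. By metric compatibility
    this produces [- low g x X (chr g x Y Z) W], which cancels the quadratic term of [riemannE]; the
    other half of the compatibility terms remains. No derivative of the inverse metric is left. *)
Lemma inner_riemann x X Y Z W : U x -> inner (g x) (riemann g x X Y Z) W =
  'D_X (fun y => low g y Y Z W) x - 'D_Y (fun y => low g y X Z W) x
  - inner (g x) (chr g x X W) (chr g x Y Z)
  + inner (g x) (chr g x Y W) (chr g x X Z).
Proof.
move=> Ux; rewrite riemannE // innerBl innerDl.
have -> : \row_l ('D_X (fun y => chr g y Y Z 0 l) x -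
      'D_Y (fun y => chr g y X Z 0 l) x) =
    \row_l 'D_X (fun y => chr g y Y Z 0 l) x -
    \row_l 'D_Y (fun y => chr g y X Z 0 l) x.
  by apply/rowP => l; rewrite !mxE.
rewrite innerBl (inner_derive_chr X Y Z W Ux) (inner_derive_chr Y X Z W Ux).
rewrite (inner_chr gU X (chr g x Y Z) W Ux) (inner_chr gU Y (chr g x X Z) W Ux).
move: ('D_X _ x) ('D_Y _ x) (low _ _ X _ _) (low _ _ Y _ _) (inner _ _ _) (inner _ _ _).
by move=> a b c d e f; ring.
Qed.

Lemma riemannN x X Y Z : riemann g x X Y Z = - riemann g x Y X Z.
Proof.
apply/rowP => l; rewrite !mxE [X in _ = - X]exchange_big /= -sumrN.
apply: eq_bigr => i _; rewrite -sumrN; apply: eq_bigr => j _; rewrite -sumrN.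
apply: eq_bigr => k _; rewrite /riemann_coef !sumrB; set p := partial _ _ _; set q := partial _ _ _.
set S := \sum_(m < n) _; set T := \sum_(m < n) _.
by move: p q S T (X 0 i) (Y 0 j) (Z 0 k) => p q S T a b c; ring.
Qed.

Lemma riemann_linl x Y Z c X X' :
  riemann g x (c *: X + X') Y Z = c *: riemann g x X Y Z + riemann g x X' Y Z.
Proof.
apply/rowP => l; rewrite !mxE big_distrr -big_split; apply: eq_bigr => i _ /=.
rewrite big_distrr -big_split; apply: eq_bigr => j _ /=.
rewrite big_distrr -big_split; apply: eq_bigr => k _ /=.
rewrite !mxE; move: (riemann_coef _ _ _ _ _ _) => r; ring.
Qed.

End Curvature.

(** * Symmetry of the tidal operator and constant curvature *)

Section Schwarz.
Context {R : realType} {V : normedModType R}.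
Implicit Types (f : V -> R) (x y u v : V).

Lemma is_derive_line f y v s : derivable f (s *: v + y) v ->
  is_derive s 1 (fun r : R => f (r *: v + y)) ('D_v f (s *: v + y)).
Proof.
move=> df.
have E : (fun h : R => h^-1 *: (((fun r : R => f (r *: v + y)) \o shift s) (h *: 1)
     - f (s *: v + y))) =
   (fun h : R => h^-1 *: ((f \o shift (s *: v + y)) (h *: v) - f (s *: v + y))).
  apply/funext => h /=; congr (_ *: (f _ - _)).
  by rewrite [h *: 1]mulr1 scalerDl addrA.
by split; [rewrite /derivable E|rewrite /derive E].
Qed.

(* The second difference of f along u and v is the increment over [0, h] of
   s |-> f (x + h u + s v) - f (x + s v), so the mean value theorem expresses it
   by values of 'D_v f near x. *)
Lemma second_difference f x u v (e : R) : 0 < e ->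
  (\near x, derivable f x v) -> differentiable ('D_v f) x ->
  \forall h \near 0^'+,
    `|f (h *: u + h *: v + x) - f (h *: u + x) - f (h *: v + x) + f x
      - h ^+ 2 * 'D_u ('D_v f) x| <= e * h ^+ 2.
Proof.
move=> e0 df dF; set F := 'D_v f.
(* The vectors [h u + s v] and [s v] with [0 <= s <= h] have norm at most [h K], the summand 1
   keeping [K] positive. Two linearization errors of at most [e' * (h * K)] add up to [e * h]. *)
pose K := `|u| + `|v| + 1.
have K0 : 0 < K by rewrite ltr_wpDl // addr_ge0.
pose e' := e / (2 * K).
have e'0 : 0 < e' by rewrite divr_gt0 // mulr_gt0.
have dF' : \forall y \near (0 : V), `|F (y + x) - F x - 'd F x y| <= e' * `|y|.
  have := diff_locally dF => /eqaddoP /(_ _ e'0).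
  apply: filterS => y; rewrite -[X in `|X|]/(F (y + x) - (F x + 'd F x y)).
  by rewrite opprD addrA.
have df' : \forall y \near (0 : V), derivable f (y + x) v.
  by move: df; rewrite (near_shift 0) /=; apply: filterS => y; rewrite subr0.
have /nbhs_norm0P[/= d d0 dP] : \forall y \near (0 : V),
    derivable f (y + x) v /\ `|F (y + x) - F x - 'd F x y| <= e' * `|y|.
  by near=> y; split; near: y.
have dK0 : 0 < d / K by rewrite divr_gt0.
near=> h.
have h0 : 0 < h by near: h; exact: nbhs_right_gt.
have hd : h < d / K by near: h; exact: nbhs_right_lt.
(* The boolean treats together the two parallel segments, starting at [x] and at [x + h u]. *)
have small (b : bool) (s : R) : 0 <= s <= h -> `|(b%:R * h) *: u + s *: v| <= h * K.
  move=> /andP[s0 sh]; apply: (le_trans (ler_normD _ _)).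
  rewrite (normrZ (b%:R * h)) (normrZ s) (ger0_norm s0) /K !mulrDr mulr1.
  have bh : `|b%:R * h| <= h.
    by case: b; rewrite ?mul1r ?mul0r ?normr0 ?gtr0_norm // ltW.
  have a1 : `|b%:R * h| * `|u| <= h * `|u| by exact: ler_wpM2r.
  have a2 : s * `|v| <= h * `|v| by exact: ler_wpM2r.
  by apply: (le_trans (lerD a1 a2)); rewrite lerDl ltW.
have smalld (b : bool) (s : R) : 0 <= s <= h -> `|(b%:R * h) *: u + s *: v| < d.
  by move=> /(small b) /le_lt_trans; apply; rewrite -ltr_pdivlMr.
pose phi (s : R) := f (s *: v + (h *: u + x)) - f (s *: v + x).
pose dphi (s : R) := F (s *: v + (h *: u + x)) - F (s *: v + x).
have dphiE (s : R) : 0 <= s <= h -> is_derive s 1 phi (dphi s).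
  move=> sh; apply: is_derive_subf; apply: is_derive_line.
    have := (dP _ (smalld true s sh)).1.
    by rewrite mul1r [h *: u + _]addrC -addrA.
  by have := (dP _ (smalld false s sh)).1; rewrite mul0r scale0r add0r.
have [c cin E] : exists2 c, c \in `]0, h[%R & phi h - phi 0 = dphi c * (h - 0).
  apply: MVT => // [s|].
    by rewrite in_itv /= => /andP[/ltW s0 /ltW sh]; apply: dphiE; rewrite s0 sh.
  apply: derivable_within_continuous => s; rewrite in_itv /= => sh.
  by have [] := dphiE s sh.
have {cin} ch : 0 <= c <= h.
  by move: cin; rewrite in_itv /= => /andP[/ltW -> /ltW ->].
have -> : f (h *: u + h *: v + x) - f (h *: u + x) - f (h *: v + x) + f x =
    dphi c * h.
  rewrite -[h in RHS]subr0 -E /phi !scale0r !add0r.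
  have -> : h *: u + h *: v + x = h *: v + (h *: u + x) by rewrite addrCA addrA.
  ring.
rewrite (_ : _ - _ = h * (dphi c - h * 'D_u F x)); last by ring.
rewrite deriveE // normrM gtr0_norm // expr2 mulrCA ler_pM2l //.
have h1 := (dP _ (smalld true c ch)).2; have h2 := (dP _ (smalld false c ch)).2.
have -> : dphi c - h * 'd F x u =
  (F ((true%:R * h) *: u + c *: v + x) - F x
     - 'd F x ((true%:R * h) *: u + c *: v)) -
  (F ((false%:R * h) *: u + c *: v + x) - F x
     - 'd F x ((false%:R * h) *: u + c *: v)).
  have dl : 'd F x (h *: u + c *: v) = h * 'd F x u + 'd F x (c *: v).
    by rewrite linearD linearZ.
  have El : h *: u + c *: v + x = c *: v + (h *: u + x) by rewrite addrCA addrA.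
  rewrite mul1r mul0r scale0r add0r dl El /dphi.
  by move: (F _) (F _) (F _) ('d F x u) ('d F x _) => p q r k l; ring.
apply: (le_trans (ler_normB _ _)); apply: (le_trans (lerD h1 h2)).
rewrite -mulrDr -ler_pdivlMl //.
have -> : e'^-1 * (e * h) = h * K + h * K.
  by rewrite /e'; field; rewrite !gt_eqF.
by apply: lerD; exact: small.
Unshelve. all: by end_near. Qed.

(** The second difference is symmetric in [u] and [v], so after division by [h^2] it approximates
    both mixed derivatives. *)
Lemma schwarz f x u v :
  (\near x, derivable f x u) -> (\near x, derivable f x v) ->
  differentiable ('D_u f) x -> differentiable ('D_v f) x ->
  'D_u ('D_v f) x = 'D_v ('D_u f) x.
Proof.
move=> fu fv du dv; apply/eqP/negPn/negP => neq.
pose L1 : R := 'D_u ('D_v f) x; pose L2 : R := 'D_v ('D_u f) x.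
have L0 : 0 < `|L1 - L2| by rewrite normr_gt0 subr_eq0.
(* With a quarter of the gap, the two errors add up to half of it, which is a contradiction. *)
pose e := `|L1 - L2| / 4.
have e0 : 0 < e by rewrite divr_gt0.
suff [h [h0 h1 h2]] : exists h : R, [/\ 0 < h,
    `|f (h *: u + h *: v + x) - f (h *: u + x) - f (h *: v + x) + f x
      - h ^+ 2 * L1| <= e * h ^+ 2
  & `|f (h *: u + h *: v + x) - f (h *: u + x) - f (h *: v + x) + f x
      - h ^+ 2 * L2| <= e * h ^+ 2].
  have hh : 0 < h ^+ 2 by rewrite exprn_gt0.
  have : h ^+ 2 * `|L1 - L2| <= e * h ^+ 2 + e * h ^+ 2.
    rewrite -{1}(gtr0_norm hh) -normrM; apply: (le_trans _ (lerD h2 h1)).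
    apply: (le_trans _ (ler_normB _ _)); rewrite le_eqVlt; apply/orP; left.
    by apply/eqP; congr `|_|; ring.
  rewrite -mulrDl mulrC ler_pM2r // /e; move: L0; clear.
  by move: `|_| => z z0 zz; lra.
have P1 := second_difference u e0 fv dv; have P2 := second_difference v e0 fu du.
have [h [h0 [h1 h2]]] := filter_ex (filterI (nbhs_right_gt (0 : R)) (filterI P1 P2)).
exists h; split; [exact: h0|exact: h1|move: h2 => /=].
by rewrite [h *: v + h *: u]addrC [f _ - f (h *: v + x) - f _]addrAC.
Qed.

End Schwarz.

Lemma is_derive_comp_rV (R : realType) n (f : 'rV[R]_n -> R) (c : R -> 'rV[R]_n) s :
  (forall k, derivable (fun r => c r 0 k) s 1) -> differentiable f (c s) ->
  is_derive s 1 (fun r => f (c r))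
    ('D_(\row_k derive1 (fun r => c r 0 k) s) f (c s)).
Proof.
move=> dc df.
have dcs : derivable c s 1 by apply/derivable_mxP => i j; rewrite ord1.
have /derivable1_diffP dcs' := dcs.
split; first exact/derivable1_diffP/differentiable_comp.
rewrite deriveE; last exact: differentiable_comp.
rewrite diff_comp //= deriveE //; congr ('d f _ _).
rewrite -deriveE // derive_mx //; apply/matrixP => i j.
by rewrite !mxE ord1 derive1E.
Qed.

Section Tidal.
Context {R : realType} {n : nat}.
Variables (U : set 'rV[R]_n) (g : 'rV[R]_n -> 'M[R]_n).
Hypothesis gU : c2_metric U g.
Implicit Types (x y X Y Z W u v w : 'rV[R]_n).

Let nU x : U x -> \near x, U x. Proof. exact: (c2_metric_near gU). Qed.
Let sg x : U x -> (g x)^T = g x. Proof. by case: gU => _ + _ _ _; apply. Qed.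
Let dg Y W x : U x -> differentiable (fun y => inner (g y) Y W) x.
Proof. by case: gU => _ _ _ + _; apply. Qed.
Let ddg X Y W x : U x ->
  differentiable (fun y => 'D_X (fun z => inner (g z) Y W) y) x.
Proof. by case: gU => _ _ _ _; apply. Qed.

Definition derive2_inner x X X' Y W : R :=
  'D_X (fun y => 'D_X' (fun z => inner (g z) Y W) y) x.

Lemma derive2_innerC x X X' Y W : U x ->
  derive2_inner x X X' Y W = derive2_inner x X' X Y W.
Proof.
move=> Ux; apply: schwarz; try exact: ddg;
  by apply: filterS (nU Ux) => y Uy; apply: diff_derivable; exact: dg.
Qed.

Lemma derive2_inner_sym x X X' Y W : U x ->
  derive2_inner x X X' Y W = derive2_inner x X X' W Y.
Proof.
move=> Ux; apply: near_eq_derive; apply: filterS (nU Ux) => y Uy.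
exact: (derive_inner_sym gU).
Qed.

Lemma derive_low x Z X Y W : U x ->
  'D_Z (fun y => low g y X Y W) x = 2^-1 *
   (derive2_inner x Z X Y W + derive2_inner x Z Y X W - derive2_inner x Z W X Y).
Proof.
move=> Ux; apply: derive_val.
have D A B C : is_derive x Z (fun y => 'D_A (fun z => inner (g z) B C) y)
    (derive2_inner x Z A B C) by exact/derivableP/diff_derivable/ddg.
have := is_derive_mulf (is_derive_constf 2^-1 x Z)
  (is_derive_subf (is_derive_addf (D X Y W) (D Y X W)) (D W X Y)).
by move=> /is_derive_eq; apply; rewrite mul0r add0r.
Qed.

(** A case of the pair symmetry of the Riemann tensor. In the expansion by second derivatives of the
    metric, equality of mixed derivatives and the symmetry of [chr] match the terms. It makes the
    polarization in [tidal_constant_curvature] possible. *)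
Lemma tidal_sym x u v w : U x ->
  inner (g x) (riemann g x u v v) w = inner (g x) (riemann g x w v v) u.
Proof.
move=> Ux; set D := derive2_inner x; set I := inner (g x).
have E a b : I (riemann g x a v v) b =
    2^-1 * (D a v v b + D a v v b - D a b v v)
    - 2^-1 * (D v a v b + D v v a b - D v b a v)
    - I (chr g x a b) (chr g x v v) + I (chr g x v b) (chr g x a v).
  rewrite /I (inner_riemann gU a v v b Ux) (derive_low a v v b Ux).
  by rewrite (derive_low v a v b Ux).
have cs a b : chr g x a b = chr g x b a.
  apply: (inner_nondeg gU Ux) => W.
  by rewrite (inner_chr gU a b W Ux) (inner_chr gU b a W Ux) (low_sym gU a b W Ux).
have IC a b : I a b = I b a by apply: innerC; exact: sg.
have D1 := derive2_innerC u v v w Ux; have D2 := derive2_innerC w v v u Ux.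
have D3 := derive2_innerC u w v v Ux; have D4 := derive2_inner_sym v v u w Ux.
have D5 := derive2_inner_sym v w u v Ux; have D6 := derive2_inner_sym v u w v Ux.
rewrite (E u w) (E w u) (cs w u) (cs v w) (cs v u) (IC (chr g x w v)).
move: D1 D2 D3 D4 D5 D6; rewrite -/D.
move: (I _ (chr g x v v)) (I _ (chr g x w v)) => p q.
clear E; clearbody D => -> -> -> -> -> ->; ring.
Qed.

Lemma riemann_same x v w : riemann g x v v w = 0.
Proof.
have /eqP := riemannN g x v v w.
by rewrite -addr_eq0 -mulr2n -scaler_nat scaler_eq0 pnatr_eq0 /= => /eqP.
Qed.

Lemma riemannDl x u u' v w :
  riemann g x (u + u') v w = riemann g x u v w + riemann g x u' v w.
Proof. by rewrite -{1}(scale1r u) riemann_linl scale1r. Qed.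

Lemma riemannZl x c u v w : riemann g x (c *: u) v w = c *: riemann g x u v w.
Proof.
have h0 : riemann g x 0 v w = 0.
  by have := riemannDl x 0 0 v w; rewrite addr0 -{1}[riemann _ _ _ _ _]addr0 => /addrI.
by rewrite -[c *: u]addr0 riemann_linl h0 addr0.
Qed.

(** Sectional curvature is the quadratic form of the tidal operator [R(., v)v], and a symmetric
    operator is determined by its quadratic form. *)
Lemma tidal_constant_curvature (kappa : R) x : U x ->
  (forall u, u != 0 -> 0 < inner (g x) u u) ->
  (forall u v, plane_area2 (g x) u v != 0 -> sectional g x u v = kappa) ->
  forall u v w, inner (g x) (riemann g x u v v) w =
    kappa * (inner (g x) v v * inner (g x) u w - inner (g x) u v * inner (g x) v w).
Proof.
move=> Ux pos sec.
have inC u v : inner (g x) u v = inner (g x) v u by apply: innerC; exact: sg.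
have Q u v : inner (g x) (riemann g x u v v) u =
    kappa * plane_area2 (g x) u v.
  (* Nothing is assumed on linearly dependent [u] and [v]. There either [v = 0] or equality in
     Cauchy-Schwarz makes [u] a multiple of [v], and both sides vanish. *)
  have [a0|a0] := eqVneq (plane_area2 (g x) u v) 0; last first.
    by rewrite -[kappa](sec u v a0) /sectional divfK.
  rewrite a0 mulr0; have [->|v0] := eqVneq v 0.
    have -> : riemann g x u 0 0 = 0; last exact: inner0l.
    by rewrite riemannN -[X in riemann g x X u](scale0r u) riemannZl scale0r oppr0.
  suff -> : u = (inner (g x) u v / inner (g x) v v) *: v.
    by rewrite riemannZl riemann_same scaler0 inner0l.
  have vv := pos v v0.
  apply/eqP; rewrite -subr_eq0; apply/negPn/negP => /pos.
  rewrite innerBl !innerBr !innerZl !innerZr (inC v u).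
  have vv0 : inner (g x) v v != 0 by rewrite gt_eqF.
  move: a0; rewrite /plane_area2.
  move: (inner _ u u) (inner _ u v) (inner _ v v) vv vv0 => p q r vv vv0 a0.
  suff -> : p - q / r * q - (q / r * q - q / r * (q / r * r)) = 0 by rewrite ltxx.
  have -> : p = q ^+ 2 / r by apply: (canRL (mulfK vv0)); apply/eqP; rewrite -subr_eq0 a0.
  by field.
move=> u v w.
(* Polarization in the first argument: the values of [Q] at [u], [w] and [u + w] give twice the
   mixed term. *)
have S := tidal_sym u v w Ux; have := Q (u + w) v.
rewrite riemannDl innerDl !innerDr (Q u v) (Q w v) -S /plane_area2.
rewrite !innerDl !innerDr (inC w u) (inC w v).
move: (inner _ u u) (inner _ u v) (inner _ v v) (inner _ w w) (inner _ u w).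
move: (inner _ v w) (inner _ (riemann _ _ _ _ _) _) => a b c d e f k H.
suff : 2 * b = 2 * (kappa * (e * k - d * a)) by move/mulfI; apply; rewrite pnatr_eq0.
by move: H; clear; lra.
Qed.

End Tidal.

(** * The FLRW metric in a chart *)

Section WarpedMetric.
Context {R : realType} {n : nat}.
Variables (a : R -> R) (h : 'rV[R]_n -> 'M[R]_n) (U : set 'rV[R]_n).

(** The metric of [flrw] over a base of arbitrary dimension; for [n = 3] the block matrix [warped]
    is convertible with the one in [flrw]. *)
Definition tcomp (x : 'rV[R]_(1 + n)) : R := lsubmx x 0 0.
Definition scomp (x : 'rV[R]_(1 + n)) : 'rV[R]_n := rsubmx x.
Definition warped (x : 'rV[R]_(1 + n)) : 'M[R]_(1 + n) :=
  block_mx (-1)%:M 0 0 (a (tcomp x) ^+ 2 *: h (scomp x)).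
Definition warped_dom : set 'rV[R]_(1 + n) := [set x | 0 < tcomp x /\ U (scomp x)].

Implicit Types (x y X Y Z W : 'rV[R]_(1 + n)).

Lemma inner_warped x Y W : inner (warped x) Y W =
  - (tcomp Y * tcomp W) + a (tcomp x) ^+ 2 * inner (h (scomp x)) (scomp Y) (scomp W).
Proof.
rewrite /inner -{1}(hsubmxK Y) -{1}(hsubmxK W) tr_row_mx mul_row_block.
rewrite !mulmx0 addr0 add0r mul_row_col mxE; congr (_ + _).
  by rewrite mul_mx_scalar mxE big_ord1 !mxE /tcomp !mxE !ord1 mulN1r mulNr.
by rewrite -scalemxAr -scalemxAl mxE.
Qed.

Lemma tcompP x y : tcomp x = tcomp y -> scomp x = scomp y -> x = y.
Proof.
move=> t s; rewrite -(hsubmxK x) -(hsubmxK y); congr (row_mx _ _) => //.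
by apply/rowP => i; rewrite ord1.
Qed.

Lemma tcompD x y : tcomp (x + y) = tcomp x + tcomp y.
Proof. by rewrite /tcomp !mxE. Qed.

Lemma tcompZ c x : tcomp (c *: x) = c * tcomp x.
Proof. by rewrite /tcomp !mxE. Qed.

Lemma scompD x y : scomp (x + y) = scomp x + scomp y.
Proof. by apply/rowP => i; rewrite !mxE. Qed.

Lemma scompZ c x : scomp (c *: x) = c *: scomp x.
Proof. by apply/rowP => i; rewrite !mxE. Qed.

Lemma differentiable_scomp x : differentiable scomp x.
Proof. exact: differentiable_rsubmx. Qed.

Lemma differentiable_tcomp x : differentiable tcomp x.
Proof.
have := differentiable_coord x 0 (lshift n 0).
by congr (differentiable _ _); apply/funext => y; rewrite /tcomp mxE.
Qed.

Lemma is_derive_scomp (F : 'rV[R]_n -> R) x X d :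
  is_derive (scomp x) (scomp X) F d -> is_derive x X (fun y => F (scomp y)) d.
Proof.
move=> [dF <-].
have E : (fun h : R => h^-1 *: (((fun y => F (scomp y)) \o shift x) (h *: X)
     - F (scomp x))) =
   (fun h : R => h^-1 *: ((F \o shift (scomp x)) (h *: scomp X) - F (scomp x))).
  by apply/funext => r /=; rewrite scompD scompZ.
by split; [rewrite /derivable E|rewrite /derive E].
Qed.

Lemma is_derive_tcomp (F : R -> R) x X :
  derivable F (tcomp x) 1 ->
  is_derive x X (fun y => F (tcomp y)) (tcomp X * derive1 F (tcomp x)).
Proof.
move=> dF; have [d0 d1] : is_derive (tcomp x) (tcomp X) F
    (tcomp X * derive1 F (tcomp x)).
  have /derivable1_diffP dF' := dF; split; first exact: diff_derivable.
  rewrite derive1E !deriveE // -[in LHS](mulr1 (tcomp X)).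
  by rewrite -[_ * 1]/(_ *: (1 : R)) linearZ.
have E : (fun h : R => h^-1 *: (((fun y => F (tcomp y)) \o shift x) (h *: X)
     - F (tcomp x))) =
   (fun h : R => h^-1 *: ((F \o shift (tcomp x)) (h *: tcomp X) - F (tcomp x))).
  by apply/funext => r /=; rewrite tcompD tcompZ.
by split; [rewrite /derivable E|rewrite /derive E].
Qed.

Hypothesis hU : c2_metric U h.
Hypothesis a_gt0 : forall t, 0 < t -> 0 < a t.
Hypothesis da : forall t, 0 < t -> derivable a t 1.
Hypothesis dda : forall t, 0 < t -> derivable (derive1 a) t 1.

Lemma open_warped_dom : open warped_dom.
Proof.
have [oU _ _ _ _] := hU.
apply: openI.
  have := (open_comp (D := [set t : R | 0 < t]) (f := tcomp)).
  apply => // x _; exact/differentiable_continuous/differentiable_tcomp.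
apply: (open_comp (D := U) (f := scomp)) => // x _.
exact/differentiable_continuous/differentiable_scomp.
Qed.

Lemma is_derive_inner_warped x X Y W : warped_dom x ->
  is_derive x X (fun y => inner (warped y) Y W)
   (2 * a (tcomp x) * derive1 a (tcomp x) * tcomp X *
      inner (h (scomp x)) (scomp Y) (scomp W)
    + a (tcomp x) ^+ 2 *
      'D_(scomp X) (fun z => inner (h z) (scomp Y) (scomp W)) (scomp x)).
Proof.
move=> [t0 Ux].
have -> : (fun y => inner (warped y) Y W) = fun y => - (tcomp Y * tcomp W) +
    a (tcomp y) * a (tcomp y) * inner (h (scomp y)) (scomp Y) (scomp W).
  by apply/funext => y; rewrite inner_warped expr2.
have Da := is_derive_tcomp X (da t0).
have Dh := is_derive_scomp (is_derive_inner hU (scomp X) (scomp Y) (scomp W) Ux).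
have := is_derive_addf (is_derive_constf (- (tcomp Y * tcomp W)) x X)
  (is_derive_mulf (is_derive_mulf Da Da) Dh).
by move=> /is_derive_eq; apply; ring.
Qed.

Lemma c2_metric_warped : c2_metric warped_dom warped.
Proof.
have [oU sU uU dU ddU] := hU.
have comp_s (F : 'rV[R]_n -> R) x : differentiable F (scomp x) ->
    differentiable (fun y => F (scomp y)) x.
  by move=> dF; apply: differentiable_comp => //; exact: differentiable_scomp.
have comp_t (F : R -> R) x : derivable F (tcomp x) 1 ->
    differentiable (fun y => F (tcomp y)) x.
  move=> /derivable1_diffP dF.
  by apply: differentiable_comp => //; exact: differentiable_tcomp.
split; first exact: open_warped_dom.
- move=> x [t0 Ux]; rewrite /warped tr_block_mx !trmx0 tr_scalar_mx.
  by rewrite linearZ /= sU.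
- move=> x [t0 Ux]; rewrite unitmxE det_lblock det_scalar1 detZ.
  rewrite unitrM unitrN1 unitrM -unitmxE uU // andbT.
  by rewrite !unitrX // unitfE gt_eqF // a_gt0.
- move=> Y W x [t0 Ux].
  have -> : (fun y => inner (warped y) Y W) = fun y => - (tcomp Y * tcomp W) +
      a (tcomp y) * a (tcomp y) * inner (h (scomp y)) (scomp Y) (scomp W).
    by apply/funext => y; rewrite inner_warped expr2.
  apply: differentiable_addf; first exact: differentiable_constf.
  apply: differentiable_mulf; last first.
    by apply: (comp_s (fun z => inner (h z) (scomp Y) (scomp W))); exact: dU.
  by apply: differentiable_mulf; apply: (comp_t a); exact: da.
move=> X Y W x xU.
apply: (@near_eq_differentiable _ _ (fun y => 2 * a (tcomp y) *
     derive1 a (tcomp y) * tcomp X * inner (h (scomp y)) (scomp Y) (scomp W)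
    + a (tcomp y) * a (tcomp y) *
      'D_(scomp X) (fun z => inner (h z) (scomp Y) (scomp W)) (scomp y))).
  apply: filterS (open_nbhs_nbhs (conj open_warped_dom xU)) => y yU.
  have [_ ->] := is_derive_inner_warped X Y W yU.
  by rewrite expr2.
have [t0 Ux] := xU.
have d1 := comp_t _ _ (da t0); have d2 := comp_t _ _ (dda t0).
apply: differentiable_addf.
  apply: differentiable_mulf; last first.
    by apply: (comp_s (fun z => inner (h z) (scomp Y) (scomp W))); exact: dU.
  apply: differentiable_mulf; last exact: differentiable_constf.
  apply: differentiable_mulf => //.
  by apply: differentiable_mulf => //; exact: differentiable_constf.
apply: differentiable_mulf; last first.
  apply: (comp_s (fun z => 'D_(scomp X) (fun z => inner (h z) (scomp Y) (scomp W)) z)).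
  exact: ddU.
exact: differentiable_mulf.
Qed.

Lemma low_warped x X Y W : warped_dom x -> low warped x X Y W =
  a (tcomp x) * derive1 a (tcomp x) *
    (tcomp X * inner (h (scomp x)) (scomp Y) (scomp W)
     + tcomp Y * inner (h (scomp x)) (scomp X) (scomp W)
     - tcomp W * inner (h (scomp x)) (scomp X) (scomp Y))
  + a (tcomp x) ^+ 2 * low h (scomp x) (scomp X) (scomp Y) (scomp W).
Proof.
move=> xU; rewrite /low.
have [_ ->] := is_derive_inner_warped X Y W xU.
have [_ ->] := is_derive_inner_warped Y X W xU.
have [_ ->] := is_derive_inner_warped W X Y xU.
move: (inner _ _ _) (inner _ _ _) (inner _ _ _) ('D_(_) _ _) ('D_(_) _ _) ('D_(_) _ _).
by move=> p q r k l m; field.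
Qed.

(** Both sides have the same inner product with every [W], so the block matrix need not be
    inverted. *)
Lemma chr_warped x X Y : warped_dom x -> chr warped x X Y =
  row_mx (a (tcomp x) * derive1 a (tcomp x) *
            inner (h (scomp x)) (scomp X) (scomp Y))%:M
    (derive1 a (tcomp x) / a (tcomp x) *:
       (tcomp X *: scomp Y + tcomp Y *: scomp X)
     + chr h (scomp x) (scomp X) (scomp Y)).
Proof.
move=> xU; have [t0 Ux] := xU.
apply: (inner_nondeg c2_metric_warped xU) => W.
rewrite (inner_chr c2_metric_warped X Y W xU) (low_warped X Y W xU) inner_warped.
rewrite /tcomp /scomp row_mxKl row_mxKr -/(tcomp x) -/(tcomp X) -/(tcomp Y).
rewrite -/(tcomp W) -/(scomp x) -/(scomp X) -/(scomp Y) -/(scomp W).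
rewrite innerDl innerZl innerDl !innerZl (inner_chr hU _ _ _ Ux).
rewrite [_%:M _ _]mxE eqxx mulr1n.
have : a (tcomp x) != 0 by rewrite gt_eqF // a_gt0.
move: (inner _ _ _) (inner _ _ _) (inner _ _ _) (low _ _ _ _ _) (a _) => p q r l b b0.
by field.
Qed.

Lemma is_derive_low_warped x Z X Y W : warped_dom x ->
  is_derive x Z (fun y => low warped y X Y W)
   (tcomp Z * (derive1 a (tcomp x) ^+ 2 + a (tcomp x) * derive1n 2 a (tcomp x)) *
      (tcomp X * inner (h (scomp x)) (scomp Y) (scomp W)
       + tcomp Y * inner (h (scomp x)) (scomp X) (scomp W)
       - tcomp W * inner (h (scomp x)) (scomp X) (scomp Y))
    + a (tcomp x) * derive1 a (tcomp x) *
      (tcomp X * 'D_(scomp Z) (fun z => inner (h z) (scomp Y) (scomp W)) (scomp x)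
       + tcomp Y * 'D_(scomp Z) (fun z => inner (h z) (scomp X) (scomp W)) (scomp x)
       - tcomp W * 'D_(scomp Z) (fun z => inner (h z) (scomp X) (scomp Y)) (scomp x))
    + 2 * tcomp Z * a (tcomp x) * derive1 a (tcomp x) *
      low h (scomp x) (scomp X) (scomp Y) (scomp W)
    + a (tcomp x) ^+ 2 *
      'D_(scomp Z) (fun z => low h z (scomp X) (scomp Y) (scomp W)) (scomp x)).
Proof.
move=> xU; have [t0 Ux] := xU.
have Da := is_derive_tcomp Z (da t0); have Dda := is_derive_tcomp Z (dda t0).
have Dh A B := is_derive_scomp (is_derive_inner hU (scomp Z) A B Ux).
have Dl : is_derive (scomp x) (scomp Z)
    (fun z => low h z (scomp X) (scomp Y) (scomp W))
    ('D_(scomp Z) (fun z => low h z (scomp X) (scomp Y) (scomp W)) (scomp x)).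
  exact/derivableP/diff_derivable/(differentiable_low hU).
have C c := is_derive_constf c x Z.
have D := is_derive_addf (is_derive_mulf (is_derive_mulf Da Dda)
  (is_derive_subf (is_derive_addf
     (is_derive_mulf (C (tcomp X)) (Dh (scomp Y) (scomp W)))
     (is_derive_mulf (C (tcomp Y)) (Dh (scomp X) (scomp W))))
     (is_derive_mulf (C (tcomp W)) (Dh (scomp X) (scomp Y)))))
  (is_derive_mulf (is_derive_mulf Da Da) (is_derive_scomp Dl)).
apply: (near_eq_is_derive (f := fun y => _) _ (is_derive_eq D _)).
  apply: filterS (open_nbhs_nbhs (conj open_warped_dom xU)) => y yU.
  by rewrite low_warped // expr2.
rewrite /derive1n /=.
move: (inner _ _ _) (inner _ _ _) (inner _ _ _) (low _ _ _ _ _).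
move: ('D_(_) _ _) ('D_(_) _ _) ('D_(_) _ _) ('D_(_) _ _).
by move=> p q r s p' q' r' s'; ring.
Qed.

(** The Gauss equation for the slices [t = const]: the first term is their intrinsic curvature, the
    second one comes from their second fundamental form. The third term, with [a''], is the
    curvature of the planes containing [d/dt]. *)
Lemma tidal_warped x X Y W : warped_dom x ->
  inner (warped x) (riemann warped x X Y Y) W =
  let b := a (tcomp x) in let hx := inner (h (scomp x)) in
  b ^+ 2 * hx (riemann h (scomp x) (scomp X) (scomp Y) (scomp Y)) (scomp W)
  + b ^+ 2 * derive1 a (tcomp x) ^+ 2 *
     (hx (scomp Y) (scomp Y) * hx (scomp X) (scomp W)
      - hx (scomp X) (scomp Y) * hx (scomp Y) (scomp W))
  - b * derive1n 2 a (tcomp x) *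
     (hx (scomp Y) (scomp Y) * tcomp X * tcomp W
      + hx (scomp X) (scomp W) * tcomp Y ^+ 2
      - hx (scomp X) (scomp Y) * tcomp Y * tcomp W
      - hx (scomp Y) (scomp W) * tcomp X * tcomp Y).
Proof.
move=> xU; cbv zeta; have [t0 Ux] := xU.
rewrite (inner_riemann c2_metric_warped X Y Y W xU).
have [_ ->] := is_derive_low_warped X Y Y W xU.
have [_ ->] := is_derive_low_warped Y X Y W xU.
rewrite (inner_riemann hU (scomp X) (scomp Y) (scomp Y) (scomp W) Ux).
rewrite !inner_warped !(chr_warped _ _ xU).
rewrite /tcomp /scomp !row_mxKl !row_mxKr -/(tcomp x) -/(tcomp X) -/(tcomp Y).
rewrite -/(tcomp W) -/(scomp x) -/(scomp X) -/(scomp Y) -/(scomp W).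
have [_ sU _ _ _] := hU.
have hC A B : inner (h (scomp x)) A B = inner (h (scomp x)) B A.
  by apply: innerC; exact: sU.
rewrite ![_%:M _ _]mxE eqxx !mulr1n.
have : a (tcomp x) != 0 by rewrite gt_eqF // a_gt0.
(* Compatibility expresses the first derivatives of [h] by [low h]. The rewriting below brings equal
   terms to one form, so that [field] can cancel them. *)
rewrite !(derive_inner_low hU _ _ _ Ux).
move: (scomp X) (scomp Y) (scomp W) (scomp x) Ux hC => A B C z Uz hC.
rewrite !(innerDl, innerDr, innerZl, innerZr).
rewrite ?(hC A (chr h z B B)) ?(hC C (chr h z B B)) ?(hC B (chr h z B B)).
rewrite ?(hC A (chr h z A B)) ?(hC C (chr h z A B)) ?(hC B (chr h z A B)).
rewrite !(inner_chr hU _ _ _ Uz).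
rewrite (hC C A) (hC B A) (hC C B).
have lC p q r : low h z p q r = low h z q p r by exact: (low_sym hU).
rewrite ?(lC B A C) ?(lC B A B).
move: (a _) (tcomp X) (tcomp Y) (tcomp W) => b p q r.
move: (derive1 a _) (derive1n 2 a _) => b1 b2 b0.
move: (low h z A C (chr h z B B)) (low h z B C (chr h z A B)) => k1 k2.
move: (low h z A B C) (low h z A C B) (low h z B B C) => k3 k4 k5.
move: (low h z B C B) (low h z A B B) (low h z B B A) (low h z B C A) => k6 k7 k8 k9.
move: ('D_A _ _) ('D_B _ _) (inner (h z) A B) (inner (h z) B B) => k10 k11 k12 k13.
move: (inner (h z) A C) (inner (h z) B C) => k14 k15.
by field.
Qed.

End WarpedMetric.

(** * The scalar Jacobi equations near the singularity *)

Section RealCalculus.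
Context {R : realType}.
Implicit Types (f F T : R -> R) (s : R).

Lemma is_derive_invf (V : normedModType R) (f : V -> R) x v (df : R) :
  f x != 0 -> is_derive x v f df ->
  is_derive x v (fun y => (f y)^-1) (- df / f x ^+ 2).
Proof.
move=> f0 [dfx <-]; split; first exact: derivableV.
by rewrite deriveV // /GRing.scale /= mulrC mulNr mulrN.
Qed.

Lemma is_derive_comp1 F T s (d : R) : is_derive s 1 T d -> derivable F (T s) 1 ->
  is_derive s 1 (fun r => F (T r)) (derive1 F (T s) * d).
Proof.
move=> [dT <-] dF; split.
  by apply/derivable1_diffP/differentiable_comp; apply/derivable1_diffP.
by rewrite -!derive1E (derive1_comp dT dF).
Qed.

Lemma is_derive_powR (q : R) T s (d : R) : is_derive s 1 T d -> 0 < T s ->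
  is_derive s 1 (fun r => T r `^ q) (q * T s `^ (q - 1) * d).
Proof.
move=> dT T0; have Ts : T s \in `]0, +oo[%R by rewrite in_itv /= T0.
have dq : derivable (fun x : R => x `^ q) (T s) 1 by exact: derivable_powR.
by have := is_derive_comp1 dT dq; move=> /is_derive_eq; apply; rewrite powR_derive1.
Qed.

Lemma is_derive_le F (f : R -> R) s s' : s <= s' ->
  (forall r, s <= r <= s' -> is_derive r 1 F (f r)) ->
  (forall r, s <= r <= s' -> 0 <= f r) -> F s <= F s'.
Proof.
move=> ss' dF f0.
have cF : {within `[s, s'], continuous F}.
  apply: derivable_within_continuous => r; rewrite in_itv /= => rs.
  by have [] := dF r rs.
have dF' r : r \in `]s, s'[%R -> is_derive r 1 F (f r).
  by rewrite in_itv /= => /andP[/ltW h1 /ltW h2]; apply: dF; rewrite h1 h2.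
have [c] := MVT_segment ss' dF' cF.
rewrite in_itv /= => cs; rewrite -subr_ge0 => ->.
by rewrite mulr_ge0 ?f0 // subr_ge0.
Qed.

Lemma is_derive0_cst F s s' (D : set R) : is_interval D -> D s -> D s' ->
  (forall r, D r -> is_derive r 1 F 0) -> F s = F s'.
Proof.
move=> iD; wlog ss' : s s' / s <= s' => [W|Ds Ds' dF].
  by case: (leP s s') => [|/ltW] h Ds Ds' dF; [|apply/esym]; exact: W.
have Dr r : s <= r <= s' -> D r by exact: iD.
apply/eqP; rewrite eq_le; apply/andP; split.
  by apply: (is_derive_le (f := fun=> 0) ss') => // r /Dr; exact: dF.
rewrite -lerN2; apply: (is_derive_le (F := fun r => - F r) (f := fun=> - 0) ss').
  by move=> r /Dr /dF ?; exact: is_deriveN.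
by rewrite oppr0.
Qed.

End RealCalculus.

Lemma powR_small (R : realType) (B q e : R) : 0 < q -> 0 < e ->
  exists2 t0 : R, 0 < t0 & forall t, 0 < t < t0 -> B * t `^ q < e.
Proof.
move=> q0 e0; pose e' := e / (`|B| + 1).
have B0 : 0 < `|B| + 1 by rewrite ltr_wpDl.
have e'0 : 0 < e' by rewrite divr_gt0.
have /cvgrPdist_lt /(_ _ e'0) := @powR_cvg0 R q q0.
rewrite near_withinE => /nbhs_norm0P[t0 /= t00 h]; exists t0 => // t /andP[tp tt].
have := h t; rewrite /= gtr0_norm // => /(_ tt tp).
rewrite sub0r normrN ger0_norm ?powR_ge0 // /e' ltr_pdivlMr // => {}h.
apply: le_lt_trans h; rewrite mulrC ler_wpM2l ?powR_ge0 //.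
by rewrite (le_trans (ler_norm B)) // lerDl.
Qed.

Lemma powR_sqr (R : realType) (t q : R) : (t `^ q) ^+ 2 = t `^ (2 * q).
Proof. by rewrite mulrC powRrM powR_mulrn // powR_ge0. Qed.

(** * Growth of the components of a Jacobi tensor as the time tends to 0 *)

Section Vanishing.
Context {R : realType}.
Variables (a : R -> R) (p kappa c0 C delta : R) (D : set R) (T v : R -> R) (s0 : R).
Hypothesis p_gt0 : 0 < p.
Hypothesis C_gt0 : 0 < C.
Hypothesis c0_le0 : c0 <= 0.
Hypothesis delta_gt0 : 0 < delta.
Hypothesis aE : forall t, 0 < t < delta -> a t = t `^ p.
Hypothesis a_gt0 : forall t, 0 < t -> 0 < a t.
Hypothesis da : forall t, 0 < t -> derivable a t 1.
Hypothesis dda : forall t, 0 < t -> derivable (derive1 a) t 1.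
Hypothesis itvD : is_interval D.
Hypothesis Ds0 : D s0.
Hypothesis T_gt0 : forall s, D s -> 0 < T s.
Hypothesis v_gt0 : forall s, D s -> 0 < v s.
Hypothesis dT : forall s, D s -> is_derive s 1 T (v s).
Hypothesis dv : forall s, D s ->
  is_derive s 1 v (- (derive1 a (T s) / a (T s)) * (v s ^+ 2 + c0)).
Hypothesis CE : forall s, D s -> a (T s) ^+ 2 * (v s ^+ 2 + c0) = C.
Hypothesis onto : forall t, 0 < t <= T s0 -> exists2 r, D r & T r = t.

Lemma time_le s s' : D s -> D s' -> s <= s' -> T s <= T s'.
Proof.
move=> Ds Ds' ss'; have Dr r : s <= r <= s' -> D r by exact: itvD.
by apply: (is_derive_le ss') => r /Dr; [exact: dT|move=> /v_gt0/ltW].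
Qed.

Lemma time_lt s s' : D s -> D s' -> T s < T s' -> s < s'.
Proof. by move=> Ds Ds'; apply: contraTT; rewrite -!leNgt; exact: time_le. Qed.

Let aT_gt0 s : D s -> 0 < a (T s). Proof. by move=> /T_gt0; exact: a_gt0. Qed.

(** Since [c0 <= 0], dropping it from [CE] leaves an inequality. As [dT = v ds], it bounds the
    conformal parameter [ds / a^2] by [dt / (sqrt C a)] and turns estimates in [s] into estimates in
    the time. *)
Lemma av_ge s : D s -> Num.sqrt C <= a (T s) * v s.
Proof.
move=> Ds; have av0 : 0 <= a (T s) * v s by rewrite mulr_ge0 ?ltW ?aT_gt0 ?v_gt0.
rewrite -(ler_pXn2r (_ : 0 < 2)%N) ?nnegrE ?sqrtr_ge0 // sqr_sqrtr; last exact: ltW.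
rewrite -(CE Ds) exprMn; apply: ler_wpM2l; first exact: sqr_ge0.
by rewrite -[leRHS]addr0 lerD2l.
Qed.

Section Transverse.
Variables (X X1 : R -> R).
Hypothesis dX : forall s, D s -> is_derive s 1 X (X1 s).
Hypothesis dX1 : forall s, D s -> is_derive s 1 X1
  (- (c0 * ((kappa + derive1 a (T s) ^+ 2) / a (T s) ^+ 2) +
      ((kappa + derive1 a (T s) ^+ 2) / a (T s) ^+ 2
       - derive1n 2 a (T s) / a (T s)) * v s ^+ 2) * X s).

(* In the conformal parameter ds / a^2 the pair (xi, eta) satisfies the
   constant coefficient system xi' = eta, eta' = - kappa C xi. *)
Let xi s := X s / a (T s).
Let eta s := X1 s * a (T s) - X s * (derive1 a (T s) * v s).

Let daT s : D s -> is_derive s 1 (fun r => a (T r)) (derive1 a (T s) * v s).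
Proof. by move=> Ds; apply: is_derive_comp1; [exact: dT|exact/da/T_gt0]. Qed.

Lemma is_derive_xi s : D s -> is_derive s 1 xi (eta s / a (T s) ^+ 2).
Proof.
move=> Ds; have a0 : a (T s) != 0 by rewrite gt_eqF ?aT_gt0.
have := is_derive_mulf (dX Ds) (is_derive_invf a0 (daT Ds)).
by move=> /is_derive_eq; apply; rewrite /eta; field.
Qed.

(** The terms with [a''] cancel against the derivative of [a' v], those with [a'^2] against [v'];
    what is left is [- kappa (v^2 + c0) xi], and [CE] replaces [v^2 + c0] by [C / a^2]. *)
Lemma is_derive_eta s : D s ->
  is_derive s 1 eta (- (kappa * C) * xi s / a (T s) ^+ 2).
Proof.
move=> Ds; have a0 : a (T s) != 0 by rewrite gt_eqF ?aT_gt0.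
have d2 := is_derive_comp1 (dT Ds) (dda (T_gt0 Ds)).
have := is_derive_subf (is_derive_mulf (dX1 Ds) (daT Ds))
  (is_derive_mulf (dX Ds) (is_derive_mulf d2 (dv Ds))).
move=> /is_derive_eq; apply; rewrite /xi -(CE Ds) /derive1n /=.
move: a0; move: (a _) (derive1 a _) (derive1 (derive1 a) _) (v s) (X s) (X1 s).
by move=> b b1 b2 w x x1 b0; field.
Qed.

(** The estimates below are integrated from a reference parameter [s1] of time [t] back to an
    earlier [s]; the segment between them stays in [D] and at times at most [t]. *)
Let base (t : R) : 0 < t <= T s0 -> exists s1, [/\ D s1, T s1 = t &
  forall s, D s -> T s < t -> s <= s1 /\
    forall r, s <= r <= s1 -> D r /\ T r <= t].
Proof.
move=> /onto [s1 Ds1 <-]; exists s1; split => // s Ds sT.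
have ss1 : s <= s1 by rewrite ltW // time_lt.
split=> // r rs; have Dr : D r by exact: itvD Ds Ds1 _ rs.
by split=> //; apply: time_le => //; case/andP: rs.
Qed.

(** For [kappa > 0] the system is a harmonic oscillator, whose energy [M] is conserved and dominates
    [xi^2]. *)
Lemma xi_bounded_pos : 0 < kappa -> exists2 B : R, 0 <= B &
  forall s, D s -> xi s ^+ 2 <= B.
Proof.
move=> k0; pose M s := kappa * C * (xi s * xi s) + eta s * eta s.
have dM s : D s -> is_derive s 1 M 0.
  move=> Ds; have h1 := is_derive_xi Ds; have h2 := is_derive_eta Ds.
  have := is_derive_addf (is_derive_mulf (is_derive_constf (kappa * C) s 1)
    (is_derive_mulf h1 h1)) (is_derive_mulf h2 h2).
  by move=> /is_derive_eq; apply; ring.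
have kC : 0 < kappa * C by rewrite mulr_gt0.
have M0 s : 0 <= M s.
  by rewrite /M -!expr2 addr_ge0 ?sqr_ge0 // mulr_ge0 ?sqr_ge0 // ltW.
exists (M s0 / (kappa * C)); first by rewrite divr_ge0 ?M0 // ltW.
move=> s Ds; rewrite ler_pdivlMr // -(is_derive0_cst itvD Ds Ds0 dM) mulrC.
by rewrite /M -!expr2 lerDl sqr_ge0.
Qed.

Let sC_gt0 : 0 < Num.sqrt C. Proof. by rewrite sqrtr_gt0. Qed.

(** For [kappa < 0] the system has the real rates [k / a^2] and [- k / a^2]. Backwards in time one
    eigenmode decays, and the hypothesis on [sigma] bounds the other one by a multiple of
    [T^(- sigma)]. *)
Lemma xi_bounded_neg (sigma t1 : R) : kappa < 0 -> 0 < t1 <= T s0 ->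
  (forall t, 0 < t <= t1 -> Num.sqrt (- kappa) * t <= sigma * a t) ->
  exists2 B : R, 0 <= B & forall s, D s -> T s < t1 ->
    xi s ^+ 2 * T s `^ (2 * sigma) <= B * (1 + T s `^ (2 * sigma)).
Proof.
move=> k0 /base[s1 [Ds1 Ts1 s1P]] sig.
pose mu := Num.sqrt (- kappa); pose k := mu * Num.sqrt C.
have mu0 : 0 < mu by rewrite sqrtr_gt0 oppr_gt0.
have kk : 0 < k by rewrite mulr_gt0.
have k2 : k ^+ 2 = - (kappa * C).
  by rewrite exprMn !sqr_sqrtr ?mulNr // ltW // oppr_gt0.
(* The two eigenmodes; they satisfy [gp + gm = 2 k xi]. *)
pose gp s := k * xi s + eta s; pose gm s := k * xi s - eta s.
have dgp s : D s -> is_derive s 1 gp (k / a (T s) ^+ 2 * gp s).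
  move=> Ds; have h1 := is_derive_xi Ds; have h2 := is_derive_eta Ds.
  have := is_derive_addf (is_derive_mulf (is_derive_constf k s 1) h1) h2.
  by move=> /is_derive_eq; apply; rewrite /gp -k2; ring.
have dgm s : D s -> is_derive s 1 gm (- (k / a (T s) ^+ 2) * gm s).
  move=> Ds; have h1 := is_derive_xi Ds; have h2 := is_derive_eta Ds.
  have := is_derive_subf (is_derive_mulf (is_derive_constf k s 1) h1) h2.
  by move=> /is_derive_eq; apply; rewrite /gm -k2; ring.
have ka0 s : D s -> 0 <= k / a (T s) ^+ 2.
  by move=> Ds; rewrite divr_ge0 ?ltW // exprn_gt0 // aT_gt0.
have gpB s : D s -> T s < t1 -> gp s ^+ 2 <= gp s1 ^+ 2.
  move=> Ds st; have [ss1 ssP] := s1P s Ds st.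
  rewrite !expr2; apply: (is_derive_le (F := fun r => gp r * gp r)
    (f := fun r => 2 * (k / a (T r) ^+ 2) * gp r ^+ 2) ss1) => r /ssP[Dr _].
    have := is_derive_mulf (dgp r Dr) (dgp r Dr).
    by move=> /is_derive_eq; apply; ring.
  by rewrite mulr_ge0 ?sqr_ge0 // mulr_ge0 // ka0.
(* The weight makes [gm^2 w] nondecreasing: its logarithmic derivative [2 sigma v / T - 2 k / a^2]
   is nonnegative by [av_ge] and the hypothesis on [sigma]. *)
pose w s := T s `^ (2 * sigma).
have gmB s : D s -> T s < t1 -> gm s ^+ 2 * w s <= gm s1 ^+ 2 * w s1.
  move=> Ds st; have [ss1 ssP] := s1P s Ds st.
  rewrite !expr2; apply: (is_derive_le (F := fun r => gm r * gm r * w r)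
    (f := fun r => (- 2 * (k / a (T r) ^+ 2) + 2 * sigma * v r / T r)
                   * (gm r ^+ 2 * w r)) ss1) => r /ssP[Dr rt].
    have T0 := T_gt0 Dr.
    have := is_derive_mulf (is_derive_mulf (dgm r Dr) (dgm r Dr))
      (is_derive_powR (2 * sigma) (dT Dr) T0).
    move=> /is_derive_eq; apply; rewrite /w.
    rewrite powRB; last by rewrite (gt_eqF T0) /= implybT.
    rewrite powRr1; last exact: ltW.
    have T0' : T r != 0 by rewrite gt_eqF.
    have a0 : a (T r) != 0 by rewrite gt_eqF ?aT_gt0.
    move: a0 T0'; move: (v r) (T r) (gm r) (a _) (_ `^ _) => y t g b q.
    by move=> b0 t0; field; rewrite b0 t0.
  apply: mulr_ge0; last by rewrite mulr_ge0 ?sqr_ge0 // powR_ge0.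
  have := sig (T r); rewrite T_gt0 // rt => /(_ isT) h.
  have := av_ge Dr; have := aT_gt0 Dr; have := T_gt0 Dr.
  rewrite -/mu in h; rewrite /k.
  move: h mu0 sC_gt0; move: (T r) (a _) (v r) (Num.sqrt C) => t b y c h m0 c_0 t0 b0 hc.
  have -> : - 2 * (mu * c / b ^+ 2) + 2 * sigma * y / t =
     2 * (sigma * b * (b * y) - mu * t * c) / (t * b ^+ 2).
    by field; rewrite !gt_eqF.
  rewrite divr_ge0 //; last by rewrite mulr_ge0 ?sqr_ge0 ?ltW.
  rewrite mulr_ge0 // subr_ge0; apply: ler_pM => //; rewrite ?mulr_ge0 ?ltW //.
exists ((gp s1 ^+ 2 + gm s1 ^+ 2 * w s1) / k ^+ 2).
  by rewrite divr_ge0 ?sqr_ge0 // addr_ge0 ?sqr_ge0 // mulr_ge0 ?sqr_ge0 ?powR_ge0.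
move=> s Ds st; have h1 := gpB s Ds st; have h2 := gmB s Ds st.
rewrite [leRHS]mulrAC ler_pdivlMr ?exprn_gt0 // -/(w s).
have w0 : 0 <= w s by exact: powR_ge0.
have w1 : 0 <= w s1 by exact: powR_ge0.
have -> : xi s ^+ 2 * w s * k ^+ 2 = 4^-1 * (gp s + gm s) ^+ 2 * w s.
  by rewrite /gp /gm; field.
have h3 : (gp s + gm s) ^+ 2 <= 2 * gp s ^+ 2 + 2 * gm s ^+ 2.
  rewrite -subr_ge0.
  by rewrite (_ : _ - _ = (gp s - gm s) ^+ 2) ?sqr_ge0 //; ring.
have h4 := ler_wpM2r w0 h3; have h5 := ler_wpM2r w0 h1.
have h6 : 0 <= gm s1 ^+ 2 * w s1 by rewrite mulr_ge0 ?sqr_ge0.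
have h7 := mulr_ge0 h6 w0.
have h8 := sqr_ge0 (gp s1); have h9 := mulr_ge0 h8 w0.
move: h2 h4 h5 h6 h7 h8 h9.
move: ((gp s + gm s) ^+ 2) (gp s ^+ 2) (gm s ^+ 2) (gp s1 ^+ 2) (gm s1 ^+ 2 * w s1).
by move=> x1 x2 x3 x4 x5; move: (w s) => y; lra.
Qed.

(** For [kappa = 0] the function [eta] is constant and [xi' = eta / a^2]. By [av_ge] and the lower
    bound on [a], this is dominated by a multiple of [T^(- sigma - 1) v], whose primitive is a power
    of the time. *)
Lemma xi_bounded_zero (sigma t1 : R) : kappa = 0 -> 0 < t1 <= T s0 ->
  0 < sigma -> (forall t, 0 < t <= t1 -> t `^ (sigma + 1) <= a t) ->
  exists2 B : R, 0 <= B & forall s, D s -> T s < t1 ->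
    `|xi s| * T s `^ sigma <= B * (1 + T s `^ sigma).
Proof.
move=> k0 /base[s1 [Ds1 Ts1 s1P]] sig0 sig.
have deta s : D s -> is_derive s 1 eta 0.
  by move=> Ds; have := is_derive_eta Ds; rewrite k0 !mul0r oppr0 !mul0r.
(* Chosen so that [- q T^(- sigma)] is a primitive of [|eta| T^(- sigma - 1) v / sqrt C], the bound
   for [|xi'|]. *)
pose q := `|eta s0| / (sigma * Num.sqrt C).
have q0 : 0 <= q by rewrite divr_ge0 // mulr_ge0 // ltW.
have etaE s : D s -> eta s = eta s0.
  by move=> Ds; exact: (is_derive0_cst itvD Ds Ds0 deta).
(* The sign [b] is taken to be 1 and -1 afterwards, which bounds [|xi|]. *)
have dxi (b : R) s : `|b| = 1 -> D s -> T s < t1 ->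
    b * xi s <= `|xi s1| + q * T s `^ (- sigma).
  move=> b1 Ds st; have [ss1 ssP] := s1P s Ds st.
  have : b * xi s - q * T s `^ (- sigma) <= b * xi s1 - q * T s1 `^ (- sigma).
    apply: (is_derive_le (F := fun r => b * xi r - q * T r `^ (- sigma))
      (f := fun r => b * eta s0 / a (T r) ^+ 2
              + q * sigma * T r `^ (- sigma - 1) * v r) ss1) => r /ssP[Dr rt].
      have := is_derive_subf (is_derive_mulf (is_derive_constf b r 1) (is_derive_xi Dr))
        (is_derive_mulf (is_derive_constf q r 1)
           (is_derive_powR (- sigma) (dT Dr) (T_gt0 Dr))).
      by move=> /is_derive_eq; apply; rewrite etaE //; ring.
    have T0 := T_gt0 Dr; have A0 := aT_gt0 Dr.
    have h1 : - `|eta s0| <= b * eta s0.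
      by rewrite -[`|_|]mul1r -b1 -normrM lerNl ler_normr lexx orbT.
    have h2 : `|eta s0| / a (T r) ^+ 2 <= q * sigma * T r `^ (- sigma - 1) * v r.
      rewrite -opprD powRN.
      have -> : q * sigma = `|eta s0| / Num.sqrt C.
        by rewrite /q; field; rewrite !gt_eqF.
      have P0 : 0 < T r `^ (sigma + 1) by rewrite powR_gt0.
      have h := sig (T r); rewrite T0 rt in h; have {}h := h isT.
      have hav := av_ge Dr.
      have e0 := normr_ge0 (eta s0).
      move: P0 A0 h hav sC_gt0 e0; move: (_ `^ _) (a _) (v r) (Num.sqrt C) (`|_|).
      move=> P A y c e P0 A0 h hav c_0 e0.
      rewrite -subr_ge0 (_ : _ - _ = e * (A * (A * y) - P * c) / (c * P * A ^+ 2)).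
        apply: divr_ge0; last by rewrite !mulr_ge0 ?sqr_ge0 ?ltW.
        by rewrite mulr_ge0 // subr_ge0 ler_pM // ltW.
      by field; rewrite !gt_eqF.
    have : - (`|eta s0| / a (T r) ^+ 2) <= b * eta s0 / a (T r) ^+ 2.
      by rewrite -mulNr ler_wpM2r // invr_ge0 sqr_ge0.
    move: h2; move: (b * _ / _) (`|eta s0| / _) (_ * v r) => z x y xy zx.
    by rewrite (le_trans _ (lerD zx xy)) // addNr.
  have h1 : b * xi s1 <= `|xi s1|.
    by rewrite (le_trans (ler_norm _)) // normrM b1 mul1r.
  have h2 : 0 <= q * T s1 `^ (- sigma) by rewrite mulr_ge0 ?powR_ge0.
  move=> h0; rewrite -lerBlDr; apply: (le_trans h0); rewrite lerBlDr.
  by apply: (le_trans h1); rewrite lerDl.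
exists (`|xi s1| + q); first by rewrite addr_ge0.
move=> s Ds st.
have h : `|xi s| <= `|xi s1| + q * T s `^ (- sigma).
  rewrite ler_norml; apply/andP; split.
    by rewrite lerNl -mulN1r; apply: dxi; rewrite // normrN normr1.
  by rewrite -[xi s]mul1r; apply: dxi; rewrite // normr1.
have P0 : 0 < T s `^ sigma by rewrite powR_gt0 // T_gt0.
have := ler_wpM2r (ltW P0) h; rewrite powRN mulrDl mulfVK ?gt_eqF //.
have := normr_ge0 (xi s1); have := mulr_ge0 q0 (ltW P0).
by move: (`|xi s|) (`|xi s1|) (_ `^ _) => x y z ? ?; nra.
Qed.

(** As [X = a xi] with [a = T^p] near the singularity, it suffices that [xi] is bounded by a
    multiple of [1 + T^(- sigma)] for some [sigma < p]. *)
Lemma transverse_vanish : [\/ 0 < kappa, kappa = 0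
    | kappa < 0 /\ (p < 1 \/ p = 1 /\ -1 < kappa)] ->
  forall e, 0 < e -> exists2 t0 : R, 0 < t0 &
    forall s, D s -> T s < t0 -> `|X s| < e.
Proof.
have XE s : D s -> X s = a (T s) * xi s.
  by move=> Ds; rewrite /xi mulrC divfK // gt_eqF ?aT_gt0.
have T00 := T_gt0 Ds0.
case=> [k0|k0|[k0 kp]] e e0.
- have [B B0 xiB] := xi_bounded_pos k0.
  have [|t0 t00 h] := @powR_small _ B (2 * p) (e ^+ 2) _ (exprn_gt0 _ e0).
    by rewrite mulr_gt0.
  exists (Num.min t0 delta) => [|s Ds]; first by rewrite lt_min t00.
  rewrite lt_min => /andP[st sd]; have T0 := T_gt0 Ds.
  rewrite -(ltr_pXn2r (_ : 0 < 2)%N) ?nnegrE // ?ltW // real_normK ?num_real //.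
  rewrite XE // exprMn aE ?T0 // powR_sqr.
  apply: le_lt_trans (h (T s) _); last by rewrite T0.
  by rewrite mulrC ler_wpM2r ?powR_ge0 // xiB.
(* The exponent lies below [p] for the conclusion, and is at least [p - 1] so that
   [t^(sg + 1) <= t^p] for [t <= 1]. *)
- have [sg [sg0 sgp sg1]] : exists sg, [/\ 0 < sg, sg < p & p <= sg + 1].
    have [p1|p1] := lerP p 1.
      by exists (p / 2); split; move: p1 p_gt0; lra.
    by exists (p - 1 / 2); split; move: p1 p_gt0; lra.
  pose t1 := Num.min (T s0) (Num.min 1 (delta / 2)).
  have d2 : 0 < delta / 2 by rewrite divr_gt0.
  have dd : delta / 2 < delta by move: delta_gt0; lra.
  have t10 : 0 < t1 <= T s0 by rewrite !lt_min T00 ltr01 d2 ge_min lexx.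
  have tP t : t <= t1 -> t <= 1 /\ t < delta.
    by rewrite !le_min => /and3P[_ -> h]; split=> //; exact: le_lt_trans h dd.
  have [|B B0 xiB] := xi_bounded_zero k0 t10 sg0.
    move=> t /andP[t0 /tP[t1' td]]; rewrite aE ?t0 //.
    by apply: ger_powR; rewrite ?t0.
  have e2 : 0 < e / 2 by rewrite divr_gt0.
  have [t2 t20 h2] := @powR_small _ B p (e / 2) p_gt0 e2.
  have [|t3 t30 h3] := @powR_small _ B (p - sg) (e / 2) _ e2.
    by rewrite subr_gt0.
  exists (Num.min t1 (Num.min t2 t3)) => [|s Ds].
    by case/andP: t10 => t10 _; rewrite lt_min t10 lt_min t20.
  rewrite lt_min => /andP[st1]; rewrite lt_min => /andP[st2 st3]; have T0 := T_gt0 Ds.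
  have P0 : 0 < T s `^ sg by rewrite powR_gt0.
  have [_ sd] := tP _ (ltW st1).
  rewrite XE // normrM gtr0_norm ?aT_gt0 // aE ?T0 //.
  have h : `|xi s| <= B * (1 + (T s `^ sg)^-1).
    rewrite -(ler_pM2r P0) (le_trans (xiB s Ds st1)) // -mulrA ler_wpM2l //.
    by rewrite mulrDl mul1r mulVf ?gt_eqF // addrC.
  have P1 := powR_ge0 (T s) p.
  apply: (le_lt_trans (ler_wpM2l P1 h)).
  have -> : T s `^ p * (B * (1 + (T s `^ sg)^-1)) =
      B * T s `^ p + B * T s `^ (p - sg).
    by rewrite powRB ?gt_eqF ?implybT //; ring.
  by rewrite (splitr e) ltrD // ?h2 ?h3 // T0.
(* For [p < 1] any [sg] in []0, p[] would do close to 0, because [t] is then negligible against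
   [t^p]; [p / 2] is taken. *)
- have [sg [t4 [t40 sgp sgP]]] : exists sg t4, [/\ 0 < t4, sg < p &
      forall t, 0 < t < t4 -> Num.sqrt (- kappa) * t <= sg * t `^ p].
    case: kp => [p1|[p1 k1]].
      have [||t0 t00 h] := @powR_small _ (Num.sqrt (- kappa)) (1 - p) (p / 2).
      - by rewrite subr_gt0.
      - by rewrite divr_gt0.
      exists (p / 2), t0; split=> // [|t tt]; first by move: p_gt0; lra.
      have t0' : 0 < t by case/andP: tt.
      have -> : Num.sqrt (- kappa) * t = Num.sqrt (- kappa) * t `^ (1 - p) * t `^ p.
        rewrite -mulrA -powRD; last by rewrite (gt_eqF t0') /= implybT.
        by rewrite subrK powRr1 // ltW.
      by rewrite ler_wpM2r ?powR_ge0 // ltW // h.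
    (* For [p = 1] the required inequality is an equality with this [sg], and [sg < p] means
       [kappa > -1]. *)
    exists (Num.sqrt (- kappa)), 1; split=> // [|t /andP[t0 _]].
      by rewrite p1 -sqrtr1 ltr_sqrt // ltrNl.
    by rewrite p1 powRr1 // ltW.
  pose t1 := Num.min (T s0) (Num.min (t4 / 2) (delta / 2)).
  have d2 : 0 < delta / 2 by rewrite divr_gt0.
  have d4 : 0 < t4 / 2 by rewrite divr_gt0.
  have t10 : 0 < t1 <= T s0 by rewrite !lt_min T00 d4 d2 ge_min lexx.
  have tP t : t <= t1 -> t < t4 /\ t < delta.
    rewrite !le_min => /and3P[_ h1 h2].
    by split; [apply: (le_lt_trans h1)|apply: (le_lt_trans h2)];
      rewrite ltr_pdivrMr // ltr_pMr // ltr1n.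
  have [|B B0 xiB] := xi_bounded_neg k0 t10 (sigma := sg).
    by move=> t /andP[t0 /tP[t1' td]]; rewrite aE ?t0 // sgP ?t0.
  have e2 : 0 < e ^+ 2 / 2 by rewrite divr_gt0 // exprn_gt0.
  have [|t2 t20 h2] := @powR_small _ B (2 * p) (e ^+ 2 / 2) _ e2.
    by rewrite mulr_gt0.
  have [|t3 t30 h3] := @powR_small _ B (2 * p - 2 * sg) (e ^+ 2 / 2) _ e2.
    by rewrite -mulrBr mulr_gt0 // subr_gt0.
  exists (Num.min t1 (Num.min t2 t3)) => [|s Ds].
    by case/andP: t10 => t10 _; rewrite lt_min t10 lt_min t20.
  rewrite lt_min => /andP[st1]; rewrite lt_min => /andP[st2 st3]; have T0 := T_gt0 Ds.
  have P0 : 0 < T s `^ (2 * sg) by rewrite powR_gt0.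
  have [_ sd] := tP _ (ltW st1).
  rewrite -(ltr_pXn2r (_ : 0 < 2)%N) ?nnegrE // ?ltW // real_normK ?num_real //.
  rewrite XE // exprMn aE ?T0 // powR_sqr.
  have h : xi s ^+ 2 <= B * (1 + (T s `^ (2 * sg))^-1).
    move: P0 (xiB s Ds st1); move: (T s `^ _) => y y0 h.
    rewrite -(ler_pM2r y0) (le_trans h) // -mulrA ler_wpM2l //.
    by rewrite mulrDl mul1r mulVf ?gt_eqF // addrC.
  have P1 := powR_ge0 (T s) (2 * p).
  apply: (le_lt_trans (ler_wpM2l P1 h)).
  have -> : T s `^ (2 * p) * (B * (1 + (T s `^ (2 * sg))^-1)) =
      B * T s `^ (2 * p) + B * T s `^ (2 * p - 2 * sg).
    rewrite powRB; last by rewrite (gt_eqF T0) /= implybT.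
    by move: (_ `^ (2 * p)) (_ `^ (2 * sg)) => y z; ring.
  by rewrite (splitr (e ^+ 2)) ltrD // ?h2 ?h3 // T0.
Qed.

End Transverse.

Section Longitudinal.
Variables (X X1 : R -> R).
Hypothesis c0E : c0 = -1.
Hypothesis dX : forall s, D s -> is_derive s 1 X (X1 s).
Hypothesis dX1 : forall s, D s ->
  is_derive s 1 X1 (derive1n 2 a (T s) / a (T s) * X s).

(* a v solves the same equation as X, hence their Wronskian is constant. *)
Lemma longitudinal_bounded : exists B t0 : R, [/\ 0 <= B, 0 < t0 &
  forall s, D s -> T s < t0 -> `|X s| <= B].
Proof.
pose w s := a (T s) * v s.
have dw s : D s -> is_derive s 1 w (derive1 a (T s)).
  move=> Ds; have a0 : a (T s) != 0 by rewrite gt_eqF ?aT_gt0.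
  have dA := is_derive_comp1 (dT Ds) (da (T_gt0 Ds)).
  have := is_derive_mulf dA (dv Ds).
  by move=> /is_derive_eq; apply; rewrite c0E; field.
have w0 s : D s -> 0 < w s by move=> Ds; rewrite mulr_gt0 ?aT_gt0 ?v_gt0.
have w2 s : D s -> w s ^+ 2 = C + a (T s) ^+ 2.
  by move=> Ds; rewrite -(CE Ds) c0E /w; ring.
pose q s := X1 s * w s - X s * derive1 a (T s).
have dq s : D s -> is_derive s 1 q 0.
  move=> Ds; have a0 : a (T s) != 0 by rewrite gt_eqF ?aT_gt0.
  have d2 := is_derive_comp1 (dT Ds) (dda (T_gt0 Ds)).
  have := is_derive_subf (is_derive_mulf (dX1 Ds) (dw s Ds)) (is_derive_mulf (dX Ds) d2).
  by move=> /is_derive_eq; apply; rewrite /w /derive1n /=; field.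
have qE s : D s -> q s = q s0 by move=> Ds; exact: (is_derive0_cst itvD Ds Ds0 dq).
(* The quotient [X / w] has derivative [q / w^2]. As [w^2 >= C] and [v >= 1], it is bounded by
   [k v], the derivative of [k T]; so both [X / w + k T] and [- X / w + k T] are nondecreasing and
   bounded by their value at [s0]. *)
pose k := `|q s0| / C; have k0 : 0 <= k by rewrite divr_ge0 // ltW.
have v1 s : D s -> 1 <= v s.
  move=> Ds; have := CE Ds; have := v_gt0 Ds; have := aT_gt0 Ds; rewrite c0E.
  move: (a _) (v s) => b y b0 y0 h; rewrite leNgt; apply/negP => y1.
  have : b ^+ 2 * (y ^+ 2 - 1) <= 0.
    rewrite mulr_ge0_le0 ?sqr_ge0 // subr_le0 expr_le1 // ltW //.
  by rewrite h leNgt C_gt0.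
have bnd (b : R) s : `|b| = 1 -> D s -> T s < T s0 ->
    b * (X s / w s) <= `|X s0 / w s0| + k * T s0.
  move=> b1 Ds st; have ss0 : s <= s0 by rewrite ltW // time_lt.
  have Dr r : s <= r <= s0 -> D r by exact: itvD.
  have : b * (X s / w s) + k * T s <= b * (X s0 / w s0) + k * T s0.
    apply: (is_derive_le (F := fun r => b * (X r / w r) + k * T r)
      (f := fun r => b * q s0 / w r ^+ 2 + k * v r) ss0) => r /Dr {}Dr.
      have w00 : w r != 0 by rewrite gt_eqF ?w0.
      have := is_derive_addf (is_derive_mulf (is_derive_constf b r 1)
        (is_derive_mulf (dX Dr) (is_derive_invf w00 (dw r Dr))))
        (is_derive_mulf (is_derive_constf k r 1) (dT Dr)).
      by move=> /is_derive_eq; apply; rewrite -(qE r Dr) /q; field.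
    have h1 : - `|q s0| <= b * q s0.
      by rewrite -[`|_|]mul1r -b1 -normrM lerNl ler_normr lexx orbT.
    have h2 : `|q s0| / w r ^+ 2 <= k * v r.
      apply: (@le_trans _ _ k); last by rewrite ler_peMr // v1.
      rewrite /k ler_wpM2l // lef_pV2 ?posrE ?exprn_gt0 ?w0 //.
      by rewrite w2 // lerDl sqr_ge0.
    have h3 : - (`|q s0| / w r ^+ 2) <= b * q s0 / w r ^+ 2.
      by rewrite -mulNr ler_wpM2r // invr_ge0 sqr_ge0.
    by rewrite (le_trans _ (lerD h3 h2)) // addNr.
  have kT : 0 <= k * T s by rewrite mulr_ge0 // ltW // T_gt0.
  move=> h; apply: (le_trans _ (le_trans h _)); first by rewrite lerDl.
  by rewrite lerD2r (le_trans (ler_norm _)) // normrM b1 mul1r.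
pose M := `|X s0 / w s0| + k * T s0.
have M0 : 0 <= M by rewrite addr_ge0 // mulr_ge0 // ltW // T_gt0.
(* At times below 1 and [delta] one has [w^2 = C + a^2 <= C + 1 <= (C + 1)^2]. *)
exists (M * (C + 1)), (Num.min (T s0) (Num.min 1 delta)).
split; first by rewrite mulr_ge0 // addr_ge0 // ltW.
  by rewrite !lt_min T_gt0 // ltr01.
move=> s Ds; rewrite !lt_min => /and3P[st s1 sd]; have T0 := T_gt0 Ds.
have h : `|X s / w s| <= M.
  rewrite ler_norml; apply/andP; split.
    by rewrite lerNl -mulN1r; apply: bnd; rewrite // normrN normr1.
  by rewrite -[X in X <= _]mul1r; apply: bnd; rewrite // normr1.
have -> : X s = X s / w s * w s by rewrite divfK // gt_eqF ?w0.
rewrite normrM; apply: ler_pM => //; rewrite gtr0_norm ?w0 //.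
have C1 : 0 <= C + 1 by rewrite addr_ge0 // ltW.
rewrite -(ler_pXn2r (_ : 0 < 2)%N) ?nnegrE //; last by rewrite ltW ?w0.
rewrite w2 // aE ?T0 // powR_sqr.
have : T s `^ (2 * p) <= 1.
  rewrite -[leRHS](powRr0 (T s)); apply: ger_powR; first by rewrite T0 ltW.
  by rewrite mulr_ge0 // ltW.
by move: (_ `^ _) => y y1; move: C_gt0; nra.
Qed.

End Longitudinal.
End Vanishing.

(** * Covariant derivatives along a curve *)

Section CovariantDerivative.
Context {R : realType} {n : nat}.
Variables (U : set 'rV[R]_n) (g : 'rV[R]_n -> 'M[R]_n) (c : R -> 'rV[R]_n).
Hypothesis gU : c2_metric U g.
Implicit Types (V W : R -> 'rV[R]_n) (s : R).

(** [cdot] and [cov] are [velocity] and [covD] read in a single chart, for a bare curve of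
    coordinates; with the data of a chart filled in they are convertible with them. *)
Definition cdot s : 'rV[R]_n := \row_k derive1 (fun r => c r 0 k) s.

Definition cov V s : 'rV[R]_n :=
  \row_k (derive1 (fun r => V r 0 k) s
    + \sum_(l < n) \sum_(m < n) christoffel g k l m (c s)
        * cdot s 0 l * V s 0 m).

Definition derivable_rV V s := forall k, derivable (fun r => V r 0 k) s 1.

Lemma covE V s :
  cov V s = \row_k derive1 (fun r => V r 0 k) s + chr g (c s) (cdot s) (V s).
Proof. by apply/rowP => k; rewrite !mxE. Qed.

Lemma is_derive_inner_along V W s : U (c s) -> derivable_rV c s ->
  derivable_rV V s -> derivable_rV W s ->
  is_derive s 1 (fun r => inner (g (c r)) (V r) (W r))
    (inner (g (c s)) (cov V s) (W s) + inner (g (c s)) (V s) (cov W s)).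
Proof.
move=> Us dc dV dW.
have dG i j : is_derive s 1 (fun r => g (c r) i j) (metric_deriv g (c s) (cdot s) i j).
  rewrite mxE; apply: (is_derive_comp_rV (f := fun y => g y i j) dc).
  exact: (differentiable_metric gU).
have d1 (F : R -> 'rV[R]_n) : derivable_rV F s -> forall k,
    is_derive s 1 (fun r => F r 0 k) ((\row_k derive1 (fun r => F r 0 k) s) 0 k).
  by move=> dF k; rewrite mxE derive1E; exact/derivableP/dF.
have := is_derive_inner_fun dG (d1 V dV) (d1 W dW).
move=> /is_derive_eq; apply; rewrite !covE innerDl innerDr.
rewrite (inner_metric_deriv gU) //.
have sg : (g (c s))^T = g (c s) by case: gU => _ + _ _ _; apply.
rewrite (innerC _ (chr g (c s) (cdot s) (W s)) sg) !(inner_chr gU) //.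
move: (inner _ (\row__ _) _) (inner _ _ (\row__ _)) (low _ _ _ _ _) (low _ _ _ _ _).
by move=> p q r t; ring.
Qed.

Lemma derivable_cov V s : U (c s) -> derivable_rV c s -> derivable_rV V s ->
  derivable_rV cdot s -> derivable_rV (fun r => \row_k derive1 (fun r => V r 0 k) r) s ->
  derivable_rV (cov V) s.
Proof.
move=> Us dc dV ddc ddV k.
have mk (f : R -> R) : derivable f s 1 -> is_derive s 1 f ('D_1 f s) by exact: derivableP.
have -> : (fun r => cov V r 0 k) = fun r =>
   (\row_k derive1 (fun r => V r 0 k) r) 0 k +
    \sum_(l < n) \sum_(m < n) christoffel g k l m (c r) * cdot r 0 l * V r 0 m.
  by apply/funext => r; rewrite [LHS]mxE [in RHS]mxE.
apply: (@ex_derive _ _ _ _ _ _ (_ + \sum_(l < n) \sum_(m < n)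
   ('D_(cdot s) (christoffel g k l m) (c s) * cdot s 0 l * V s 0 m
    + christoffel g k l m (c s) * 'D_1 (fun r => cdot r 0 l) s * V s 0 m
    + christoffel g k l m (c s) * cdot s 0 l * 'D_1 (fun r => V r 0 m) s))).
apply: is_derive_addf; first exact: (mk _ (ddV k)).
apply: is_derive_sumf => l _; apply: is_derive_sumf => m _.
have dG := is_derive_comp_rV dc (differentiable_christoffel gU k l m Us).
have := is_derive_mulf (is_derive_mulf dG (mk _ (ddc l))) (mk _ (dV m)).
by move=> /is_derive_eq; apply; rewrite mulrDl.
Qed.

End CovariantDerivative.

Section WarpedCurve.
Context {R : realType} {n : nat}.
Variables (a : R -> R) (h : 'rV[R]_n -> 'M[R]_n) (U : set 'rV[R]_n).
Variable (c : R -> 'rV[R]_(1 + n)).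
Hypothesis hU : c2_metric U h.
Hypothesis a_gt0 : forall t, 0 < t -> 0 < a t.
Hypothesis da : forall t, 0 < t -> derivable a t 1.
Hypothesis dda : forall t, 0 < t -> derivable (derive1 a) t 1.

Lemma tcomp_cov (V : R -> 'rV[R]_(1 + n)) s : warped_dom U (c s) ->
  tcomp (cov (warped a h) c V s) = derive1 (fun r => tcomp (V r)) s +
    a (tcomp (c s)) * derive1 a (tcomp (c s)) *
    inner (h (scomp (c s))) (scomp (cdot c s)) (scomp (V s)).
Proof.
move=> cs; rewrite covE tcompD (chr_warped hU a_gt0 da dda) //; congr (_ + _).
  rewrite /tcomp !mxE; congr (derive1 _ s); apply/funext => r; rewrite mxE //.
by rewrite /tcomp row_mxKl mxE eqxx mulr1n.
Qed.

Lemma tcomp_cdot s : tcomp (cdot c s) = derive1 (fun r => tcomp (c r)) s.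
Proof.
by rewrite /tcomp !mxE; congr (derive1 _ s); apply/funext => r; rewrite mxE.
Qed.

(** [K] and [H] are the sectional curvatures of the spatial planes and of the planes containing
    [d/dt]. The values of [inner] on [Y, Y] and [W, Y] serve to eliminate the spatial inner
    products, leaving spacetime products and time components. *)
Lemma tidal_orthogonal (kappa : R) (x X Y W : 'rV[R]_(1 + n)) (c0 : R) :
  warped_dom U x ->
  (forall u, u != 0 -> 0 < inner (h (scomp x)) u u) ->
  (forall u v, plane_area2 (h (scomp x)) u v != 0 ->
     sectional h (scomp x) u v = kappa) ->
  inner (warped a h x) Y Y = c0 -> inner (warped a h x) W Y = 0 ->
  let K := (kappa + derive1 a (tcomp x) ^+ 2) / a (tcomp x) ^+ 2 in
  let H := derive1n 2 a (tcomp x) / a (tcomp x) in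
  inner (warped a h x) (riemann (warped a h) x X Y Y) W =
  K * c0 * inner (warped a h x) X W +
  (K - H) * (c0 * tcomp X * tcomp W
             - inner (warped a h x) X Y * tcomp Y * tcomp W
             + tcomp Y ^+ 2 * inner (warped a h x) X W).
Proof.
move=> xU pos sec; cbv zeta; have [t0 Ux] := xU.
rewrite (tidal_warped hU a_gt0 da dda) //; cbv zeta.
rewrite (tidal_constant_curvature hU Ux pos sec) !inner_warped.
have a0 : a (tcomp x) != 0 by rewrite gt_eqF ?a_gt0.
have sh : (h (scomp x))^T = h (scomp x) by case: hU => _ + _ _ _; apply.
rewrite (innerC (scomp W) (scomp Y) sh).
move: (inner _ (scomp X) _) (inner _ (scomp X) _) (inner _ (scomp Y) _) (inner _ (scomp Y) _).
move: (tcomp X) (tcomp Y) (tcomp W) a0.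
move: (a _) (derive1 a _) (derive1n 2 a _) => b b1 b2 p q r b0.
move=> xw xy yw yy <- /eqP; rewrite addrC subr_eq0 => /eqP e.
have -> : yw = r * q / b ^+ 2 by rewrite -e; field.
by field.
Qed.

Lemma is_derive_tcomp_curve (V : R -> 'rV[R]_(1 + n)) s : derivable_rV V s ->
  is_derive s 1 (fun r => tcomp (V r)) (derive1 (fun r => tcomp (V r)) s).
Proof.
move=> dV; rewrite derive1E; apply/derivableP.
rewrite (_ : (fun r => _) = fun r => V r 0 (lshift n 0)); first exact: dV.
by apply/funext => r; rewrite /tcomp mxE.
Qed.

End WarpedCurve.

(** * Functions that are twice differentiable at a point *)

Section TwiceDerivable.
Context {R : realType}.

Lemma near_forall (I : finType) (P : I -> R -> Prop) (s : R) :
  (forall k, \forall r \near s, P k r) -> \forall r \near s, forall k, P k r.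
Proof. by move=> h; exact: (@filter_forall _ _ P (nbhs s) _ h). Qed.

(** The regularity under which [cov] can be differentiated once more. It is stable under the sums
    and products that make up [comb], whose smoothness is known only through its coefficients and
    the frame. *)
Definition twice (f : R -> R) (s : R) :=
  (\forall r \near s, derivable f r 1) /\ derivable (derive1 f) s 1.

Lemma twice_mul f g s : twice f s -> twice g s -> twice (fun r => f r * g r) s.
Proof.
move=> [f1 f2] [g1 g2]; have fg : \forall r \near s,
    is_derive (r : R) 1 (fun r : R => f r * g r) (derive1 f r * g r + f r * derive1 g r).
  apply: filterS (filterI f1 g1) => r [fr gr]; rewrite !derive1E.
  exact: is_derive_mulf (derivableP fr) (derivableP gr).
split; first by apply: filterS fg => r [].
have fs := nbhs_singleton f1; have gs := nbhs_singleton g1.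
have D2 := is_derive_addf
  (is_derive_mulf (derivableP f2) (derivableP gs))
  (is_derive_mulf (derivableP fs) (derivableP g2)).
apply: (@ex_derive _ _ _ _ _ _ _ (near_eq_is_derive _ D2)).
by apply: filterS fg => r [_ <-]; rewrite derive1E.
Qed.

Lemma twice_sum n (f : 'I_n -> R -> R) s : (forall k, twice (f k) s) ->
  twice (fun r => \sum_(k < n) f k r) s.
Proof.
move=> tf; have nf : \forall r \near s, forall k, derivable (f k) r 1.
  by apply: near_forall => k; case: (tf k).
have df : \forall r \near s, is_derive (r : R) 1 (fun r : R => \sum_(k < n) f k r)
    (\sum_(k < n) derive1 (f k) r).
  apply: filterS nf => r nfr; apply: is_derive_sumf => k _.
  by rewrite derive1E; exact/derivableP.
split; first by apply: filterS df => r [].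
have D2 : is_derive s 1 (fun r => \sum_(k < n) derive1 (f k) r)
    (\sum_(k < n) 'D_1 (derive1 (f k)) s).
  by apply: is_derive_sumf => k _; apply: derivableP; case: (tf k).
apply: (@ex_derive _ _ _ _ _ _ _ (near_eq_is_derive _ D2)).
by apply: filterS df => r [_ <-]; rewrite derive1E.
Qed.

Lemma twice_near (f : R -> R) s (P : R -> Prop) :
  (\forall r \near s, P r) -> (forall (m : nat) r, P r -> derivable (derive1n m f) r 1) ->
  twice f s.
Proof.
move=> nP df; split; first by apply: filterS nP => r; exact: (df 0%N).
exact: (df 1%N _ (nbhs_singleton nP)).
Qed.

Definition twice_rV n (V : R -> 'rV[R]_n) s := forall k, twice (fun r => V r 0 k) s.

Lemma twice_rV_derivable n (V : R -> 'rV[R]_n) s : twice_rV V s ->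
  (\forall r \near s, derivable_rV V r) /\
  derivable_rV (fun r => \row_k derive1 (fun r => V r 0 k) r) s.
Proof.
move=> tV; split; first by apply: near_forall => k; case: (tV k).
move=> k; have [_ h] := tV k.
by rewrite (_ : (fun r => _) = derive1 (fun r => V r 0 k)) //;
  apply/funext => r; rewrite mxE.
Qed.

End TwiceDerivable.

Lemma differentiable_rV (R : realType) n m (f : 'rV[R]_n -> 'rV[R]_m) x :
  (forall k, differentiable (fun y => f y 0 k) x) -> differentiable f x.
Proof.
move=> df; have -> : f = \sum_(k < m) (fun y => f y 0 k *: delta_mx 0 k).
  by apply/funext => y; rewrite fct_sumE -row_deltaE.
by apply: differentiable_sum => k; apply: differentiableZl.
Qed.

(** * Geodesics of an FLRW spacetime and their Jacobi tensors *)

Section RiemannianChart.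
Context {R : realType} {n : nat}.
Variables (S : metric_atlas R n) (i : idx S).
Hypothesis rS : riemannian_manifold S.

Lemma unitmx_posdef (G : 'M[R]_n) :
  (forall u, u != 0 -> 0 < inner G u u) -> G \in unitmx.
Proof.
move=> pos; rewrite -row_free_unit -kermx_eq0; apply/negPn/negP => /rowV0Pn[u].
move=> /sub_kermxP uG u0; have := pos u u0.
by rewrite /inner uG mul0mx mxE ltxx.
Qed.

Lemma c2_metric_chart : c2_metric (crd i @` dom i) (gmx i).
Proof.
have [[_ _ /(_ i)[_ oU] _ _] [sm sym pos _]] := rS.
have posx x : (crd i @` dom i) x -> forall u, u != 0 -> 0 < inner (gmx i x) u u.
  by move=> [q dq <-] u; exact: pos.
have d0 k l x : (crd i @` dom i) x -> differentiable (fun x => gmx i x k l) x.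
  by move=> ux; exact: (sm i k l [::]).
have d1 j k l x : (crd i @` dom i) x ->
    differentiable (partial j (fun x => gmx i x k l)) x.
  by move=> ux; exact: (sm i k l [:: j]).
have E Y W : (fun y => inner (gmx i y) Y W) = fun y =>
    \sum_(k < n) \sum_(l < n) Y 0 k * gmx i y k l * W 0 l.
  by apply/funext => y; rewrite innerE.
split => //.
- by move=> x [q dq <-]; exact: sym.
- by move=> x ux; apply: unitmx_posdef; exact: posx.
- move=> Y W x ux; rewrite E; apply: differentiable_sumf => k _.
  apply: differentiable_sumf => l _; apply: differentiable_mulf.
    by apply: differentiable_mulf; [exact: differentiable_constf|exact: d0].
  exact: differentiable_constf.
move=> X Y W x ux; apply: (@near_eq_differentiable _ _ (fun y =>
   \sum_(k < n) \sum_(l < n) Y 0 k *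
     (\sum_(j < n) X 0 j * partial j (fun x => gmx i x k l) y) * W 0 l)).
  apply: filterS (open_nbhs_nbhs (conj oU ux)) => y uy; apply/esym.
  rewrite E; apply: derive_val.
  apply: is_derive_sumf => k _; apply: is_derive_sumf => l _.
  have dk : is_derive y X (fun y => gmx i y k l)
      (\sum_(j < n) X 0 j * partial j (fun x => gmx i x k l) y).
    rewrite -derive_rVE; last exact: d0.
    exact/derivableP/diff_derivable/d0.
  have := is_derive_mulf (is_derive_mulf (is_derive_constf (Y 0 k) y X) dk)
    (is_derive_constf (W 0 l) y X).
  by move=> /is_derive_eq; apply; rewrite mul0r add0r mulr0 addr0.
apply: differentiable_sumf => k _; apply: differentiable_sumf => l _.
apply: differentiable_mulf; last exact: differentiable_constf.
apply: differentiable_mulf; first exact: differentiable_constf.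
apply: differentiable_sumf => j _.
by apply: differentiable_mulf; [exact: differentiable_constf|exact: d1].
Qed.

End RiemannianChart.

Section Geodesic.
Context {R : realType}.
Variables (kappa : R) (a : R -> R) (S : metric_atlas R 3).
Hypothesis rS : riemannian_manifold S.
Hypothesis kS : constant_curvature S kappa.
Hypothesis sa : scale_factor a.
Variables (D : set R) (gam : R -> pt (flrw a S)).
Hypothesis geo : flrw_geodesic D gam.

Lemma scale_factor_gt0 t : 0 < t -> 0 < a t.
Proof. by case: sa => _ + _; apply. Qed.

Lemma derivable_scale_factor t : 0 < t -> derivable a t 1.
Proof. by case: sa => /(_ 0%N t) + _ _; apply. Qed.

Lemma derivable_derive1_scale_factor t : 0 < t -> derivable (derive1 a) t 1.
Proof. by case: sa => /(_ 1%N t) + _ _; apply. Qed.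

Implicit Types (i j : idx S).

Let openD : open D. Proof. by case: geo. Qed.
Let itvD : is_interval D. Proof. by case: geo. Qed.

Local Notation T := (time gam).
Local Notation v := (derive1 (time gam)).

Let c (i : idx S) (r : R) : 'rV[R]_(1 + 3) := @crd _ _ (flrw a S) i (gam r).
Let G (i : idx S) := warped a (gmx i).

Lemma time_tcomp i r : T r = tcomp (c i r).
Proof. by rewrite /tcomp /c /= row_mxKl mxE eqxx mulr1n. Qed.

Lemma exists_chart s : D s -> exists i : idx S, @dom _ _ (flrw a S) i (gam s).
Proof. by case: geo => _ _ [[_ ch _] _] _ _ Ds; exact: ch. Qed.

Lemma chart_dom i s : @dom _ _ (flrw a S) i (gam s) ->
  warped_dom (crd i @` dom i) (c i s).
Proof.
move=> [t0 di]; split; first by rewrite -time_tcomp.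
by rewrite /scomp /c /= row_mxKr; exists (gam s).2.
Qed.

Lemma near_chart i s : D s -> @dom _ _ (flrw a S) i (gam s) ->
  \forall r \near s, D r /\ @dom _ _ (flrw a S) i (gam r).
Proof.
move=> Ds [t0 di].
have gc : {for s, continuous gam} by case: geo => _ _ [[gc _ _] _] _ _; exact: gc.
have g1 : (gam r).1 @[r --> s] --> (gam s).1 by apply: cvg_comp gc _; exact: cvg_fst.
have g2 : (gam r).2 @[r --> s] --> (gam s).2 by apply: cvg_comp gc _; exact: cvg_snd.
have [[_ _ /(_ i)[od _] _ _] _] := rS.
have n1 : \forall r \near s, 0 < (gam r).1.
  apply: (g1 [set t | 0 < t]); apply: open_nbhs_nbhs; split => //; exact: open_gt.
have n2 : \forall r \near s, dom i (gam r).2.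
  by apply: (g2 (dom i)); apply: open_nbhs_nbhs.
have n0 : \forall r \near s, D r by exact: open_nbhs_nbhs.
near=> r; split; first by near: r.
by split; near: r.
Unshelve. all: by end_near. Qed.

Lemma derivable_chart i s : D s -> @dom _ _ (flrw a S) i (gam s) ->
  derivable_rV (c i) s /\ derivable_rV (cdot (c i)) s.
Proof.
move=> Ds di; have [_ _ [[_ _ sm] _] _ _] := geo.
split=> k; first exact: (sm i k 0%N s Ds di).
have -> : (fun r => cdot (c i) r 0 k) = derive1 (fun r => c i r 0 k).
  by apply/funext => r; rewrite mxE.
exact: (sm i k 1%N s Ds di).
Qed.

Lemma time_gt0 s : D s -> 0 < T s.
Proof. by move=> /exists_chart[i []]. Qed.

Lemma derive_time_gt0 s : D s -> 0 < v s.
Proof. by case: geo => _ _ _ + _; apply. Qed.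

Lemma is_derive_time s : D s -> is_derive s 1 T (v s).
Proof.
move=> Ds; have [i di] := exists_chart Ds.
have [dc _] := derivable_chart Ds di.
have -> : T = fun r => tcomp (c i r) by apply/funext => r; exact: time_tcomp.
exact: is_derive_tcomp_curve.
Qed.

Lemma tcomp_velocity i s : tcomp (cdot (c i) s) = v s.
Proof.
by rewrite tcomp_cdot; congr (derive1 _ s); apply/funext => r; rewrite -time_tcomp.
Qed.

Lemma cov_velocity i s : D s -> @dom _ _ (flrw a S) i (gam s) ->
  cov (G i) (c i) (cdot (c i)) s = 0.
Proof. by move=> Ds di; have [_ _ [_ ge] _ _] := geo; exact: (ge i s Ds di). Qed.

Let hU i := c2_metric_chart i rS.
Let gU i : c2_metric (warped_dom (crd i @` dom i)) (G i).
Proof.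
apply: (c2_metric_warped (hU i)); first exact: scale_factor_gt0.
  exact: derivable_scale_factor.
exact: derivable_derive1_scale_factor.
Qed.

Section Causal.
Variable c0 : R.
Hypothesis causal : causal_character D gam c0.

Lemma inner_velocity i s : D s -> @dom _ _ (flrw a S) i (gam s) ->
  inner (G i (c i s)) (cdot (c i) s) (cdot (c i) s) = c0.
Proof. by move=> Ds di; exact: (causal Ds di). Qed.

Lemma inner_space_velocity i s : D s -> @dom _ _ (flrw a S) i (gam s) ->
  a (T s) ^+ 2 * inner (gmx i (scomp (c i s))) (scomp (cdot (c i) s))
    (scomp (cdot (c i) s)) = v s ^+ 2 + c0.
Proof.
move=> Ds di; have := inner_velocity Ds di.
rewrite inner_warped tcomp_velocity -time_tcomp => <-.
by rewrite expr2 addrA subrr add0r.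
Qed.

(** The time component of the geodesic equation is [t'' = - a a' h(x', x')], and the causal
    character gives [a^2 h(x', x') = v^2 + c0]. *)
Lemma is_derive_velocity s : D s -> is_derive s 1 v
  (- (derive1 a (T s) / a (T s)) * (v s ^+ 2 + c0)).
Proof.
move=> Ds; have [i di] := exists_chart Ds.
have [_ ddc] := derivable_chart Ds di.
have vE : v = fun r => tcomp (cdot (c i) r).
  by apply/funext => r; rewrite tcomp_velocity.
have := is_derive_tcomp_curve ddc; rewrite -vE.
move=> /is_derive_eq; apply.
have := tcomp_cov (hU i) scale_factor_gt0 derivable_scale_factor
  derivable_derive1_scale_factor (cdot (c i)) (chart_dom di).
rewrite -/(G i) cov_velocity // -vE -time_tcomp.
have a0 : a (T s) != 0 by rewrite gt_eqF ?scale_factor_gt0 ?time_gt0.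
rewrite -(inner_space_velocity Ds di) [tcomp 0]mxE [X in X = _]mxE.
move: (inner _ _ _) (derive1 v s) a0; move: (a _) (derive1 a _) => b b1 x y b0 e.
have -> : y = - (b * b1 * x) by apply/eqP; rewrite -addr_eq0 -e.
by field.
Qed.

Lemma spatial_constantE i s : D s -> @dom _ _ (flrw a S) i (gam s) ->
  spatial_constant gam i s = a (T s) ^+ 2 * (v s ^+ 2 + c0).
Proof.
move=> Ds di; rewrite -(inner_space_velocity Ds di) /spatial_constant.
congr (_ * _); rewrite /= block_mxKdr -/(c i s).
rewrite /inner -scalemxAr -scalemxAl mxE; congr (_ * _).
by rewrite -[lsubmx _ 0 0]/(tcomp (c i s)) -time_tcomp.
Qed.

(** By [is_derive_velocity], the logarithmic derivative of [v^2 + c0] is [- 2 (a' / a) v], opposite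
    to that of [a^2]. *)
Lemma spatial_constant_const s s' : D s -> D s' ->
  a (T s) ^+ 2 * (v s ^+ 2 + c0) = a (T s') ^+ 2 * (v s' ^+ 2 + c0).
Proof.
move=> Ds Ds'.
apply: (is_derive0_cst (F := fun s => a (T s) ^+ 2 * (v s ^+ 2 + c0)) itvD Ds Ds').
move=> r Dr; have dA := is_derive_comp1 (is_derive_time Dr)
  (derivable_scale_factor (time_gt0 Dr)).
have dv := is_derive_velocity Dr.
have := is_derive_mulf (is_derive_mulf dA dA)
  (is_derive_addf (is_derive_mulf dv dv) (is_derive_constf c0 r 1)).
have a0 : a (T r) != 0 by rewrite gt_eqF ?scale_factor_gt0 ?time_gt0.
rewrite (_ : (fun y => _) = fun s => a (T s) ^+ 2 * (v s ^+ 2 + c0)); last first.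
  by apply/funext => y; rewrite !expr2.
move=> /is_derive_eq; apply.
move: a0; move: (a _) (derive1 a _) (v r) => b b1 y b0; field.
exact: b0.
Qed.

End Causal.

(* The charts of the product leave the time coordinate alone. *)
Lemma tcomp_vector_field (V : field (flrw a S)) i j s : vector_field D gam V ->
  D s -> @dom _ _ (flrw a S) i (gam s) -> @dom _ _ (flrw a S) j (gam s) ->
  tcomp (n := 3) (V j s) = tcomp (n := 3) (V i s).
Proof.
move=> [_ tr] Ds di dj; rewrite (tr i j s Ds di dj).
set f : 'rV[R]_(1 + 3) -> 'rV[R]_(1 + 3) := @transition _ _ (flrw a S) i j.
have fE : f = fun x => row_mx (tcomp x)%:M (transition i j (scomp x)) by [].
have [[_ _ _ _ tS] _] := rS.
have df : differentiable f (c i s).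
  apply: differentiable_rV => k; rewrite fE; case: (split_ordP k) => k' ->.
    rewrite (_ : (fun y => _) = tcomp); first exact: differentiable_tcomp.
    by apply/funext => y; rewrite row_mxEl mxE !ord1 eqxx mulr1n.
  rewrite (_ : (fun y => _) = (fun z => transition i j z 0 k') \o scomp); last first.
    by apply/funext => y; rewrite row_mxEr.
  apply: differentiable_comp; first exact: differentiable_scomp.
  apply: (tS i j k' [::]); exists (gam s).2; last by rewrite /scomp /c /= row_mxKr.
  by case: di dj => _ ? [].
rewrite -[X in _ *m X]/(jacobian f (c i s)) -deriveEjacobian //.
rewrite derive_mx; last exact: diff_derivable.
rewrite /tcomp !mxE.
have -> : (fun t => f t 0 (lshift 3 0)) = tcomp.
  by apply/funext => y; rewrite fE row_mxEl mxE eqxx mulr1n.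
have di1 : derivable (id : R -> R) (tcomp (c i s)) 1 by exact: derivable_id.
have [_ ->] := is_derive_tcomp (V i s) di1.
by rewrite derive1_id mulr1 /tcomp mxE.
Qed.

Lemma twice_vector_field (V : field (flrw a S)) i s : vector_field D gam V ->
  D s -> @dom _ _ (flrw a S) i (gam s) -> twice_rV (V i) s.
Proof.
move=> [sm _] Ds di k; apply: (twice_near (near_chart Ds di)) => m r [Dr dr].
exact: sm.
Qed.

Section ParallelFields.
Variables (i : idx S) (s : R).
Hypothesis Ds : D s.
Hypothesis di : @dom _ _ (flrw a S) i (gam s).

Lemma is_derive_inner_chart (V W : R -> 'rV[R]_(1 + 3)) :
  derivable_rV V s -> derivable_rV W s ->
  is_derive s 1 (fun r => inner (G i (c i r)) (V r) (W r))
    (inner (G i (c i s)) (cov (G i) (c i) V s) (W s)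
     + inner (G i (c i s)) (V s) (cov (G i) (c i) W s)).
Proof.
move=> dV dW; have [dc _] := derivable_chart Ds di.
exact: (is_derive_inner_along (gU i) (chart_dom di) dc dV dW).
Qed.

Lemma derivable_cov_chart (V : R -> 'rV[R]_(1 + 3)) : twice_rV V s ->
  derivable_rV (cov (G i) (c i) V) s.
Proof.
move=> /twice_rV_derivable[nV d2V]; have [dc ddc] := derivable_chart Ds di.
exact: (derivable_cov (gU i) (chart_dom di) dc (nbhs_singleton nV) ddc d2V).
Qed.

Lemma inner_chartC V W : inner (G i (c i s)) V W = inner (G i (c i s)) W V.
Proof.
by apply: innerC; case: (gU i) => _ + _ _ _; apply; exact: chart_dom.
Qed.

Lemma chart_posdef (u : 'rV[R]_3) : u != 0 ->
  0 < inner (gmx i (scomp (c i s))) u u.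
Proof.
have [_ [_ _ pos _]] := rS; have [_ [q dq <-]] := chart_dom di.
exact: pos.
Qed.

Lemma chart_sectional (u w : 'rV[R]_3) :
  plane_area2 (gmx i (scomp (c i s))) u w != 0 ->
  sectional (gmx i) (scomp (c i s)) u w = kappa.
Proof. by have [_ [q dq <-]] := chart_dom di; exact: kS. Qed.

End ParallelFields.

Let K s := (kappa + derive1 a (T s) ^+ 2) / a (T s) ^+ 2.
Let H s := derive1n 2 a (T s) / a (T s).

Lemma inner_tidal c0 i s X W : causal_character D gam c0 ->
  D s -> @dom _ _ (flrw a S) i (gam s) ->
  inner (G i (c i s)) W (cdot (c i) s) = 0 ->
  inner (G i (c i s)) (riemann (G i) (c i s) X (cdot (c i) s) (cdot (c i) s)) W =
  K s * c0 * inner (G i (c i s)) X W +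
  (K s - H s) * (c0 * tcomp X * tcomp W
             - inner (G i (c i s)) X (cdot (c i) s) * v s * tcomp W
             + v s ^+ 2 * inner (G i (c i s)) X W).
Proof.
move=> cs Ds di W0.
have := tidal_orthogonal (hU i) scale_factor_gt0 derivable_scale_factor
  derivable_derive1_scale_factor X (chart_dom di) (@chart_posdef i s di)
  (@chart_sectional i s di) (inner_velocity cs Ds di) W0.
by cbv zeta; rewrite tcomp_velocity -(time_tcomp i s) => ->.
Qed.

(** * The Jacobi tensor of a null geodesic *)

Section Null.
Hypothesis nul : null D gam.
Variables (s2 : R) (A : R -> 'M[R]_2).
Hypothesis qA : quotient_jacobi_matrix D gam s2 A.

Lemma quotient_jacobi_smooth k l s : D s ->
  is_derive s 1 (fun r => A r k l) (derive1 (fun r => A r k l) s).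
Proof.
move=> Ds; have [E [_ sm _ _]] := qA; rewrite derive1E; apply/derivableP.
exact: (sm k l 0%N s Ds).
Qed.

(** Everything is known only modulo the velocity, and pairing with the [E m], which are orthogonal
    to it, removes this ambiguity. The Gram matrix of the frame is constant, so the equation for the
    products [X m] passes to the entries of [A]. The term [0 * K s] is [c0 * K s] for [c0 = 0],
    which gives the form expected for transverse components. *)
Lemma quotient_jacobi_eq k l s : D s ->
  is_derive s 1 (derive1 (fun r => A r k l))
    (- (0 * K s + (K s - H s) * v s ^+ 2) * A s k l).
Proof.
move=> Ds; have [E [[vE oE iE pE] sm _ eqA]] := qA.
have [i di] := exists_chart Ds.
pose Ei k r : 'rV[R]_(1 + 3) := E k i r.
pose V r : 'rV[R]_(1 + 3) := \sum_(k < 2) A r k l *: Ei k r.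
pose I r := inner (G i (c i r)).
have nD := near_chart Ds di.
have tE m : twice_rV (Ei m) s by exact: (twice_vector_field (vE m) Ds di).
have tA m : twice (fun r => A r m l) s.
  by apply: (twice_near nD) => d r [Dr _]; exact: (sm m l d r Dr).
have tV : twice_rV V s.
  move=> j; rewrite (_ : (fun r => _) = fun r => \sum_(k < 2) A r k l * Ei k r 0 j).
    by apply: twice_sum => m; apply: twice_mul => //; exact: tE.
  by apply/funext => r; rewrite summxE; apply: eq_bigr => m _; rewrite mxE.
have [nV _] := twice_rV_derivable tV.
have nE : \forall r \near s, forall m, derivable_rV (Ei m) r.
  by apply: near_forall => m; case: (twice_rV_derivable (tE m)).
have oEi r m : D r -> @dom _ _ (flrw a S) i (gam r) ->
    inner (G i (c i r)) (Ei m r) (cdot (c i) r) = 0.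
  by move=> Dr dr; exact: (oE m i r Dr dr).
have oV r : D r -> @dom _ _ (flrw a S) i (gam r) -> I r (V r) (cdot (c i) r) = 0.
  move=> Dr dr; rewrite /I /V inner_suml big1 // => m _.
  by rewrite innerZl oEi // mulr0.
have cE r m : D r -> @dom _ _ (flrw a S) i (gam r) ->
    exists b, cov (G i) (c i) (Ei m) r = b *: cdot (c i) r.
  by move=> Dr dr; have [b e] := pE m i r Dr dr; exists b; rewrite -[RHS]add0r.
pose X m r := I r (V r) (Ei m r).
have dX1 m : \forall r \near s, is_derive (r : R) 1 (X m)
    (I r (cov (G i) (c i) V r) (Ei m r)).
  apply: filterS (filterI nD (filterI nV nE)) => r [[Dr dr] [dV dE]].
  have := is_derive_inner_chart Dr dr dV (dE m) => /is_derive_eq; apply.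
  have [b ->] := cE r m Dr dr.
  by rewrite innerZr -/(I r (V r) (cdot (c i) r)) oV // mulr0 addr0.
have dE := nbhs_singleton nE; have dV := nbhs_singleton nV.
have [_ ddc] := derivable_chart Ds di.
(* The derivative of [inner V gam'], which vanishes near [s], with [gam'] parallel. It discards the
   multiple of the velocity in [cov (Ei m)] in the second derivative. *)
have oDV : I s (cov (G i) (c i) V s) (cdot (c i) s) = 0.
  have [_] := is_derive_inner_chart Ds di dV ddc.
  rewrite cov_velocity // inner0r addr0 => e; rewrite /I -e.
  rewrite (near_eq_derive (g := cst 0)) ?derive_cst //.
  by apply: filterS nD => r [Dr dr]; exact: oV.
have dX2 m : is_derive s 1 (fun r => I r (cov (G i) (c i) V r) (Ei m r))
    (- ((K s - H s) * v s ^+ 2 * X m s)).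
  have := is_derive_inner_chart Ds di (derivable_cov_chart Ds di tV) (dE m).
  move=> /is_derive_eq; apply; have [b ->] := cE s m Ds di.
  rewrite innerZr -/(I s (cov (G i) (c i) V s) (cdot (c i) s)) oDV mulr0 addr0.
  have [eq _] := eqA l; have [b' e] := eq i s Ds di.
  have {}e : cov (G i) (c i) (cov (G i) (c i) V) s +
      riemann (G i) (c i s) (V s) (cdot (c i) s) (cdot (c i) s) =
      b' *: cdot (c i) s by rewrite -[RHS]add0r; exact: e.
  have oE0 : I s (cdot (c i) s) (Ei m s) = 0.
    by rewrite /I inner_chartC // oEi.
  have /eqP := congr1 (fun z => I s z (Ei m s)) e.
  rewrite /I innerDl innerZl -!/(I s _ _) oE0 mulr0 addr_eq0 => /eqP ->.
  rewrite /I (inner_tidal _ nul Ds di); last exact: oEi.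
  rewrite -!/(I s _ _) oV // /X.
  by move: (I s _ _) => y; ring.
pose g k m r := I r (Ei k r) (Ei m r).
have dg m m' : \forall r \near s, is_derive (r : R) 1 (g m m') 0.
  apply: filterS (filterI nD nE) => r [[Dr dr] dEr].
  have := is_derive_inner_chart Dr dr (dEr m) (dEr m') => /is_derive_eq; apply.
  have [b1 ->] := cE r m Dr dr; have [b2 ->] := cE r m' Dr dr.
  rewrite innerZl innerZr [X in b1 * X]inner_chartC //.
  by rewrite !oEi // !mulr0 addr0.
have XE m r : X m r = \sum_(k < 2) A r k l * g k m r.
  by rewrite /X /I /V inner_suml; apply: eq_bigr => j _; rewrite innerZl.
have dXg m : \forall r \near s, is_derive (r : R) 1 (X m)
    (\sum_(k < 2) derive1 (fun r => A r k l) r * g k m r).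
  have ng : \forall r \near s, forall k, is_derive (r : R) 1 (g k m) 0.
    by apply: near_forall => j; exact: dg.
  apply: filterS (filterI nD ng) => r [[Dr dr] gr].
  rewrite (_ : X m = fun r => \sum_(k < 2) A r k l * g k m r); last first.
    by apply/funext => r'; exact: XE.
  apply: is_derive_sumf => j _.
  have := is_derive_mulf (quotient_jacobi_smooth j l Dr) (gr j).
  by move=> /is_derive_eq; apply; rewrite mulr0 addr0.
pose A2 (j : 'I_2) := 'D_1 (derive1 (fun r => A r j l)) s.
have dA2 (j : 'I_2) : is_derive s 1 (derive1 (fun r => A r j l)) (A2 j).
  by apply: derivableP; exact: (sm j l 1%N s Ds).
(* The derivative of [X m] has two expressions that agree near [s], by covariant derivatives and by
   the entries of [A]; their derivatives at [s] are compared. *)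
have sumA2 m : \sum_(k < 2) (A2 k + (K s - H s) * v s ^+ 2 * A s k l) * g k m s = 0.
  have D2 : is_derive s 1 (fun r => \sum_(k < 2) derive1 (fun r => A r k l) r * g k m r)
      (\sum_(k < 2) A2 k * g k m s).
    apply: is_derive_sumf => j _.
    have := is_derive_mulf (dA2 j) (nbhs_singleton (dg j m)).
    by move=> /is_derive_eq; apply; rewrite mulr0 addr0.
  have D3 := near_eq_is_derive (g := fun r => I r (cov (G i) (c i) V r) (Ei m r)) _ D2.
  have {D3} : is_derive s 1 (fun r => I r (cov (G i) (c i) V r) (Ei m r))
      (\sum_(k < 2) A2 k * g k m s).
    apply: D3; apply: filterS (filterI (dX1 m) (dXg m)) => r [h1 h2].
    by rewrite -(@derive_val _ _ _ _ _ _ _ h1) -(@derive_val _ _ _ _ _ _ _ h2).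
  move=> [_ e]; have [_] := dX2 m; rewrite e => e'.
  under eq_bigr do rewrite mulrDl; rewrite big_split /= e'.
  rewrite XE mulr_sumr -sumrN -big_split big1 //= => m' _.
  by rewrite mulrA addNr.
pose b (j : 'I_2) := A2 j + (K s - H s) * v s ^+ 2 * A s j l.
pose Z : 'rV[R]_(1 + 3) := \sum_(j < 2) b j *: Ei j s.
have ZE m : I s Z (Ei m s) = 0.
  by rewrite -[RHS](sumA2 m) /I /Z inner_suml; apply: eq_bigr => j _; rewrite innerZl.
have ZZ : I s Z Z = 0.
  rewrite {2}/Z /I inner_sumr big1 // => j _.
  by rewrite innerZr -/(I s Z (Ei j s)) ZE mulr0.
have Zv : I s Z (cdot (c i) s) = 0.
  rewrite /Z /I inner_suml big1 // => j _.
  by rewrite innerZl oEi // mulr0.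
(* [Z] is orthogonal to itself and to the null velocity. Subtracting the multiple of the velocity
   with the same time component leaves a spatial vector of norm 0, hence 0. So [Z] is a multiple of
   the velocity, and the frame is independent modulo the velocity. *)
have b0 : forall j : 'I_2, b j = 0.
  apply: (iE b i s Ds di); exists (tcomp Z / v s); rewrite add0r.
  set q := tcomp Z / v s; have v0 : v s != 0 by rewrite gt_eqF ?derive_time_gt0.
  suff /eqP : Z - q *: cdot (c i) s = 0 by rewrite subr_eq0 => /eqP.
  have t0 : tcomp (Z - q *: cdot (c i) s) = 0.
    by rewrite tcompD -scaleNr tcompZ tcomp_velocity mulNr /q divfK // subrr.
  apply: tcompP; first by rewrite t0 /tcomp !mxE.
  have -> : scomp (0 : 'rV[R]_(1 + 3)) = 0 by apply/rowP => j; rewrite !mxE.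
  apply/eqP/negPn/negP => /(chart_posdef di).
  have : I s (Z - q *: cdot (c i) s) (Z - q *: cdot (c i) s) = 0.
    have vv : I s (cdot (c i) s) (cdot (c i) s) = 0.
      exact: (inner_velocity (nul : causal_character D gam 0) Ds di).
    have vZ : I s (cdot (c i) s) Z = 0 by rewrite /I inner_chartC.
    rewrite /I innerBl !innerBr !innerZl !innerZr -!/(I s _ _) ZZ Zv vv vZ; ring.
  rewrite /I inner_warped t0 mul0r oppr0 add0r => /eqP.
  by rewrite mulf_eq0 expf_eq0 /= gt_eqF ?scale_factor_gt0 -?time_tcomp ?time_gt0 //= => /eqP ->; rewrite ltxx.
have := dA2 k => /is_derive_eq; apply; have /eqP := b0 k.
by rewrite /b addr_eq0 mul0r add0r mulNr => /eqP.
Qed.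

End Null.

(** * The Jacobi tensor of a timelike geodesic *)

Section Timelike.
Hypothesis tl : timelike D gam.
Variables (A : R -> 'M[R]_3) (E J : 'I_3 -> field (flrw a S)).
Hypothesis pE : parallel_orthonormal_frame (n := 4) D gam E.
Hypothesis hJ : forall l, jacobi_field D gam (J l).
Hypothesis hA : forall l,
  along D gam (eqmod_velocity gam (J l) (comb (fun s k => A s k l) E)).

Let frame_orth k i s : D s -> @dom _ _ (flrw a S) i (gam s) ->
  inner (G i (c i s)) (E k i s) (cdot (c i) s) = 0.
Proof. by move=> Ds di; case: pE => _ _ + _; exact. Qed.

Let frame_orthonormal k l i s : D s -> @dom _ _ (flrw a S) i (gam s) ->
  inner (G i (c i s)) (E k i s) (E l i s) = (k == l)%:R.
Proof. by move=> Ds di; case: pE => _ _ _; exact. Qed.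

Let frame_parallel k i s : D s -> @dom _ _ (flrw a S) i (gam s) ->
  cov (n := 1 + 3) (G i) (c i) (E k i) s = 0.
Proof. by move=> Ds di; case: pE => _ + _ _; exact. Qed.

Let frame_vector k : vector_field D gam (E k).
Proof. by case: pE. Qed.

(** The covariant derivative of the field [a d/dt] in a direction [X] is [a' X]. Its inner product
    with a parallel vector orthogonal to the velocity is therefore constant, and for [E k] this
    product is [- a (E k)^0]. *)
Lemma frame_time_const : exists cc : 'I_3 -> R, forall s i k, D s ->
  @dom _ _ (flrw a S) i (gam s) -> a (T s) * tcomp (n := 3) (E k i s) = cc k.
Proof.
(* The time component is read in a chart chosen at each [r]. It does not depend on the chart, so
   [e k] is a single function on [D] even if no chart contains the whole curve; 0 is a default value
   outside [D]. *)
pose e k r := if pselect (D r) is left Dr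
  then tcomp (n := 3) (E k (sval (cid (exists_chart Dr))) r) else 0.
have eE k r i : D r -> @dom _ _ (flrw a S) i (gam r) ->
    e k r = tcomp (n := 3) (E k i r).
  move=> Dr dr; rewrite /e; case: pselect => // Dr'.
  exact: (tcomp_vector_field (frame_vector k) Dr dr (svalP (cid (exists_chart Dr')))).
have de k r : D r -> is_derive r 1 (fun r => a (T r) * e k r) 0.
  move=> Dr; have [i dr] := exists_chart Dr.
  pose Ei r : 'rV[R]_(1 + 3) := E k i r.
  have tE : twice_rV Ei r by exact: (twice_vector_field (frame_vector k) Dr dr).
  have [/nbhs_singleton dE _] := twice_rV_derivable tE.
  have de : is_derive r 1 (e k) (derive1 (fun r => tcomp (Ei r)) r).
    apply: near_eq_is_derive (is_derive_tcomp_curve dE).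
    by apply: filterS (near_chart Dr dr) => r' [Dr' dr']; rewrite (eE k r' i).
  have dA := is_derive_comp1 (is_derive_time Dr) (derivable_scale_factor (time_gt0 Dr)).
  have := is_derive_mulf dA de => /is_derive_eq; apply; rewrite (eE k r i) //.
  have := tcomp_cov (hU i) scale_factor_gt0 derivable_scale_factor
    derivable_derive1_scale_factor Ei (chart_dom dr).
  have -> : cov (warped a (gmx i)) (c i) Ei r = 0 by exact: frame_parallel.
  have := frame_orth k Dr dr; rewrite inner_chartC // inner_warped tcomp_velocity.
  have tc0 : tcomp (0 : 'rV[R]_(1 + 3)) = 0 by rewrite /tcomp !mxE.
  rewrite -(time_tcomp i r) -/(Ei r) tc0.
  have a0 : a (T r) != 0 by rewrite gt_eqF ?scale_factor_gt0 ?time_gt0.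
  move: (inner _ _ _) (derive1 (fun r => tcomp _) r) (tcomp (Ei r)) => x y z.
  move: a0; move: (a _) (derive1 a _) (v r) => b b1 w b0.
  move=> e1 /eqP; rewrite eq_sym addr_eq0 => /eqP ->.
  have -> : b1 * w * z + b * - (b * b1 * x) = - b1 * (- (w * z) + b ^+ 2 * x) by ring.
  by rewrite e1 mulr0.
have [[s0 Ds0]|D0] := pselect (exists s0, D s0); last first.
  by exists (fun=> 0) => s i k Ds; case: D0; exists s.
exists (fun k => a (T s0) * e k s0) => s i k Ds di.
rewrite -(eE k s i Ds di).
exact: (is_derive0_cst (F := fun r => a (T r) * e k r) itvD Ds Ds0 (de k)).
Qed.

(** The completeness relation of the orthonormal frame made of the velocity and the [E k], at its
    time-time entry, where the inverse metric is -1. *)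
Lemma frame_time_sum i s : D s -> @dom _ _ (flrw a S) i (gam s) ->
  \sum_(k < 3) tcomp (n := 3) (E k i s) ^+ 2 = v s ^+ 2 - 1.
Proof.
move=> Ds di; pose F : 'M[R]_(1 + 3) := col_mx (cdot (c i) s) (\matrix_k (E k i s : 'rV[R]_(1 + 3))).
pose B := G i (c i s).
(* The Minkowski matrix, written as a [warped] metric with scale factor 1 and Euclidean base so that
   [inner_warped] applies to it. *)
pose eta : 'M[R]_(1 + 3) := warped (fun=> 1) (fun=> 1%:M) (0 : 'rV[R]_(1 + 3)).
have etaE : eta = block_mx (-1)%:M 0 0 1%:M by rewrite /eta /warped expr1n scale1r.
have rowu : row (lshift 3 0) F = cdot (c i) s.
  by apply/rowP => j; rewrite mxE col_mxEu.
have rowd k : row (rshift 1 k) F = E k i s.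
  by apply/rowP => j; rewrite mxE col_mxEd mxE.
have FBF : F *m B *m F^T = eta.
  apply/matrixP => p q; rewrite inner_rows etaE.
  case: (split_ordP p) => p' ->; case: (split_ordP q) => q' ->; rewrite ?ord1 ?rowu ?rowd.
  - by rewrite block_mxEul mxE eqxx mulr1n; exact: (inner_velocity (tl : causal_character D gam (-1)) Ds di).
  - by rewrite block_mxEur mxE inner_chartC // frame_orth.
  - by rewrite block_mxEdl mxE frame_orth.
  - by rewrite block_mxEdr mxE frame_orthonormal.
have ee : eta *m eta = 1%:M.
  rewrite etaE mulmx_block !mulmx0 !mul0mx !addr0 !add0r mul1mx -scalar_mxM.
  by rewrite mulrNN mulr1 -scalar_mx_block.
have : (F *m B) *m (F^T *m eta) = 1%:M by rewrite mulmxA FBF ee.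
(* A one-sided inverse of a square matrix is two-sided: orthonormality of the rows of [F] becomes
   completeness, [F^T eta F B = 1]. *)
move=> /mulmx1C; rewrite mulmxA => /matrixP /(_ (lshift 3 0) (lshift 3 0)).
rewrite mxE big_split_ord /= big_ord1 [X in _ + X]big1 ?addr0; last first.
  by move=> j _; rewrite /B /G /warped block_mxEdl [X in _ * X]mxE mulr0.
rewrite /B /G /warped block_mxEul [X in _ * X]mxE eqxx mulr1n mulrN1.
have := inner_rows F^T eta (lshift 3 0) (lshift 3 0); rewrite trmxK ord1 => ->.
rewrite [X in _ = X -> _]mxE eqxx mulr1n.
rewrite /eta inner_warped expr1n mul1r.
have Fu (j : 'I_(1 + 3)) : F (lshift 3 0) j = cdot (c i) s 0 j by rewrite col_mxEu.
have Fd k (j : 'I_(1 + 3)) : F (rshift 1 k) j = (E k i s : 'rV[R]_(1 + 3)) 0 j.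
  by rewrite col_mxEd mxE.
have -> : tcomp (row (lshift 3 0) F^T) = v s.
  rewrite -(tcomp_velocity i s) /tcomp; do 3 rewrite mxE.
  by rewrite Fu [in RHS]mxE.
have wk k : scomp (row (lshift 3 0) F^T) 0 k = tcomp (n := 3) (E k i s).
  by rewrite /scomp; do 3 rewrite mxE; rewrite Fd /tcomp [in RHS]mxE.
have -> : inner 1%:M (scomp (row (lshift 3 0) F^T)) (scomp (row (lshift 3 0) F^T)) =
    \sum_(k < 3) tcomp (n := 3) (E k i s) ^+ 2.
  rewrite /inner mulmx1 mxE; apply: eq_bigr => k _.
  by rewrite [X in _ * X]mxE wk expr2.
by move: (\sum_(k < 3) _) (v s) => x y e; rewrite -[X in _ - X]e; ring.
Qed.

Lemma jacobi_matrixE i s k l : D s -> @dom _ _ (flrw a S) i (gam s) ->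
  A s k l = inner (G i (c i s)) (J l i s) (E k i s).
Proof.
move=> Ds di; have [b e] := hA l Ds di.
have {}e : J l i s = \sum_(m < 3) A s m l *: (E m i s : 'rV[R]_(1 + 3))
    + b *: cdot (c i) s := e.
rewrite e innerDl innerZl [X in b * X]inner_chartC // frame_orth // mulr0 addr0.
rewrite inner_suml (bigD1 k) //= innerZl frame_orthonormal // eqxx mulr1.
rewrite big1 ?addr0 // => m mk.
by rewrite innerZl frame_orthonormal // (negPf mk) mulr0.
Qed.

Lemma is_derive_jacobi_matrix i s k l : D s -> @dom _ _ (flrw a S) i (gam s) ->
  is_derive s 1 (fun r => A r k l)
    (inner (G i (c i s)) (cov (n := 1 + 3) (G i) (c i) (J l i) s) (E k i s)).
Proof.
move=> Ds di.
have tE : twice_rV (n := 1 + 3) (E k i) s.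
  exact: (twice_vector_field (frame_vector k) Ds di).
have tJ : twice_rV (n := 1 + 3) (J l i) s.
  by apply: twice_vector_field => //; case: (hJ l).
have [/nbhs_singleton dE _] := twice_rV_derivable tE.
have [/nbhs_singleton dJ _] := twice_rV_derivable tJ.
have := is_derive_inner_chart Ds di dJ dE.
rewrite frame_parallel // inner0r addr0; apply: near_eq_is_derive.
by apply: filterS (near_chart Ds di) => r [Dr dr]; rewrite (jacobi_matrixE k l Dr dr).
Qed.

(** A component [b gam'] of [J l] is allowed: it adds [b v] to the time component of [J l] and [- b]
    to its product with the velocity, and the two contributions cancel in [inner_tidal]. *)
Lemma jacobi_matrix_eq i s k l : D s -> @dom _ _ (flrw a S) i (gam s) ->
  is_derive s 1 (derive1 (fun r => A r k l))
    (K s * A s k l - (K s - H s) * (v s ^+ 2 * A s k l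
       - tcomp (n := 3) (E k i s) *
         \sum_(m < 3) tcomp (n := 3) (E m i s) * A s m l)).
Proof.
move=> Ds di.
have tE : twice_rV (n := 1 + 3) (E k i) s.
  exact: (twice_vector_field (frame_vector k) Ds di).
have [vJ eJ] := hJ l.
have tJ : twice_rV (n := 1 + 3) (J l i) s by exact: (twice_vector_field vJ Ds di).
have [/nbhs_singleton dE _] := twice_rV_derivable tE.
have := is_derive_inner_chart Ds di (derivable_cov_chart Ds di tJ) dE.
rewrite frame_parallel // inner0r addr0 => d2.
apply: (near_eq_is_derive _ (is_derive_eq d2 _)).
  apply: filterS (near_chart Ds di) => r [Dr dr].
  by have [_ <-] := is_derive_jacobi_matrix k l Dr dr; rewrite derive1E.
have e : cov (G i) (c i) (cov (n := 1 + 3) (G i) (c i) (J l i)) s +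
    riemann (G i) (c i s) (J l i s) (cdot (c i) s) (cdot (c i) s) = 0.
  exact: (eJ i s Ds di).
have /eqP := congr1 (fun z => inner (G i (c i s)) z (E k i s)) e.
rewrite innerDl inner0l addr_eq0 => /eqP ->.
rewrite (inner_tidal _ tl Ds di); last exact: frame_orth.
rewrite -(jacobi_matrixE k l Ds di).
have [b Jb] := hA l Ds di.
have {}Jb : J l i s = \sum_(m < 3) A s m l *: (E m i s : 'rV[R]_(1 + 3))
    + b *: cdot (c i) s := Jb.
have -> : inner (G i (c i s)) (J l i s) (cdot (c i) s) = - b.
  rewrite Jb innerDl innerZl (inner_velocity (tl : causal_character D gam (-1)) Ds di) mulrN1.
  rewrite inner_suml big1 ?add0r // => m _.
  by rewrite innerZl frame_orth // mulr0.
have -> : tcomp (n := 3) (J l i s) =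
    \sum_(m < 3) tcomp (n := 3) (E m i s) * A s m l + b * v s.
  rewrite Jb tcompD tcompZ; congr (_ + b * _); last exact: tcomp_velocity.
  rewrite /tcomp mxE summxE; apply: eq_bigr => m _.
  by rewrite !mxE mulrC.
by move: (\sum_(m < 3) _) (K s) (H s) => x y z; ring.
Qed.

End Timelike.

End Geodesic.

(** * The integral conditions *)

Section Integrals.
Context {R : realType}.
Variables (kappa p delta : R) (a : R -> R).
Hypothesis p_gt0 : 0 < p.
Hypothesis delta_gt0 : 0 < delta.
Hypothesis aE : forall t, 0 < t < delta -> a t = t `^ p.
Hypothesis cond : [\/ 1 < p /\ 0 < kappa, p < 1 \/ kappa = 0 | p = 1 /\ -1 < kappa].

Let near_a t : 0 < t < delta -> \near t, a t = t `^ p.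
Proof.
move=> /andP[t0 td]; near=> s; apply: aE; apply/andP; split; near: s.
  exact: lt_nbhsr.
exact: lt_nbhsl.
Unshelve. all: by end_near. Qed.

Let near_D t : 0 < t < delta -> \forall s \near t, 0 < s < delta.
Proof.
move=> /andP[t0 td]; near=> s; apply/andP; split; near: s.
  exact: lt_nbhsr.
exact: lt_nbhsl.
Unshelve. all: by end_near. Qed.

Lemma derive1_powR_near (q b : R) (f : R -> R) (t : R) : 0 < t ->
  (\near t, f t = b * t `^ q) -> derive1 f t = b * (q * t `^ (q - 1)).
Proof.
move=> t0 fE; rewrite derive1E.
have -> : 'D_1 f t = 'D_1 (fun s => b * s `^ q) t by exact: near_eq_derive.
have := is_derive_mulf (is_derive_constf b t 1)
  (is_derive_powR q (is_derive_id t (1 : R)) t0).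
by case=> _ ->; rewrite mul0r add0r mulr1.
Qed.

Lemma derive1_a t : 0 < t < delta -> derive1 a t = p * t `^ (p - 1).
Proof.
move=> tD; rewrite (@derive1_powR_near p 1) ?mul1r //; first by case/andP: tD.
by apply: filterS (near_a tD) => s ->; rewrite mul1r.
Qed.

Lemma derive2_a t : 0 < t < delta -> derive1n 2 a t = p * (p - 1) * t `^ (p - 2).
Proof.
move=> tD; rewrite /derive1n /= (@derive1_powR_near (p - 1) p).
- by rewrite mulrA; congr (_ * _ `^ _); ring.
- by case/andP: tD.
- by apply: filterS (near_D tD) => s; exact: derive1_a.
Qed.

Lemma bracketE t : 0 < t < delta ->
  flrw_bracket kappa a t = - p * t `^ (- 2) - kappa * t `^ (- (2 * p)).
Proof.
move=> tD; rewrite /flrw_bracket derive2_a // derive1_a // aE //.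
have [t0 _] := andP tD.
have tq q : t `^ q != 0 by rewrite gt_eqF // powR_gt0.
have -> : t `^ (p - 2) = t `^ p * t `^ (- 2).
  by rewrite -powRD // (gt_eqF t0) /= implybT.
have -> : t `^ (p - 1) = t `^ p * t `^ (- 1).
  by rewrite -powRD // (gt_eqF t0) /= implybT.
have e2 : t `^ (-1) ^+ 2 = t `^ (- 2).
  by rewrite powR_sqr; congr (_ `^ _); ring.
have e3 : (t `^ p) ^+ 2 = (t `^ (- (2 * p)))^-1 by rewrite powR_sqr powRN invrK.
have e4 : kappa / t `^ p ^+ 2 = kappa * t `^ (- (2 * p)) by rewrite e3 invrK.
rewrite e4 -e2; move: (tq p); move: (t `^ p) (t `^ (-1)) (t `^ _) => x y z x0.
by field.
Qed.

(** The bracket is [- p t^(-2) - kappa t^(- 2 p)]. The second term is harmless for [kappa >= 0], of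
    lower order for [p < 1], and of the same order for [p = 1], where [1 + kappa > 0] is what
    remains. *)
Lemma bracket_le : exists c t0 : R, [/\ 0 < c, 0 < t0, t0 < delta &
  forall t, 0 < t < t0 -> flrw_bracket kappa a t <= - (c * t `^ (- 2))].
Proof.
have d2 : 0 < delta / 2 by rewrite divr_gt0.
have dd : delta / 2 < delta by rewrite ltr_pdivrMr // ltr_pMr // ltr1n.
have tD t : 0 < t < delta / 2 -> 0 < t < delta.
  by case/andP=> -> /lt_trans; apply.
have [k0|k0] := lerP 0 kappa.
  exists p, (delta / 2); split=> // t tt; rewrite bracketE ?tD //.
  by rewrite mulNr lerBlDr lerDl mulr_ge0 // powR_ge0.
have [p1|[p1 k1]] : p < 1 \/ (p = 1 /\ -1 < kappa).
  case: cond => [[_ k1]|[p1|k1]|h]; [|by left| |by right].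
    by move: k1; rewrite ltNge (ltW k0).
  by move: k0; rewrite k1 ltxx.
  have [||t0 t00 h] := @powR_small _ (- kappa) (2 - 2 * p) (p / 2).
  - by rewrite subr_gt0 -[ltRHS]mulr1 ltr_pM2l.
  - by rewrite divr_gt0.
  exists (p / 2), (Num.min t0 (delta / 2)); split; rewrite ?divr_gt0 //.
  + by rewrite lt_min t00.
  + by rewrite gt_min dd orbT.
  move=> t /andP[tt]; rewrite lt_min => /andP[h1 h2].
  rewrite bracketE ?tD ?tt //; have := h t; rewrite tt h1 => /(_ isT).
  have -> : t `^ (- (2 * p)) = t `^ (2 - 2 * p) * t `^ (- 2).
    rewrite -powRD; last by rewrite (gt_eqF tt) /= implybT.
    by congr (_ `^ _); ring.
  have := powR_ge0 t (- 2); move: (t `^ (- 2)) (t `^ (2 - 2 * p)) => y x y0 hx.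
  rewrite -subr_ge0 (_ : _ - _ = (p / 2 - - kappa * x) * y); last by field.
  by rewrite mulr_ge0 // subr_ge0 ltW.
exists (1 + kappa), (delta / 2); split=> //; first by rewrite -ltrBlDl sub0r.
move=> t tt; rewrite bracketE ?tD // p1 mulr1.
by move: (t `^ _) => y; rewrite le_eqVlt; apply/orP; left; apply/eqP; ring.
Qed.

End Integrals.

(** * Integrals over segments and the divergent double integral *)

Section IntegralTools.
Context {R : realType}.
Local Notation mu := (@lebesgue_measure R).
Implicit Types (f F : R -> R) (x y z : R).

Lemma integrable_within_continuous f x y : {within `[x, y], continuous f} ->
  mu.-integrable `[x, y] (EFin \o f).
Proof. by move=> cf; apply: continuous_compact_integrable => //; exact: segment_compact. Qed.

Lemma Rintegral_FTC2 F f x y : x < y ->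
  (forall z, x <= z <= y -> is_derive z 1 F (f z)) ->
  {within `[x, y], continuous f} ->
  \int[mu]_(t in `[x, y]) f t = F y - F x.
Proof.
move=> xy dF cf.
have cF z : x <= z <= y -> {for z, continuous F}.
  by move=> /dF [/derivable1_diffP /differentiable_continuous].
have oo z : z \in `]x, y[%R -> x <= z <= y.
  by rewrite in_itv /= => /andP[/ltW -> /ltW ->].
rewrite /Rintegral (continuous_FTC2 (F := F) xy cf) //.
- split.
  + by move=> z /oo /dF [].
  + by apply: cvg_at_right_filter; apply: cF; rewrite lexx ltW.
  + by apply: cvg_at_left_filter; apply: cF; rewrite lexx ltW.
- by move=> z /oo /dF [_ <-]; rewrite derive1E.
Qed.

Lemma within_continuous_derivable F f x y :
  (forall z, x <= z <= y -> is_derive z 1 F (f z)) -> {within `[x, y], continuous F}.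
Proof.
move=> dF; apply: derivable_within_continuous => z; rewrite in_itv /= => /dF.
by case.
Qed.

Lemma Rintegral_split f x y z : x <= z <= y -> {within `[x, y], continuous f} ->
  \int[mu]_(t in `[z, y]) f t =
  \int[mu]_(t in `[x, y]) f t - \int[mu]_(t in `[x, z]) f t.
Proof.
move=> /andP[xz zy] cf.
have cz : {within `[z, y], continuous f}.
  apply: continuous_subspaceW cf => w /=; rewrite !in_itv /= => /andP[zw ->].
  by rewrite (le_trans xz zw).
rewrite Rintegral_itvB ?bnd_simp //; last exact: integrable_within_continuous.
rewrite Rintegral_itv_obnd_cbnd //.
apply: (integrableS _ _ _ (integrable_within_continuous cz)) => //.
by move=> w /=; rewrite !in_itv /= => /andP[/ltW -> ->].
Qed.

Lemma is_derive_powR_id (q x : R) : 0 < x ->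
  is_derive x 1 (fun z => z `^ q) (q * x `^ (q - 1)).
Proof.
move=> x0; have := is_derive_powR q (is_derive_id x (1 : R)) x0.
by move=> /is_derive_eq; apply; rewrite mulr1.
Qed.

Lemma within_continuous_powR (q x y : R) : 0 < x ->
  {within `[x, y], continuous (fun z => z `^ q)}.
Proof.
move=> x0; apply: (@within_continuous_derivable _ (fun z => q * z `^ (q - 1))).
by move=> z /andP[xz _]; apply: is_derive_powR_id; exact: lt_le_trans xz.
Qed.

Lemma within_continuous_mul f F x y : {within `[x, y], continuous f} ->
  {within `[x, y], continuous F} -> {within `[x, y], continuous (fun z => f z * F z)}.
Proof. by move=> cf cF z; apply: cvgM; [exact: cf|exact: cF]. Qed.

Lemma within_continuous_sub f F x y : {within `[x, y], continuous f} ->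
  {within `[x, y], continuous F} -> {within `[x, y], continuous (fun z => f z - F z)}.
Proof. by move=> cf cF z; apply: cvgB; [exact: cf|exact: cF]. Qed.

Lemma within_continuous_cst (k : R) x y : {within `[x, y], continuous (fun=> k)}.
Proof. by move=> z; exact: cvg_cst. Qed.

(* The inner integral is at most - c' (x^(-1-p) - y^(-1-p)), so that the outer
   integrand is at most - c' (1/x - 1/y), whose integral diverges. *)
Lemma double_integral_diverges (a G g : R -> R) (p c y : R) : 0 < p -> 0 < c -> 0 < y ->
  (forall x, 0 < x <= y -> a x = x `^ p) ->
  (forall x, 0 < x <= y -> G x = g x) ->
  (forall x, 0 < x -> {within `[x, y], continuous g}) ->
  (forall x, 0 < x <= y -> g x <= - (c * x `^ (- 2 - p))) ->
  \int[mu]_(x in `[t, y]) (a x * \int[mu]_(z in `[x, y]) G z) @[t --> 0^'+] --> -oo.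
Proof.
move=> p0 c0 y0 aE GE cg gle; pose k := c / (1 + p).
have p1 : 0 < 1 + p by rewrite addr_gt0.
have k0 : 0 < k by rewrite divr_gt0.
have xin x t : 0 < t -> `[t, y]%classic x -> 0 < x <= y.
  by move=> t0 /=; rewrite in_itv /= => /andP[/(lt_le_trans t0) -> ->].
have IE x : 0 < x -> \int[mu]_(z in `[x, y]) G z = \int[mu]_(z in `[x, y]) g z.
  move=> x0; apply: eq_Rintegral => z; rewrite inE => /(xin _ _ x0); exact: GE.
have Ile x : 0 < x -> x < y -> \int[mu]_(z in `[x, y]) g z <=
    - (k * (x `^ (- 1 - p) - y `^ (- 1 - p))).
  move=> x0 xy.
  have ch : {within `[x, y], continuous (fun z => (- c) * z `^ (- 2 - p))}.
    by apply: within_continuous_mul; [exact: within_continuous_cst|exact: within_continuous_powR].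
  have -> : - (k * (x `^ (- 1 - p) - y `^ (- 1 - p))) =
      \int[mu]_(z in `[x, y]) ((- c) * z `^ (- 2 - p)).
    have dF z : x <= z <= y -> is_derive z 1 (fun z => k * z `^ (- 1 - p))
        ((- c) * z `^ (- 2 - p)).
      move=> /andP[xz _]; have z0 := lt_le_trans x0 xz.
      have := is_derive_mulf (is_derive_constf k z 1) (is_derive_powR_id (- 1 - p) z0).
      move=> /is_derive_eq; apply; rewrite mul0r add0r /k.
      have -> : - 1 - p - 1 = - 2 - p by ring.
      by move: (z `^ _) => w; field; rewrite gt_eqF.
    by rewrite (Rintegral_FTC2 xy dF ch); ring.
  apply: le_Rintegral => //; try exact: integrable_within_continuous.
    by apply: integrable_within_continuous; exact: cg.
  by move=> z /(xin _ _ x0) /gle; rewrite mulNr.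
have Fle t : 0 < t -> t < y ->
    \int[mu]_(x in `[t, y]) (a x * \int[mu]_(z in `[x, y]) G z) <=
    - (k * (ln y - ln t - (y - t) / y)).
  move=> t0 ty.
  (* The inner integral is rewritten as a difference of integrals with fixed left endpoint [t],
     which shows that the outer integrand is continuous, hence integrable. *)
  pose W x := x `^ p * (\int[mu]_(z in `[t, y]) g z - \int[mu]_(z in `[t, x]) g z).
  have WE x : `[t, y]%classic x -> a x * \int[mu]_(z in `[x, y]) G z = W x.
    move=> xty; have xy := xin _ _ t0 xty; have [x0 _] := andP xy.
    have txy : t <= x <= y by move: xty; rewrite /= in_itv.
    by rewrite aE // IE // /W (Rintegral_split txy (cg t t0)).
  rewrite (@eq_Rintegral _ _ _ mu _ W); last by move=> x; rewrite inE; exact: WE.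
  have cW : {within `[t, y], continuous W}.
    apply: within_continuous_mul; first exact: within_continuous_powR.
    apply: within_continuous_sub; first exact: within_continuous_cst.
    apply: parameterized_integral_continuous; first exact: ltW.
    by apply: integrable_within_continuous; exact: cg.
  have ch : {within `[t, y], continuous (fun x => (- k) * (x `^ (- 1) - y^-1))}.
    apply: within_continuous_mul; first exact: within_continuous_cst.
    apply: within_continuous_sub; first exact: within_continuous_powR.
    exact: within_continuous_cst.
  have -> : - (k * (ln y - ln t - (y - t) / y)) =
      \int[mu]_(x in `[t, y]) ((- k) * (x `^ (- 1) - y^-1)).
    have dF z : t <= z <= y -> is_derive z 1 (fun x => (- k) * (ln x - x * y^-1))
        ((- k) * (z `^ (- 1) - y^-1)).
      move=> /andP[tz _]; have z0 := lt_le_trans t0 tz.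
      have := is_derive_mulf (is_derive_constf (- k) z 1)
        (is_derive_subf (is_derive1_ln z0)
          (is_derive_mulf (is_derive_id z (1 : R)) (is_derive_constf y^-1 z 1))).
      move=> /is_derive_eq; apply; rewrite powR_inv1; last exact: ltW.
      by rewrite mul0r add0r mul1r mulr0 addr0.
    by rewrite (Rintegral_FTC2 ty dF ch); ring.
  apply: le_Rintegral => //; try exact: integrable_within_continuous.
  move=> x xty; have xy := xin _ _ t0 xty; have [x0 xley] := andP xy.
  rewrite -WE // aE // IE //.
  have [->|xney] := eqVneq x y.
    rewrite set_itv1 Rintegral_set1 mulr0 powR_inv1; last exact: ltW.
    by rewrite subrr mulr0.
  have xlty : x < y by rewrite lt_neqAle xney.
  apply: (le_trans (ler_wpM2l (powR_ge0 x p) (Ile x x0 xlty))).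
  have e1 : x `^ (- 1) = x `^ p * x `^ (- 1 - p).
    by rewrite -powRD ?(gt_eqF x0) /= ?implybT //; congr (_ `^ _); ring.
  have e2 : y^-1 = y `^ p * y `^ (- 1 - p).
    rewrite -powRD ?(gt_eqF y0) /= ?implybT // -powR_inv1 ?ltW //.
    by congr (_ `^ _); ring.
  rewrite e1 e2 mulNr mulrN lerN2 mulrCA (ler_pM2l k0) mulrBr lerD2l lerN2.
  apply: ler_wpM2r; first exact: powR_ge0.
  by apply: ge0_ler_powR => //; rewrite ?nnegrE ltW.
apply/cvgrNyPle => M.
near=> t.
have t0 : 0 < t by near: t; exact: nbhs_right_gt.
have ty : t < y by near: t; exact: nbhs_right_lt.
(* Solves [- k (ln y - ln t - 1) <= M] for [t], where 1 bounds [(y - t) / y]. *)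
have tM : t < expR (ln y - 1 + M / k).
  by near: t; apply: nbhs_right_lt; exact: expR_gt0.
apply: (le_trans (Fle t t0 ty)).
have : ln t < ln y - 1 + M / k.
  by rewrite -(expRK (ln y - 1 + M / k)) ltr_ln ?posrE ?expR_gt0.
have h : (y - t) / y <= 1 by rewrite ler_pdivrMr // mul1r gerBl ltW.
move=> h2.
have h3 : - (M / k) <= ln y - ln t - (y - t) / y.
  by move: h h2; move: (ln t) (ln y) (M / k) ((y - t) / y) => u v w r; lra.
by rewrite lerNl -(ler_pM2l k0) in h3 *; move: h3; rewrite mulrN mulrCA divff ?gt_eqF // mulr1.
Unshelve. all: by end_near. Qed.

End IntegralTools.

Lemma scale_integrals (R : realType) (kappa p delta C : R) (a : R -> R) :
  0 < p -> 0 < delta -> (forall t, 0 < t < delta -> a t = t `^ p) ->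
  [\/ 1 < p /\ 0 < kappa, p < 1 \/ kappa = 0 | p = 1 /\ -1 < kappa] ->
  0 < C -> exists2 t1 : R, 0 < t1 &
     (\int[lebesgue_measure]_(t' in `[t, t1])
        (a t' * \int[lebesgue_measure]_(t'' in `[t', t1])
                  ((a t'')^-1 * flrw_bracket kappa a t''))
        @[t --> 0^'+] --> -oo) /\
     (exists2 l : R, 0 <= l &
        \int[lebesgue_measure]_(t' in `[t, t1]) flrw_f_plus kappa a C t'
          @[t --> 0^'+] --> l).
Proof.
move=> p0 d0 aE cond C0.
have [c [t0 [c0 t00 t0d cB]]] := bracket_le p0 d0 aE cond.
have Cc : 0 < 2 * C * c by rewrite !mulr_gt0.
(* Near 0, [f] is at most [(3 p (p - 1) t^(2 p) - 2 C c) t^(- 2 - p)] by [bracket_le]; below [t2]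
   the parenthesis is negative. *)
have [|t2 t20 h2] := @powR_small _ (3 * (p * (p - 1))) (2 * p) (2 * C * c) _ Cc.
  by rewrite mulr_gt0.
pose t1 := Num.min (t0 / 2) (t2 / 2).
have t10 : 0 < t1 by rewrite lt_min !divr_gt0.
have tt0 t : t <= t1 -> t < t0.
  by rewrite le_min => /andP[h _]; apply: (le_lt_trans h); rewrite ltr_pdivrMr // ltr_pMr // ltr1n.
have tt2 t : t <= t1 -> t < t2.
  by rewrite le_min => /andP[_ h]; apply: (le_lt_trans h); rewrite ltr_pdivrMr // ltr_pMr // ltr1n.
have tD t : 0 < t <= t1 -> 0 < t < delta.
  by move=> /andP[-> /tt0/lt_trans]; apply.
have tB t : 0 < t <= t1 -> flrw_bracket kappa a t <= - (c * t `^ (- 2)).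
  by move=> /andP[h /tt0 h']; apply: cB; rewrite h.
exists t1 => //; split.
  pose g x := (- p * x `^ (- 2) - kappa * x `^ (- (2 * p))) * x `^ (- p).
  have gE x : 0 < x <= t1 -> (a x)^-1 * flrw_bracket kappa a x = g x.
    by move=> xt; rewrite (bracketE kappa aE) ?tD // aE ?tD // -powRN mulrC.
  apply: (double_integral_diverges (g := g) p0 c0 t10) => //.
  - by move=> x xt; apply: aE; exact: tD.
  - move=> x x0; apply: within_continuous_mul; last exact: within_continuous_powR.
    by apply: within_continuous_sub; apply: within_continuous_mul;
      (exact: within_continuous_cst || exact: within_continuous_powR).
  - move=> x xt; rewrite -gE //; have [x0 _] := andP xt.
    rewrite aE ?tD // -powRN.
    have -> : x `^ (- 2 - p) = x `^ (- 2) * x `^ (- p).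
      by rewrite -powRD // (gt_eqF x0) /= implybT.
    by rewrite mulrA -mulNr mulrC ler_wpM2r ?powR_ge0 // tB.
(* On []0, t1]] one has [f <= 0], so [f_+] is 0 there and so are all the integrals. *)
exists 0 => //; apply: cvg_near_cst; near=> t.
have t0' : 0 < t by near: t; exact: nbhs_right_gt.
rewrite (@eq_Rintegral _ _ _ _ _ (fun=> 0)).
  by rewrite Rintegral_cst // mul0r.
move=> x; rewrite inE /= in_itv /= => /andP[/(lt_le_trans t0') x0 xt].
have xt1 : 0 < x <= t1 by rewrite x0.
apply/max_idPr; rewrite /flrw_f (derive2_a aE) ?tD // aE ?tD //.
have P0 : 0 < x `^ p by rewrite powR_gt0.
have Q0 : 0 < x `^ (- 2) by rewrite powR_gt0.
have -> : x `^ (p - 2) = x `^ p * x `^ (- 2).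
  by rewrite -powRD // (gt_eqF x0) /= implybT.
have h := h2 x; rewrite x0 tt2 // -powR_sqr in h; have {}h := ltW (h isT).
have := tB x xt1; move: (flrw_bracket _ _ _) => B hB.
have k0 : 0 <= 2 * C / x `^ p by rewrite divr_ge0 ?mulr_ge0 // ltW.
apply: (le_trans (lerD (lexx _) (ler_wpM2l k0 hB))).
move: h P0 Q0; move: (x `^ p) (x `^ (- 2)) => y z h y0 z0.
rewrite (_ : _ + _ = (3 * (p * (p - 1)) * y ^+ 2 - 2 * C * c) * (z / y)); last first.
  by field; rewrite gt_eqF.
by rewrite mulr_le0_ge0 ?subr_le0 // divr_ge0 // ltW.
Unshelve. all: by end_near. Qed.

(** * Limits of the determinants *)

Section Limits.
Context {R : realType}.
Variables (D : set R) (T : R -> R).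
Implicit Types f g : R -> R.

(** The limit is taken as the time tends to 0 along [D], whatever the affine parameter does there;
    [tau] then enters only in [vanishing_vanishes_at]. *)
Definition vanishing f := forall e : R, 0 < e -> exists2 t0 : R, 0 < t0 &
  forall s, D s -> T s < t0 -> `|f s| < e.

Definition eventually_bounded f := exists M t0 : R, 0 < t0 /\
  forall s, D s -> T s < t0 -> `|f s| <= M.

Lemma vanishing_bounded f : vanishing f -> eventually_bounded f.
Proof.
move=> /(_ 1 ltr01)[t0 t00 h]; exists 1, t0; split=> // s Ds st.
by apply: ltW; exact: h.
Qed.

Lemma bounded_cst (k : R) : eventually_bounded (fun=> k).
Proof. by exists `|k|, 1; split=> // s _ _. Qed.

Lemma bounded_add f g : eventually_bounded f -> eventually_bounded g ->
  eventually_bounded (fun s => f s + g s).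
Proof.
move=> [M [t0 [t00 hf]]] [N [t1 [t10 hg]]].
exists (M + N), (Num.min t0 t1); split=> [|s Ds]; first by rewrite lt_min t00.
rewrite lt_min => /andP[s0 s1]; apply: (le_trans (ler_normD _ _)).
by apply: lerD; [exact: hf|exact: hg].
Qed.

Lemma bounded_mul f g : eventually_bounded f -> eventually_bounded g ->
  eventually_bounded (fun s => f s * g s).
Proof.
move=> [M [t0 [t00 hf]]] [N [t1 [t10 hg]]].
exists (M * N), (Num.min t0 t1); split=> [|s Ds]; first by rewrite lt_min t00.
rewrite lt_min => /andP[s0 s1]; rewrite normrM.
by apply: ler_pM => //; [exact: hf|exact: hg].
Qed.

Lemma bounded_sum (I : Type) (r : seq I) (f : I -> R -> R) :
  (forall i, eventually_bounded (f i)) ->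
  eventually_bounded (fun s => \sum_(i <- r) f i s).
Proof.
move=> hf; elim: r => [|i r IH].
  have -> : (fun s => \sum_(i <- [::]) f i s) = fun=> 0.
    by apply/funext => s; rewrite big_nil.
  exact: bounded_cst.
have -> : (fun s => \sum_(j <- i :: r) f j s) = fun s => f i s + \sum_(j <- r) f j s.
  by apply/funext => s; rewrite big_cons.
exact: bounded_add.
Qed.

Lemma bounded_prod (I : Type) (r : seq I) (f : I -> R -> R) :
  (forall i, eventually_bounded (f i)) ->
  eventually_bounded (fun s => \prod_(i <- r) f i s).
Proof.
move=> hf; elim: r => [|i r IH].
  have -> : (fun s => \prod_(i <- [::]) f i s) = fun=> 1.
    by apply/funext => s; rewrite big_nil.
  exact: bounded_cst.
have -> : (fun s => \prod_(j <- i :: r) f j s) = fun s => f i s * \prod_(j <- r) f j s.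
  by apply/funext => s; rewrite big_cons.
exact: bounded_mul.
Qed.

Lemma bounded_det m (M : R -> 'M[R]_m) :
  (forall i j, eventually_bounded (fun s => M s i j)) ->
  eventually_bounded (fun s => \det (M s)).
Proof.
move=> hM; apply: bounded_sum => q; apply: bounded_mul; first exact: bounded_cst.
by apply: bounded_prod => i.
Qed.

Lemma bounded_adj m (M : R -> 'M[R]_m) i j :
  (forall i j, eventually_bounded (fun s => M s i j)) ->
  eventually_bounded (fun s => (\adj (M s)) i j).
Proof.
move=> hM; have -> : (fun s => (\adj (M s)) i j) =
    fun s => (-1) ^+ (j + i) * \det (row' j (col' i (M s))).
  by apply/funext => s; rewrite mxE.
apply: bounded_mul; first exact: bounded_cst.
apply: bounded_det => k l; rewrite (_ : (fun s => _) = fun s => M s (lift j k) (lift i l)) //.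
by apply/funext => s; rewrite !mxE.
Qed.

Lemma vanishing_add f g : vanishing f -> vanishing g ->
  vanishing (fun s => f s + g s).
Proof.
move=> hf hg e e0; have e2 : 0 < e / 2 by rewrite divr_gt0.
have [t0 t00 h0] := hf _ e2; have [t1 t10 h1] := hg _ e2.
exists (Num.min t0 t1) => [|s Ds]; first by rewrite lt_min t00.
rewrite lt_min => /andP[s0 s1]; apply: (le_lt_trans (ler_normD _ _)).
by rewrite (splitr e) ltrD // ?h0 ?h1.
Qed.

Lemma vanishing_mulr f g : vanishing f -> eventually_bounded g ->
  vanishing (fun s => f s * g s).
Proof.
move=> hf [M [t1 [t10 hg]]] e e0.
have M0 : 0 < `|M| + 1 by rewrite ltr_wpDl.
have [t0 t00 h0] := hf (e / (`|M| + 1)) (divr_gt0 e0 M0).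
exists (Num.min t0 t1) => [|s Ds]; first by rewrite lt_min t00.
rewrite lt_min => /andP[s0 s1]; rewrite normrM.
have h := h0 s Ds s0; rewrite ltr_pdivlMr // in h; apply: le_lt_trans h.
apply: ler_wpM2l => //; apply: (le_trans (hg s Ds s1)).
by rewrite (le_trans (ler_norm M)) // lerDl.
Qed.

Lemma vanishing_sum n (f : 'I_n -> R -> R) : (forall i, vanishing (f i)) ->
  vanishing (fun s => \sum_(i < n) f i s).
Proof.
move=> hf; elim: (index_enum _) => [|i r IH].
  by move=> e e0; exists 1 => // s _ _; rewrite big_nil normr0.
have -> : (fun s => \sum_(j <- i :: r) f j s) = fun s => f i s + \sum_(j <- r) f j s.
  by apply/funext => s; rewrite big_cons.
exact: vanishing_add.
Qed.

End Limits.

(** * Conjugacy to the singularity *)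

Section Conjugate.
Context {R : realType}.
Variables (kappa p delta : R) (a : R -> R) (S : metric_atlas R 3).
Hypothesis rS : riemannian_manifold S.
Hypothesis kS : constant_curvature S kappa.
Hypothesis sa : scale_factor a.
Hypothesis p_gt0 : 0 < p.
Hypothesis delta_gt0 : 0 < delta.
Hypothesis aE : forall t, 0 < t < delta -> a t = t `^ p.
Hypothesis cond : [\/ 0 < kappa, kappa = 0
    | kappa < 0 /\ (p < 1 \/ p = 1 /\ -1 < kappa)].
Variables (D : set R) (gam : R -> pt (flrw a S)).
Hypothesis geo : flrw_geodesic D gam.
Hypothesis nonco : non_comoving D gam.
Variable s2 : R.
Hypothesis Ds2 : D s2.

Local Notation T := (time gam).
Local Notation v := (derive1 (time gam)).

Let itvD : is_interval D. Proof. by case: geo. Qed.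
Let onto t : 0 < t <= T s2 -> exists2 r, D r & T r = t.
Proof. by case: geo => _ _ _ _; apply. Qed.

Let CE c0 s : causal_character D gam c0 -> D s ->
  a (T s) ^+ 2 * (v s ^+ 2 + c0) = a (T s2) ^+ 2 * (v s2 ^+ 2 + c0).
Proof. by move=> cs Ds; exact: (spatial_constant_const rS sa geo cs). Qed.

Let C_gt0 c0 : causal_character D gam c0 ->
  0 < a (T s2) ^+ 2 * (v s2 ^+ 2 + c0).
Proof.
move=> cs; have [i di] := exists_chart geo Ds2.
by rewrite -(spatial_constantE cs Ds2 di); exact: nonco.
Qed.

Lemma transverse_component_vanishing c0 (X X1 : R -> R) :
  causal_character D gam c0 -> c0 <= 0 ->
  (forall s, D s -> is_derive s 1 X (X1 s)) ->
  (forall s, D s -> is_derive s 1 X1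
    (- (c0 * ((kappa + derive1 a (T s) ^+ 2) / a (T s) ^+ 2) +
      ((kappa + derive1 a (T s) ^+ 2) / a (T s) ^+ 2
       - derive1n 2 a (T s) / a (T s)) * v s ^+ 2) * X s)) ->
  vanishing D T X.
Proof.
move=> cs c00 dX dX1.
exact: (transverse_vanish p_gt0 (C_gt0 cs) c00 delta_gt0 aE
  (scale_factor_gt0 sa) (derivable_scale_factor sa)
  (derivable_derive1_scale_factor sa) itvD Ds2 (time_gt0 geo)
  (derive_time_gt0 geo) (is_derive_time geo) (is_derive_velocity rS sa geo cs)
  (fun s => CE cs) onto dX dX1 cond).
Qed.

Lemma longitudinal_component_bounded (X X1 : R -> R) : timelike D gam ->
  (forall s, D s -> is_derive s 1 X (X1 s)) ->
  (forall s, D s -> is_derive s 1 X1 (derive1n 2 a (T s) / a (T s) * X s)) ->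
  eventually_bounded D T X.
Proof.
move=> cs dX dX1; have c00 : -1 <= 0 :> R by rewrite lerN10.
have [B [t0 [B0 t00 h]]] := longitudinal_bounded p_gt0 (C_gt0 cs) delta_gt0 aE
  (scale_factor_gt0 sa) (derivable_scale_factor sa)
  (derivable_derive1_scale_factor sa) itvD Ds2 (time_gt0 geo)
  (derive_time_gt0 geo) (is_derive_time geo) (is_derive_velocity rS sa geo cs)
  (fun s => CE cs) (erefl _) dX dX1.
by exists B, t0.
Qed.

Lemma vanishing_vanishes_at m (A : R -> 'M[R]_m) :
  vanishing D T (fun s => \det (A s)) -> vanishes_at D gam A 0.
Proof.
move=> hA; right; split=> //; apply/cvgrPdist_lt => e e0.
have [t0 t00 h] := hA e e0.
near=> r.
have r0 : 0 < r by near: r; exact: nbhs_right_gt.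
have rt0 : r < t0 by near: r; exact: nbhs_right_lt.
have rT : r <= T s2.
  by near: r; apply: nbhs_right_le; exact: (time_gt0 geo Ds2).
have [|q Dq Tq] := @onto r; first by rewrite r0.
(* The default value of [xget] in [tau] is avoided, since all times up to that of [s2] are
   attained. *)
have [Dt Tt] : D (tau D gam r) /\ T (tau D gam r) = r.
  by apply: (xgetPex 0 (P := [set s | D s /\ T s = r])); exists q.
by rewrite sub0r normrN; apply: h; rewrite ?Tt.
Unshelve. all: by end_near. Qed.

(** Every entry is transverse, so in an expansion along a row each term is a vanishing entry times a
    bounded cofactor. *)
Lemma null_vanishes_at (A : R -> 'M[R]_2) : null D gam ->
  quotient_jacobi_matrix D gam s2 A -> vanishes_at D gam A 0.
Proof.
move=> nul qA.
have van k l : vanishing D T (fun s => A s k l).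
  apply: (@transverse_component_vanishing 0 _ (derive1 (fun r => A r k l)) nul) => //.
    by move=> s Ds; exact: (quotient_jacobi_smooth qA).
  by move=> s Ds; exact: (quotient_jacobi_eq rS kS sa geo nul qA).
apply: vanishing_vanishes_at.
have -> : (fun s => \det (A s)) = fun s => \sum_(j < 2) A s 0 j * cofactor (A s) 0 j.
  by apply/funext => s; rewrite (expand_det_row _ 0).
apply: vanishing_sum => j; apply: vanishing_mulr => //.
have -> : (fun s => cofactor (A s) 0 j) = fun s => (\adj (A s)) j 0.
  by apply/funext => s; rewrite mxE.
by apply: bounded_adj => *; exact: vanishing_bounded.
Qed.

(** In [jacobi_matrix_eq] the rows of [A] are coupled only through [x l], the product of the column
    [l] with the constant vector [cc]. Splitting the columns along [cc] and its orthogonal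
    complement uncouples the system. *)
Lemma timelike_vanishes_at (A : R -> 'M[R]_3) : timelike D gam ->
  jacobi_matrix D gam s2 A -> vanishes_at D gam A 0.
Proof.
move=> tl [E [J [pE hJ _ hA]]]; apply: vanishing_vanishes_at.
have [cc ccE] := frame_time_const rS sa geo pE.
pose C := a (T s2) ^+ 2 * (v s2 ^+ 2 + -1).
have C0 : 0 < C by exact: C_gt0 tl.
have a0 s : D s -> a (T s) != 0.
  by move=> Ds; rewrite gt_eqF // (scale_factor_gt0 sa) // (time_gt0 geo).
have ck s i k : D s -> @dom _ _ (flrw a S) i (gam s) ->
    tcomp (n := 3) (E k i s) = cc k / a (T s).
  by move=> Ds di; rewrite -(ccE s i k Ds di) mulrAC divff ?mul1r // a0.
have vE s : D s -> v s ^+ 2 = 1 + C / a (T s) ^+ 2.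
  move=> Ds; rewrite /C -(CE tl Ds).
  by move: (a0 s Ds); move: (a _) (v s) => b y b0; field.
have ccC : \sum_(k < 3) cc k ^+ 2 = C.
  have [i di] := exists_chart geo Ds2.
  have := frame_time_sum rS sa tl pE Ds2 di.
  under eq_bigr do rewrite (ck s2 i) // exprMn exprVn.
  rewrite -mulr_suml /C => e; rewrite -[_ + -1]e mulrC divfK //.
  by rewrite expf_neq0 // a0.
pose x l s := \sum_(k < 3) cc k * A s k l.
pose x1 l s := \sum_(k < 3) cc k * derive1 (fun r => A r k l) s.
pose K s := (kappa + derive1 a (T s) ^+ 2) / a (T s) ^+ 2.
pose H s := derive1n 2 a (T s) / a (T s).
have dA k l s : D s -> is_derive s 1 (fun r => A r k l) (derive1 (fun r => A r k l) s).
  move=> Ds; have [i di] := exists_chart geo Ds.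
  have [h _] := is_derive_jacobi_matrix rS sa geo pE hJ hA k l Ds di.
  by rewrite derive1E; exact/derivableP.
have d2A k l s : D s -> is_derive s 1 (derive1 (fun r => A r k l))
    (K s * A s k l - (K s - H s) * (v s ^+ 2 * A s k l
       - cc k * x l s / a (T s) ^+ 2)).
  move=> Ds; have [i di] := exists_chart geo Ds.
  have := jacobi_matrix_eq rS kS sa geo tl pE hJ hA k l Ds di.
  move=> /is_derive_eq; apply; rewrite (ck s i) //.
  have -> : \sum_(m < 3) tcomp (n := 3) (E m i s) * A s m l = x l s / a (T s).
    by rewrite /x mulr_suml; apply: eq_bigr => m _; rewrite (ck s i) // mulrAC.
  rewrite -/(K s) -/(H s).
  by move: (a0 s Ds); move: (a _) (K s) (H s) (x l s) => b k1 k2 y b0; field.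
have dx l s : D s -> is_derive s 1 (x l) (x1 l s).
  move=> Ds; apply: is_derive_sumf => k _.
  have := is_derive_mulf (is_derive_constf (cc k) s 1) (dA k l s Ds).
  by move=> /is_derive_eq; apply; rewrite mul0r add0r.
have dx1 l s : D s -> is_derive s 1 (x1 l) (H s * x l s).
  move=> Ds; have d k : is_derive s 1 (fun r => cc k * derive1 (fun r => A r k l) r)
      ((K s - (K s - H s) * v s ^+ 2) * (cc k * A s k l)
       + (K s - H s) * x l s / a (T s) ^+ 2 * cc k ^+ 2).
    have := is_derive_mulf (is_derive_constf (cc k) s 1) (d2A k l s Ds).
    move=> /is_derive_eq; apply.
    by move: (K s) (H s) (a0 s Ds); move: (a _) (x l s) => b y k1 k2 b0; field.
  have ds : is_derive s 1 (x1 l) (\sum_(k < 3)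
      ((K s - (K s - H s) * v s ^+ 2) * (cc k * A s k l)
       + (K s - H s) * x l s / a (T s) ^+ 2 * cc k ^+ 2)).
    by apply: is_derive_sumf => k _; exact: d.
  apply: (is_derive_eq ds).
  rewrite big_split -!mulr_sumr /= ccC -/(x l s) vE //.
  by move: (K s) (H s) (a0 s Ds); move: (a _) (x l s) => b y k1 k2 b0; field.
have bx l : eventually_bounded D T (x l).
  exact: (longitudinal_component_bounded tl (dx l) (dx1 l)).
pose B s k l := A s k l - cc k / C * x l s.
have vB k l : vanishing D T (fun s => B s k l).
  apply: (@transverse_component_vanishing (-1) _
     (fun s => derive1 (fun r => A r k l) s - cc k / C * x1 l s) tl).
  - by rewrite lerN10.
  - move=> s Ds; apply: is_derive_subf; first exact: dA.
    have := is_derive_mulf (is_derive_constf (cc k / C) s 1) (dx l s Ds).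
    by move=> /is_derive_eq; apply; rewrite mul0r add0r.
  - move=> s Ds; have := is_derive_subf (d2A k l s Ds)
      (is_derive_mulf (is_derive_constf (cc k / C) s 1) (dx1 l s Ds)).
    move=> /is_derive_eq; apply; rewrite -/(K s) -/(H s) vE // /B.
    have C00 : C != 0 by rewrite gt_eqF.
    move: (K s) (H s) (a0 s Ds); move: (a _) (x l s) (A s k l) => b y z.
    by move=> k1 k2 b0; field; rewrite b0 C00.
have bA k l : eventually_bounded D T (fun s => A s k l).
  have -> : (fun s => A s k l) = fun s => B s k l + cc k / C * x l s.
    by apply/funext => s; rewrite /B subrK.
  apply: bounded_add; first exact: vanishing_bounded.
  by apply: bounded_mul => //; exact: bounded_cst.
have detE s : \det (A s) = \sum_(k < 3) \sum_(l < 3) B s k l * (2^-1 * (\adj (A s)) l k).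
  (* Since [cc] has square norm [C], this is the orthogonal projection onto its complement:
     [P A = B] and its trace is the rank 2. Taking the trace of [P A adj A = det A P] makes [det A]
     a sum of entries of [B] times bounded factors. *)
  pose P : 'M[R]_3 := 1%:M - C^-1 *: \matrix_(k, m) (cc k * cc m).
  have PA : P *m A s = \matrix_(k, l) B s k l.
    apply/matrixP => k l; rewrite mulmxBl mul1mx -scalemxAl !mxE /B; congr (_ - _).
    rewrite /x mulrC mulr_sumr mulr_suml; apply: eq_bigr => m _.
    by rewrite mxE; ring.
  have trP : \tr P = 2.
    rewrite linearB /= mxtrace1 linearZ /= /mxtrace.
    under eq_bigr do rewrite mxE -expr2.
    by rewrite ccC mulVf ?gt_eqF //; ring.
  have : \tr ((\matrix_(k, l) B s k l) *m \adj (A s)) = 2 * \det (A s).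
    by rewrite -PA -mulmxA mul_mx_adj mul_mx_scalar linearZ /= trP mulrC.
  rewrite /mxtrace => e; apply: (mulfI (_ : 2 != 0 :> R)); first by rewrite pnatr_eq0.
  rewrite -e mulr_sumr; apply: eq_bigr => k _; rewrite mxE mulr_sumr.
  by apply: eq_bigr => l _; rewrite mxE; field.
have -> : (fun s => \det (A s)) =
    fun s => \sum_(k < 3) \sum_(l < 3) B s k l * (2^-1 * (\adj (A s)) l k).
  by apply/funext.
apply: vanishing_sum => k; apply: vanishing_sum => l.
apply: vanishing_mulr => //; apply: bounded_mul; first exact: bounded_cst.
exact: bounded_adj.
Qed.

End Conjugate.

Theorem mainTheorem2 (R : realType) (eps kappa : R) (a : R -> R)
    (S : metric_atlas R 3) :
  0 < eps ->
  riemannian_manifold S -> constant_curvature S kappa ->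
  scale_factor a ->
  (exists2 delta : R, 0 < delta &
     forall t, 0 < t < delta -> a t = t `^ eps^-1) ->
  [\/ eps < 1 /\ 0 < kappa, 1 < eps \/ kappa = 0 | eps = 1 /\ -1 < kappa] ->
  (forall C : R, 0 < C -> exists2 t1 : R, 0 < t1 &
     (\int[lebesgue_measure]_(t' in `[t, t1])
        (a t' * \int[lebesgue_measure]_(t'' in `[t', t1])
                  ((a t'')^-1 * flrw_bracket kappa a t''))
        @[t --> 0^'+] --> -oo) /\
     (exists2 l : R, 0 <= l &
        \int[lebesgue_measure]_(t' in `[t, t1]) flrw_f_plus kappa a C t'
          @[t --> 0^'+] --> l)) /\
  (forall (D : set R) (gam : R -> pt (flrw a S)),
     flrw_geodesic D gam -> non_comoving D gam -> non_spacelike D gam ->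
     forall s2 : R, D s2 ->
       exists2 t' : R, 0 <= t' < time gam s2 & conjugate D gam s2 t').
Proof.
move=> e0 rS kS sa [delta d0 aE] cond.
have p0 : 0 < eps^-1 by rewrite invr_gt0.
have cond1 : [\/ 1 < eps^-1 /\ 0 < kappa, eps^-1 < 1 \/ kappa = 0
    | eps^-1 = 1 /\ -1 < kappa].
  case: cond => [[e1 k0]|[e1|k0]|[-> k1]].
  - by apply: Or31; rewrite invf_gt1.
  - by apply: Or32; left; rewrite invf_lt1.
  - by apply: Or32; right.
  - by apply: Or33; rewrite invr1.
split; first by move=> C; exact: (scale_integrals p0 d0 aE cond1).
move=> D gam geo nonco _ s2 Ds2; exists 0.
  by rewrite lexx (time_gt0 geo).
(* The three cases are sorted by the sign of [kappa]; if it is negative, only [p < 1] or [p = 1]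
   with [-1 < kappa] is left. *)
have cond2 : [\/ 0 < kappa, kappa = 0
    | kappa < 0 /\ (eps^-1 < 1 \/ eps^-1 = 1 /\ -1 < kappa)].
  have [k0|k0|k0] := ltrgtP kappa 0; last by apply: Or32.
    apply: Or33; split=> //; case: cond1 => [[_]|[h|h]|h].
    - by rewrite ltNge ltW.
    - by left.
    - by move: k0; rewrite h ltxx.
    - by right.
  by apply: Or31.
by split=> h A hA;
  [exact: (timelike_vanishes_at rS kS sa p0 d0 aE cond2 geo nonco Ds2 h hA)
  |exact: (null_vanishes_at rS kS sa p0 d0 aE cond2 geo nonco Ds2 h hA)].
Qed.
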